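(* Let $(E,F)$ be a complex Finsler bundle, where $\pi:E\to M$ is a holomorphic vector bundle of rank $m$ over an $n$-dimensional complex manifold $M$. Let $\sigma:M\to\mathbb{R}$ be a smooth function and let $\widetilde F$ be the complex Finsler structure on $E$ given by $\widetilde F^2=e^{\sigma(z)}F^2$. Let $\nabla$ and $\widetilde\nabla$ be the partial Bott complex connections of $(E,F)$ and $(E,\widetilde F)$. Then for every $j=1,\dots,m$ the horizontal classes of Chern type of order $j$ coincide, $c^h_j(\widetilde\nabla)=c^h_j(\nabla)$; that is, the horizontal forms of Chern type $\mathcal{C}^h_j(\widetilde\nabla)$ and $\mathcal{C}^h_j(\nabla)$ lie in the same $d^{\prime\prime h}$-cohomology class (their difference is $d^{\prime\prime h}\psi$ for some horizontal form $\psi$ of type $(j,j-1,0,0)$), where $d^{\prime\prime h}$ is the operator determined by $F$.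
   Context: Coordinates: $(z^k)_{k=1}^n$ are local holomorphic coordinates on $M$, $(s_a)_{a=1}^m$ a local holomorphic frame of $E$, and $(z^k,\eta^a)$ the induced local coordinates on $E$ (the point is $\eta^a s_a(z)$); they change by $z'^k=z'^k(z)$, $\eta'^a=M^a_b(z)\eta^b$ with $M$ holomorphic and invertible. Write $\partial_k=\partial/\partial z^k$, $\dot\partial_a=\partial/\partial\eta^a$, $\dot\partial_{\overline a}=\partial/\partial\overline\eta^a$, and $E^*=E\setminus\{\text{zero section}\}$. Summation convention is used. Complex Finsler bundle: a pair $(E,F)$ with $F:E\to[0,\infty)$ such that (1) $F^2$ is smooth on $E^*$; (2) $F(z,\eta)=0$ iff $\eta=0$; (3) $F(z,\lambda\eta)=|\lambda|F(z,\eta)$ for all $\lambda\in\mathbb{C}\setminus\{0\}$; (4) the matrix $h_{a\overline b}=\dot\partial_a\dot\partial_{\overline b}(F^2)$ is positive definite on $E^*$ (strict pseudoconvexity). Chern–Finsler nonlinear connection: $N^a_k=h^{\overline c a}\,\partial_k\dot\partial_{\overline c}(F^2)$, where $(h^{\overline c a})$ is the inverse of $(h_{a\overline c})$. Set $\delta_k=\partial_k-N^a_k\dot\partial_a$ and $\delta_{\overline k}=\overline{\delta_k}$. It is known that $[\delta_j,\delta_k]=0$. The $\delta_k$ span the horizontal bundle $H'E$, and the $\dot\partial_a$ span the vertical bundle $V'E$, with $T'E=H'E\oplus V'E$. Partial Bott complex connection $\nabla$ of $(E,F)$: $\nabla_XY=v'[X,Y]$ for $X\in\Gamma(H'E)$,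 $Y\in\Gamma(V'E)$, where $v'$ is the vertical projection. Its connection form is $\omega=(\omega^a_b)$, $\omega^a_b=L^a_{bk}dz^k$, $L^a_{bk}=\dot\partial_b(N^a_k)$, and its horizontal curvature form is $\Omega=(\Omega^a_b)$, $\Omega^a_b=\Omega^a_{bj\overline k}\,dz^j\wedge d\overline z^k$, $\Omega^a_{bj\overline k}=-\delta_{\overline k}(L^a_{bj})$. Horizontal forms: $\mathcal{A}^{p,q,0,0}$ is the space of smooth complex forms on $E^*$ locally of the form $\varphi=\frac{1}{p!q!}\varphi_{I_p\overline{J_q}}(z,\eta)\,dz^{I_p}\wedge d\overline z^{J_q}$ (coefficients may depend on $\eta$). The operator $d^{\prime\prime h}:\mathcal{A}^{p,q,0,0}\to\mathcal{A}^{p,q+1,0,0}$ is $$(d^{\prime\prime h}\varphi)_{I_p\overline{j_1}\dots\overline{j_{q+1}}}=(-1)^p\sum_{k=1}^{q+1}(-1)^{k-1}\delta_{\overline{j_k}}\big(\varphi_{I_p\overline{j_1}\dots\widehat{\overline{j_k}}\dots\overline{j_{q+1}}}\big),$$ and $d^{\prime\prime h}\circ d^{\prime\prime h}=0$. The $h''$-cohomology groups are $H^q(E,\Phi^{p,0,0})=\ker(d^{\prime\prime h}|\mathcal{A}^{p,q,0,0})/d^{\prime\prime h}\mathcal{A}^{p,q-1,0,0}$. Horizontal forms of Chern type: $\mathcal{C}^h_j(\nabla)\in\mathcal{A}^{j,j,0,0}$ is defined by $\det\left(I_m-\frac{1}{2\pi i}\Omega\right)=\sum_{j=0}^m\mathcal{C}^h_j(\nabla)$,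 i.e. $\mathcal{C}^h_j(\nabla)=\frac{(-1)^j}{(2\pi i)^jj!}\sum\delta^{b_1\dots b_j}_{a_1\dots a_j}\Omega^{a_1}_{b_1}\wedge\dots\wedge\Omega^{a_j}_{b_j}$ with $\delta^{b_1\dots b_j}_{a_1\dots a_j}$ the generalized Kronecker symbol. These are globally defined and $d^{\prime\prime h}$-closed, and $c^h_j(\nabla)=[\mathcal{C}^h_j(\nabla)]\in H^j(E,\Phi^{j,0,0})$ is the horizontal class of Chern type of order $j$. The connection $\widetilde\nabla$ and forms $\mathcal{C}^h_j(\widetilde\nabla)$ are obtained by the same formulas with $F$ replaced by $\widetilde F$. *)

(* Defs.v *)
From HB Require Import structures.
From mathcomp Require Import all_boot all_order all_algebra perm.
From mathcomp Require Import complex.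
From mathcomp Require Import boolp classical_sets functions reals topology.
From mathcomp Require Import normedtype derive exp trigo.

Set Implicit Arguments.
Unset Strict Implicit.
Unset Printing Implicit Defensive.

Import Order.TTheory GRing.Theory Num.Theory numFieldNormedType.Exports.

Local Open Scope classical_set_scope.
Local Open Scope ring_scope.
Local Open Scope complex_scope.

Section Calculus.
Context {R : realType} {N : nat}.
Implicit Types (U : set 'rV[R[i]]_N) (f : 'rV[R[i]]_N -> R[i]).
Implicit Types (v w : 'rV[R[i]]_N).

(* The topology of C^N is found by the library on matrices over R[i]^o. *)
Definition openCN U : Prop := open (U : set 'rV[R[i]^o]_N).

Definition continuousCN f w : Prop :=
  {for w, continuous (f : 'rV[R[i]^o]_N -> R[i]^o)}.

(* Derivatives along real lines t |-> w + t v. *)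
Definition rderivable f w v : Prop :=
  derivable (fun t : R => complex.Re (f (w + t%:C *: v))) 0 1 /\
  derivable (fun t : R => complex.Im (f (w + t%:C *: v))) 0 1.

Definition rderive v f w : R[i] :=
  derive1 (fun t : R => complex.Re (f (w + t%:C *: v))) 0 +i*
  derive1 (fun t : R => complex.Im (f (w + t%:C *: v))) 0.

(* With w^l = x^l + i y^l: unit vector of x^l (b = false) or y^l (b = true). *)
Definition rdir (l : 'I_N) (b : bool) : 'rV[R[i]]_N :=
  (if b then 'i else 1) *: delta_mx 0 l.

Fixpoint Ck (k : nat) U f : Prop :=
  (forall w, U w -> continuousCN f w) /\
  if k is k'.+1 then
    forall l b, (forall w, U w -> rderivable f w (rdir l b)) /\
                Ck k' U (rderive (rdir l b) f)
  else True.

Definition smooth U f : Prop := forall k, Ck k U f.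

(* Wirtinger derivatives d/dw^l and d/d(conj w^l). *)
Definition dC (l : 'I_N) f w : R[i] :=
  (rderive (rdir l false) f w - 'i%C * rderive (rdir l true) f w) / 2.

Definition dCbar (l : 'I_N) f w : R[i] :=
  (rderive (rdir l false) f w + 'i%C * rderive (rdir l true) f w) / 2.

Definition holomorphic U f : Prop :=
  smooth U f /\ forall w l, U w -> dCbar l f w = 0.

End Calculus.

(* An n-dimensional complex structure on M, as a holomorphic atlas; [cpt i] is
   the inverse of the chart [crd i] and is irrelevant outside its image. *)
Record complex_manifold (R : realType) (n : nat) (M : topologicalType) :=
  ComplexManifold {
    chart : Type;
    cdom : chart -> set M;
    crd : chart -> M -> 'rV[R[i]]_n;
    cpt : chart -> 'rV[R[i]]_n -> M;
    mfd_hausdorff : hausdorff_space M;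
    mfd_countable : @second_countable M;
    cdom_open : forall i, open (cdom i);
    cdom_cover : forall x, exists i, cdom i x;
    crdK : forall i x, cdom i x -> cpt i (crd i x) = x;
    cimg_open : forall i, openCN (crd i @` cdom i);
    crd_continuous : forall i x, cdom i x ->
      {for x, continuous (crd i : M -> 'rV[R[i]^o]_n)};
    cpt_continuous : forall i z, (crd i @` cdom i) z ->
      {for z, continuous (cpt i : 'rV[R[i]^o]_n -> M)};
    crd_holomorphic : forall i i' l,
      holomorphic (crd i @` (cdom i `&` cdom i'))
        (fun z => crd i' (cpt i z) 0 l) }.

(* A holomorphic vector bundle of rank m with fibres [E x], given by local
   holomorphic frames; [ftrans al be x] is the matrix (M^a_b) of the change of
   fibre coordinates eta'^a = M^a_b eta^b from frame al to frame be. *)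
Record holomorphic_bundle (R : realType) (n : nat) (M : topologicalType)
    (X : complex_manifold R n M) (m : nat) (E : M -> lmodType R[i]) :=
  HolomorphicBundle {
    fidx : Type;
    fdom : fidx -> set M;
    frame : fidx -> forall x, 'I_m -> E x;
    ftrans : fidx -> fidx -> M -> 'M[R[i]]_m;
    fdom_open : forall al, open (fdom al);
    fdom_cover : forall x, exists al, fdom al x;
    frame_basis : forall al x, fdom al x -> forall v : E x,
      exists! eta : 'rV[R[i]]_m, v = \sum_a eta 0 a *: frame al x a;
    ftransE : forall al be x, fdom al x -> fdom be x -> forall b,
      frame al x b = \sum_a ftrans al be x a b *: frame be x a;
    ftrans_holomorphic : forall i al be a b,
      holomorphic (@crd _ _ _ X i @` (@cdom _ _ _ X i `&` fdom al `&` fdom be))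
        (fun z => ftrans al be (@cpt _ _ _ X i z) a b) }.

Arguments chart {R n M} X : rename.
Arguments cdom {R n M X} i x : rename.
Arguments crd {R n M X} i x : rename.
Arguments cpt {R n M X} i z : rename.
Arguments fidx {R n M X m E} B : rename.
Arguments fdom {R n M X m E B} al x : rename.
Arguments frame {R n M X m E B} al x a : rename.
Arguments ftrans {R n M X m E B} al be x : rename.

Definition smooth_on_manifold (R : realType) (n : nat) (M : topologicalType)
    (X : complex_manifold R n M) (sigma : M -> R) : Prop :=
  forall i : chart X,
    smooth (crd i @` cdom i) (fun z => (sigma (cpt i z))%:C).

Section Bundle.
Context {R : realType} {n : nat} {M : topologicalType}.
Context {X : complex_manifold R n M} {m : nat} {E : M -> lmodType R[i]}.
Context (B : holomorphic_bundle X m E).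

Local Notation C := R[i].
(* w = (z, eta), i.e. z^k = w 0 (lshift m k) and eta^a = w 0 (rshift n a). *)
Local Notation coords := 'rV[C]_(n + m).

(* A chart of M and a frame of E, giving induced coordinates (z, eta) over the
   intersection of their domains. *)
Definition echart : Type := (chart X * fidx B)%type.

(* The part of the coordinate domain where eta <> 0, i.e. lying in E^*. *)
Definition edom (c : echart) : set coords :=
  [set w | (crd c.1 @` (cdom c.1 `&` fdom c.2)) (lsubmx w) /\ rsubmx w <> 0].

Definition base_pt (c : echart) (w : coords) : M := cpt c.1 (lsubmx w).

Definition fibre_pt (c : echart) (w : coords) : E (base_pt c w) :=
  \sum_a w 0 (rshift n a) *: frame c.2 (base_pt c w) a.

Definition dz (k : 'I_n) : (coords -> C) -> coords -> C := dC (lshift m k).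
Definition deta (a : 'I_m) : (coords -> C) -> coords -> C := dC (rshift n a).
Definition detabar (a : 'I_m) : (coords -> C) -> coords -> C :=
  dCbar (rshift n a).

Section Finsler.
Variable F : forall x : M, E x -> R.

Definition Fsq (c : echart) (w : coords) : C :=
  (F (fibre_pt c w) ^+ 2)%:C.

(* Entry (a, b) is h_{a bbar}. *)
Definition hmx (c : echart) (w : coords) : 'M[C]_m :=
  \matrix_(a, b) deta a (detabar b (Fsq c)) w.

Definition complex_finsler : Prop :=
  [/\ forall x (v : E x), 0 <= F v,
      forall c, smooth (edom c) (Fsq c),
      forall x (v : E x), F v = 0 <-> v = 0,
      forall x (v : E x) (lam : C), lam != 0 ->
        (F (lam *: v))%:C = `|lam| * (F v)%:C
    & forall c w, edom c w -> forall xi : 'rV[C]_m, xi != 0 ->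
        0 < \sum_a \sum_b hmx c w a b * xi 0 a * conjc (xi 0 b)].

(* N^a_k; entry (d, a) of the inverse matrix is h^{dbar a}. *)
Definition Ncoef (c : echart) (a : 'I_m) (k : 'I_n) (w : coords) : C :=
  \sum_d invmx (hmx c w) d a * dz k (detabar d (Fsq c)) w.

(* Local vector fields of type (1,0), by their components. *)
Definition vfield : Type := 'I_(n + m) -> coords -> C.

Definition vapply (Y : vfield) (f : coords -> C) (w : coords) : C :=
  \sum_l Y l w * dC l f w.

(* The action of the conjugate field. *)
Definition vapply_bar (Y : vfield) (f : coords -> C) (w : coords) : C :=
  \sum_l conjc (Y l w) * dCbar l f w.

(* The bracket of (1,0) fields is of type (1,0), their coefficients being
   differentiated in the holomorphic directions only. *)
Definition bracket (Y Z : vfield) : vfield :=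
  fun l w => vapply Y (Z l) w - vapply Z (Y l) w.

Definition delta_field (c : echart) (k : 'I_n) : vfield :=
  fun l w => match fintype.split l with
             | inl j => (j == k)%:R
             | inr a => - Ncoef c a k w
             end.

Definition vert_field (b : 'I_m) : vfield := fun l _ => (l == rshift n b)%:R.

(* Components of v' Z on the deta_a, along the horizontal bundle:
   d/dz^k = delta_k + N^a_k deta_a. *)
Definition vproj (c : echart) (Z : vfield) (a : 'I_m) (w : coords) : C :=
  Z (rshift n a) w + \sum_k Ncoef c a k w * Z (lshift m k) w.

(* The partial Bott connection nabla_Y Z = v'[Y, Z]. *)
Definition bott (c : echart) (Y Z : vfield) : 'I_m -> coords -> C :=
  vproj c (bracket Y Z).

(* L^a_{bk}, where nabla_{delta_k} deta_b = L^a_{bk} deta_a; expanding the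
   bracket gives deta_b (N^a_k). *)
Definition Lcoef (c : echart) (a b : 'I_m) (k : 'I_n) : coords -> C :=
  bott c (delta_field c k) (vert_field b) a.

Definition delta_bar (c : echart) (k : 'I_n) : (coords -> C) -> coords -> C :=
  vapply_bar (delta_field c k).

(* Omega^a_{b j kbar}. *)
Definition Omega (c : echart) (a b : 'I_m) (j k : 'I_n) (w : coords) : C :=
  - delta_bar c k (Lcoef c a b j) w.

End Finsler.

(* Local coefficients phi_{I Jbar}, in every bundle chart, of
   1/(p! q!) phi_{I Jbar} dz^I /\ dzbar^J. *)
Definition hcoef (p q : nat) : Type :=
  echart -> {ffun 'I_p -> 'I_n} -> {ffun 'I_q -> 'I_n} -> coords -> C.

Definition echange (c c' : echart) (w : coords) : coords :=
  row_mx (crd c'.1 (base_pt c w))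
         (rsubmx w *m (ftrans c.2 c'.2 (base_pt c w))^T).

(* d z'^l / d z^k. *)
Definition jac (c c' : echart) (k l : 'I_n) (w : coords) : C :=
  dC k (fun z => crd c'.1 (cpt c.1 z) 0 l) (lsubmx w).

(* Membership in A^{p,q,0,0}: coefficients smooth on E^*, alternating, and
   patching to a global form. *)
Definition hform (p q : nat) (phi : hcoef p q) : Prop :=
  [/\ forall c I J, smooth (edom c) (phi c I J),
      forall c w, edom c w ->
        forall (I : {ffun 'I_p -> 'I_n}) (J : {ffun 'I_q -> 'I_n})
               (s : {perm 'I_p}) (t : {perm 'I_q}),
        phi c [ffun r => I (s r)] [ffun r => J (t r)] w =
        (-1) ^+ s * (-1) ^+ t * phi c I J w
    & forall c c' w, edom c w ->
        cdom c'.1 (base_pt c w) -> fdom c'.2 (base_pt c w) ->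
        forall I J, phi c I J w =
          \sum_(K : {ffun 'I_p -> 'I_n}) \sum_(L : {ffun 'I_q -> 'I_n})
            (\prod_r jac c c' (I r) (K r) w) *
            (\prod_r conjc (jac c c' (J r) (L r) w)) *
            phi c' K L (echange c c' w)].

(* Equality of the forms represented on E^*. *)
Definition heq (p q : nat) (phi psi : hcoef p q) : Prop :=
  forall c w, edom c w -> forall I J, phi c I J w = psi c I J w.

Definition hzero (p q : nat) : hcoef p q := fun _ _ _ _ => 0.

Definition hsub (p q : nat) (phi psi : hcoef p q) : hcoef p q :=
  fun c I J w => phi c I J w - psi c I J w.

Section Cohomology.
Variable F : forall x : M, E x -> R.

(* The operator d''^h of F; the index k starts from 0. *)
Definition dbarh (p q : nat) (phi : hcoef p q) : hcoef p q.+1 :=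
  fun c I J w =>
    (-1) ^+ p * \sum_(k < q.+1)
      (-1) ^+ k * delta_bar F c (J k) (phi c I [ffun r => J (lift k r)]) w.

Definition hclosed (p q : nat) (phi : hcoef p q) : Prop :=
  hform phi /\ heq (dbarh phi) (@hzero p q.+1).

(* A^{p,-1,0,0} is zero. *)
Definition hexact (p q : nat) : hcoef p q -> Prop :=
  match q with
  | 0 => fun phi => heq phi (@hzero p 0)
  | q'.+1 => fun phi =>
      exists psi : hcoef p q', hform psi /\ heq phi (dbarh psi)
  end.

(* The class of a closed phi in H^q(E, Phi^{p,0,0}), as a coset of closed
   forms. *)
Definition hclass (p q : nat) (phi : hcoef p q) : set (hcoef p q) :=
  [set chi | hclosed chi /\ hexact (hsub chi phi)].

End Cohomology.

(* Coefficients of theta_1 /\ ... /\ theta_j for the (1,1)-forms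
   theta_r = th r k l dz^k /\ dzbar^l. Moving all dz^k to the left gives the
   sign (-1)^(j(j-1)/2); the coefficients are then antisymmetrized, without
   the factor 1/(j! j!), which is part of the convention in hcoef. *)
Definition wedge11 (j : nat) (th : 'I_j -> 'I_n -> 'I_n -> C)
    (K L : {ffun 'I_j -> 'I_n}) : C :=
  (-1) ^+ 'C(j, 2) *
  \sum_(s : {perm 'I_j}) \sum_(t : {perm 'I_j})
    (-1) ^+ s * (-1) ^+ t * \prod_r th r (K (s r)) (L (t r)).

Definition gen_kronecker (j : nat) (b a : {ffun 'I_j -> 'I_m}) : C :=
  \det (\matrix_(r < j, s < j) (b r == a s)%:R).

Definition chern_form (F : forall x : M, E x -> R) (j : nat) : hcoef j j :=
  fun c K L w =>
    (-1) ^+ j / ((2 * (pi : R)%:C * 'i%C) ^+ j * j`!%:R) *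
    \sum_(a : {ffun 'I_j -> 'I_m}) \sum_(b : {ffun 'I_j -> 'I_m})
      gen_kronecker b a *
      wedge11 (fun r k l => Omega F c (a r) (b r) k l w) K L.

(* c^h_j of the partial Bott connection of G, in the cohomology of F. *)
Definition chern_class (F G : forall x : M, E x -> R) (j : nat) :
    set (hcoef j j) :=
  hclass F (@chern_form G j).

End Bundle.

Arguments chern_form {R n M X m E} B F j c K L w.
Arguments chern_class {R n M X m E} B F G j.
Arguments hclosed {R n M X m E B} F {p q} phi.

(* Main.v *)
Require Import Defs.
From mathcomp Require Import all_boot all_order all_algebra all_fingroup.
From mathcomp Require Import complex.
From mathcomp Require Import boolp classical_sets functions reals topology.
From mathcomp Require Import normedtype derive realfun sequences exp trigo.
From mathcomp Require Import ring lra.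

Set Implicit Arguments.
Unset Strict Implicit.
Unset Printing Implicit Defensive.

Import Order.TTheory GRing.Theory Num.Theory numFieldNormedType.Exports.

Local Open Scope classical_set_scope.
Local Open Scope ring_scope.
Local Open Scope complex_scope.

(** Locally, F^2 is a function of (z, eta), and the delta_k are the lifts of the
    d/dz^k that annihilate all the d(F^2)/d(conj eta^d). This description gives
    [delta_j, delta_k] = 0 and the behaviour of the connection under changes of
    chart and frame. For e^sigma F^2 it yields, with alpha_k = d sigma/dz^k, the
    coefficients N^a_k + alpha_k eta^a and L^a_bk + alpha_k delta^a_b. The fields
    delta_bar_k change by multiples of the conjugate Euler field, which by
    homogeneity annihilates the L^a_bk. So both curvatures are d''^h-closed for F,
    and they differ by the scalar matrix of delta_bar_l (alpha_k).

    The form of Chern type is, up to a constant, P(Omega, ..., Omega) for a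
    multilinear invariant P. Replacing the curvatures one slot at a time, the
    difference is a sum of terms P(..., delta_bar alpha I, ...) whose other entries
    are closed, and each is, up to sign, d''^h P(..., alpha I, ...). *)

(** * Smooth functions and Wirtinger derivatives on C^N *)

(** Smoothness means that all iterated partial derivatives along real coordinate lines exist and are
    continuous. Symmetry of second derivatives and the chain rule therefore both come from the
    one-variable mean value theorem, applied to real and imaginary parts. The inverse of h serves
    only to define N and to see that it is smooth. The laws for N are found by contracting with h:
    vertical vectors with equal contractions coincide. Changes of chart and frame are holomorphic,
    so every delta_bar kills their coefficients. Hence d''^h acts on curvature matrices entry by
    entry, closedness involves no commutator with the connection, and conjugation invariance of P is
    needed only to patch charts. Since sigma lives on M, alpha is a (1,0)-form and alpha I
    transforms like an endomorphism-valued form, although the connection coefficients do not. This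
    makes P(..., alpha I, ...) a global form. Each form is handled as the alternation of a tensor.
    The slot that receives the new index of d''^h can then be chosen freely, at the price of a
    single sign. *)

Section RealDerivative.
Context {R : realType}.
Implicit Types (f : R -> R) (a d : R).

(** Little-o form of the derivative: without a quotient, the estimates of the chain rule need not
    exclude [t = 0]. *)
Lemma is_derive0P f d : is_derive (0 : R) 1 f d <->
  forall e : R, 0 < e ->
    \forall t \near (0 : R), `|f t - f 0 - t * d| <= e * `|t|.
Proof.
split=> [[dr dv] e e0|H].
  have cv : h^-1 *: ((f \o shift 0) (h *: 1) - f 0) @[h --> 0^'] --> d.
    by rewrite -dv; exact: dr.
  have : \forall h \near 0^', `|d - h^-1 *: ((f \o shift 0) (h *: 1) - f 0)| <= e.
    by apply: cvgr_dist_le.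
  rewrite near_withinE => {}cv; near=> t.
  have [->|t0] := eqVneq t 0; first by rewrite !subrr mul0r subr0 normr0 mulr0.
  have : t != 0 -> `|d - t^-1 *: ((f \o shift 0) (t *: 1) - f 0)| <= e.
    by near: t.
  move=> /(_ t0); rewrite /shift /= [_ *: 1]mulr1 addr0 => le.
  have -> : f t - f 0 - t * d = - ((d - t^-1 * (f t - f 0)) * t).
    by field.
  by rewrite normrN normrM ler_wpM2r.
have cv : h^-1 *: ((f \o shift 0) (h *: 1) - f 0) @[h --> 0^'] --> d.
  apply/cvgrPdist_le => e e0; have := H e e0.
  rewrite near_withinE => cv; near=> t => /= t0.
  have : `|f t - f 0 - t * d| <= e * `|t| by near: t.
  have -> : f t - f 0 - t * d = - ((d - t^-1 * (f t - f 0)) * t).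
    by field.
  by rewrite normrN normrM ler_pM2r ?normr_gt0// /shift addr0 [_ *: 1]mulr1.
by split; [apply/cvg_ex; exists d|exact/cvg_lim].
Unshelve. all: by end_near. Qed.

End RealDerivative.

Section ComplexTopology.
Context {R : realType}.
Local Notation C := R[i].

Lemma continuous_Re : continuous (@complex.Re R : R[i]^o -> R).
Proof.
move=> z; apply/(@cvgrPdist_lt _ _ _ (nbhs z)) => e e0.
apply/nbhs_ballP; exists (e%:C); first by rewrite /= ltcR.
move=> y; rewrite -ball_normE /= => yz; rewrite -ltcR; apply: le_lt_trans yz.
have -> : complex.Re z - complex.Re y = complex.Re ((z : C) - y).
  by case: (z) (y) => [? ?] [? ?].
exact: normc_ge_Re.
Qed.

Lemma continuous_conjc : continuous (@conjc R : R[i]^o -> R[i]^o).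
Proof.
move=> z; apply/(@cvgrPdist_lt _ _ _ (nbhs z)) => e e0.
apply/nbhs_ballP; exists e => // y; rewrite -ball_normE /= => yz.
by apply: le_lt_trans yz; rewrite -(rmorphB (@conjc R)) normcJ.
Qed.

Lemma continuous_Im : continuous (@complex.Im R : R[i]^o -> R).
Proof.
move=> z.
rewrite (_ : @complex.Im R = fun z : C => complex.Re (- 'i * z)); last first.
  by apply/funext => -[a b] /=; ring.
apply: (@continuous_comp _ _ _ (fun z : R[i]^o => - 'i * z)); last first.
  exact: continuous_Re.
exact: mulrl_continuous.
Qed.

Lemma continuous_real_complex : continuous (fun t : R => t%:C : R[i]^o).
Proof.
move=> t; apply/(@cvgrPdist_lt _ _ _ (nbhs t)) => e e0.
have [r er] : exists r : R, e = r%:C.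
  by apply/complex_realP; rewrite gtr0_real.
apply/nbhs_ballP; exists r; first by rewrite /= -ltcR -er.
move=> y; rewrite -ball_normE /= => yz.
by rewrite -(rmorphB (real_complex R)) normc_def /= expr0n addr0 sqrtr_sqr er ltcR.
Qed.

End ComplexTopology.

Section CurveDerivative.
Context {R : realType}.
Local Notation C := R[i].
Implicit Types (p q : R -> C) (a b d : C).

Definition is_cderive p d : Prop :=
  is_derive (0 : R) 1 (fun t => complex.Re (p t)) (complex.Re d) /\
  is_derive (0 : R) 1 (fun t => complex.Im (p t)) (complex.Im d).

Lemma is_cderive_unique p a b : is_cderive p a -> is_cderive p b -> a = b.
Proof.
move=> [[_ ar] [_ ai]] [[_ br] [_ bi]].
by apply/eqP; rewrite eq_complex -ar -ai -br -bi !eqxx.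
Qed.

Lemma is_cderive_near p q d :
  (\forall t \near 0, p t = q t) -> is_cderive p d -> is_cderive q d.
Proof.
move=> pq [dr di]; split.
  by apply: near_eq_is_derive dr; apply: filterS pq => t ->.
by apply: near_eq_is_derive di; apply: filterS pq => t ->.
Qed.

Lemma is_cderive_cst a : is_cderive (fun=> a) 0.
Proof. by split; exact: is_derive_cst. Qed.

Lemma is_cderiveD p q a b : is_cderive p a -> is_cderive q b ->
  is_cderive (fun t => p t + q t) (a + b).
Proof.
move=> [pr pi] [qr qi]; split.
  rewrite (_ : (fun t => _) = (fun t => complex.Re (p t)) + (fun t => complex.Re (q t))).
    by rewrite raddfD; exact: is_deriveD.
  by apply/funext => t; rewrite !fctE raddfD.
rewrite (_ : (fun t => _) = (fun t => complex.Im (p t)) + (fun t => complex.Im (q t))).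
  by rewrite raddfD; exact: is_deriveD.
by apply/funext => t; rewrite !fctE raddfD.
Qed.

Lemma is_cderiveM p q a b : is_cderive p a -> is_cderive q b ->
  is_cderive (fun t => p t * q t) (a * q 0 + p 0 * b).
Proof.
move=> [pr pi] [qr qi]; split.
  rewrite (_ : (fun t => _) = (fun t => complex.Re (p t)) * (fun t => complex.Re (q t))
    - (fun t => complex.Im (p t)) * (fun t => complex.Im (q t))).
    apply: is_derive_eq (is_deriveB (is_deriveM pr qr) (is_deriveM pi qi)) _.
    case: (p 0) (q 0) a b {pr pi qr qi} => [? ?] [? ?] [? ?] [? ?] /=.
    by rewrite !/(_ *: _) /=; ring.
  by apply/funext => t; rewrite !fctE; case: (p t) (q t) => [? ?] [? ?].
rewrite (_ : (fun t => _) = (fun t => complex.Re (p t)) * (fun t => complex.Im (q t))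
    + (fun t => complex.Im (p t)) * (fun t => complex.Re (q t))).
  apply: is_derive_eq (is_deriveD (is_deriveM pr qi) (is_deriveM pi qr)) _.
  by case: (p 0) (q 0) a b {pr pi qr qi} => [? ?] [? ?] [? ?] [? ?] /=; rewrite !/(_ *: _) /=; ring.
by apply/funext => t; rewrite !fctE; case: (p t) (q t) => [? ?] [? ?].
Qed.

Lemma is_cderive_conjc p a :
  is_cderive p a -> is_cderive (fun t => conjc (p t)) (conjc a).
Proof.
move=> [pr pi]; split.
  rewrite (_ : (fun t => _) = (fun t => complex.Re (p t))); last first.
    by apply/funext => t; case: (p t).
  by case: a pr pi.
rewrite (_ : (fun t => _) = - (fun t => complex.Im (p t))); last first.
  by apply/funext => t; rewrite !fctE; case: (p t).
by apply: is_derive_eq (is_deriveN pi) _; case: a {pr pi}.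
Qed.

Lemma is_cderive_real (r : R -> R) (d : R) :
  is_derive (0 : R) 1 r d -> is_cderive (fun t => (r t)%:C) d%:C.
Proof. by move=> rd; split => //=; exact: is_derive_cst. Qed.

(** Since [p^-1 = conjc p / |p|^2] has a real denominator, the product rule and the real inverse
    suffice. *)
Lemma is_cderiveV p a : p 0 != 0 -> is_cderive p a ->
  is_cderive (fun t => (p t)^-1) (- a / p 0 ^+ 2).
Proof.
move=> p0 pa; have pJ := is_cderive_conjc pa.
pose N t := complex.Re (p t * conjc (p t)).
have NE t : (N t)%:C = p t * conjc (p t).
  by rewrite /N; case: (p t) => x y; apply/eqP; rewrite eq_complex /= eqxx; apply/eqP; ring.
have [/= dN _] := is_cderiveM pa pJ; rewrite -/N in dN.
set n' := complex.Re _ in dN.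
have n'E : n'%:C = a * conjc (p 0) + p 0 * conjc a.
  rewrite /n'; case: (p 0) (a) => x y [u v].
  by apply/eqP; rewrite eq_complex /= eqxx; apply/eqP; ring.
have N0 : N 0 != 0.
  by apply: contra_neq p0 => /(congr1 (real_complex R))/eqP;
    rewrite NE mulf_eq0 conjc_eq0 orbb => /eqP.
have dV := is_cderive_real (is_deriveV N0 dN).
have -> : (fun t => (p t)^-1) = (fun t => conjc (p t) * ((N t)^-1)%:C).
  apply/funext => t; rewrite -[(_^-1)%:C]/(real_complex R _) fmorphV /= NE.
  (* The identity is needed at every [t]; at a zero of [p] it holds because [0^-1 = 0]. *)
  have [->|pt] := eqVneq (p t) 0.
    by rewrite rmorph0 mul0r invr0.
  by field; rewrite conjc_eq0 pt.
have := is_cderiveM pJ dV; congr is_cderive.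
rewrite (_ : (- N 0 ^- 2 *: n')%:C = - n'%:C / (N 0)%:C ^+ 2); last first.
  by rewrite -rmorphXn -fmorphV -rmorphN -rmorphM mulNr mulrC -mulNr.
rewrite -[((N 0)^-1)%:C]/(real_complex R _) fmorphV /= NE n'E.
by field; rewrite conjc_eq0 p0.
Qed.

End CurveDerivative.

(** * Derivatives along real lines and stability of the classes C^k *)

Section LineDerivative.
Context {R : realType} {N : nat}.
Local Notation C := R[i].
Local Notation V := 'rV[C]_N.
Implicit Types (U : set V) (f g : V -> C) (v w : V) (a b d : C).

Definition is_rderive f w v d : Prop :=
  is_cderive (fun t : R => f (w + t%:C *: v)) d.

Lemma is_rderiveP f w v : rderivable f w v <-> is_rderive f w v (rderive v f w).
Proof.
split=> [[dr di]|[[dr _] [di _]]]; last by split; [exact: dr|exact: di].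
by split; rewrite /rderive /= derive1E; [exact: (derivableP dr)|exact: (derivableP di)].
Qed.

Lemma rderive_val f w v d : is_rderive f w v d -> rderive v f w = d.
Proof.
by case=> [[_ dr] [_ di]]; rewrite /rderive !derive1E dr di; case: (d).
Qed.

Lemma is_rderive_able f w v d : is_rderive f w v d -> rderivable f w v.
Proof. by case=> [[dr _] [di _]]; split; [exact: dr|exact: di]. Qed.

Lemma line_continuous w v :
  {for 0, continuous (fun t : R => w + t%:C *: v : 'rV[R[i]^o]_N)}.
Proof.
apply: (@continuousD _ _ _ (fun=> w) (fun t : R => t%:C *: v : 'rV[R[i]^o]_N)).
  exact: cst_continuous.
move=> /=.
apply: (@continuousZl _ _ _ (fun t : R => t%:C : R[i]^o) v 0).
exact: continuous_real_complex.
Qed.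

Lemma line_near U w v : openCN U -> U w -> \forall t \near (0 : R), U (w + t%:C *: v).
Proof.
move=> oU Uw; have := @line_continuous w v; apply.
by rewrite scale0r addr0; exact: (open_nbhs_nbhs (conj oU Uw)).
Qed.

Lemma is_rderive_ext U f g w v d : openCN U -> U w ->
  (forall w', U w' -> f w' = g w') -> is_rderive f w v d -> is_rderive g w v d.
Proof.
move=> oU Uw fg; apply: is_cderive_near.
by apply: filterS (line_near v oU Uw) => t; exact: fg.
Qed.

Lemma rderive_ext U f g w v : openCN U -> U w ->
  (forall w', U w' -> f w' = g w') -> rderive v f w = rderive v g w.
Proof.
move=> oU Uw fg; rewrite /rderive !derive1E; congr (_ +i* _);
  by apply: near_eq_derive; apply: filterS (line_near v oU Uw) => t /fg ->.
Qed.

Lemma is_rderive_cst a w v : is_rderive (fun=> a) w v 0.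
Proof. exact: is_cderive_cst. Qed.

Lemma is_rderiveD f g w v a b : is_rderive f w v a -> is_rderive g w v b ->
  is_rderive (fun w => f w + g w) w v (a + b).
Proof. exact: is_cderiveD. Qed.

Lemma is_rderiveM f g w v a b : is_rderive f w v a -> is_rderive g w v b ->
  is_rderive (fun w => f w * g w) w v (a * g w + f w * b).
Proof.
by move=> fa gb; have := is_cderiveM fa gb; rewrite /= scale0r addr0.
Qed.

Lemma is_rderiveV f w v a : f w != 0 -> is_rderive f w v a ->
  is_rderive (fun w => (f w)^-1) w v (- a / f w ^+ 2).
Proof.
move=> fw fa; have := @is_cderiveV _ (fun t : R => f (w + t%:C *: v)) a.
by rewrite /= scale0r addr0; apply.
Qed.

Lemma is_rderive_conjc f w v a : is_rderive f w v a ->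
  is_rderive (fun w => conjc (f w)) w v (conjc a).
Proof. exact: is_cderive_conjc. Qed.

End LineDerivative.

Section CkClosure.
Context {R : realType} {N : nat}.
Local Notation C := R[i].
Local Notation V := 'rV[C]_N.
Variable U : set V.
Hypothesis oU : openCN U.
Implicit Types (f g : V -> C) (v w : V) (a : C) (l : 'I_N) (b : bool).

Lemma Ck_continuous k f w : Ck k U f -> U w -> continuousCN f w.
Proof. by case: k => [|k] /= [cf _]; exact: cf. Qed.

Lemma continuousCN_ext f g w : U w -> (forall w', U w' -> f w' = g w') ->
  continuousCN f w -> continuousCN g w.
Proof.
move=> Uw fg cf; rewrite /continuousCN /prop_for /continuous_at -(fg w Uw).
apply: cvg_trans cf; apply: (@near_eq_cvg _ _ (nbhs (w : 'rV[R[i]^o]_N)) _ f g).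
apply: (@filterS _ (nbhs (w : 'rV[R[i]^o]_N)) _ U); first by move=> w'; exact: fg.
exact: (open_nbhs_nbhs (conj oU Uw)).
Qed.

Lemma Ck_ext k f g : (forall w, U w -> f w = g w) -> Ck k U f -> Ck k U g.
Proof.
elim: k f g => [|k IH] f g fg /= [cf Hf]; split=> [w Uw|].
- exact: (continuousCN_ext Uw fg (cf w Uw)).
- by [].
- exact: (continuousCN_ext Uw fg (cf w Uw)).
move=> l b; have [dr Cf] := Hf l b; split=> [w Uw|].
  move/is_rderiveP: (dr w Uw) => H.
  exact: (is_rderive_able (is_rderive_ext oU Uw fg H)).
apply: IH Cf => w Uw; exact: (rderive_ext _ oU Uw fg).
Qed.

Lemma CkW k f : Ck k.+1 U f -> Ck k U f.
Proof.
elim: k f => [|k IH] f; first by move=> [cf _]; split.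
move=> [cf Hf]; split=> // l b; have [dr Cf] := Hf l b; split=> //; exact: IH.
Qed.

Lemma Ck_rderive k f w l b : Ck k.+1 U f -> U w ->
  is_rderive f w (rdir l b) (rderive (rdir l b) f w).
Proof. by move=> [_ /(_ l b) [dr _]] Uw; apply/is_rderiveP/dr. Qed.

(** Entry point of the inductions on the order: candidates [f'] for the partial derivatives suffice.
    They agree with [rderive] on [U] only, which [Ck_ext] absorbs. *)
Lemma Ck_build k f (f' : 'I_N -> bool -> V -> C) :
  (forall w, U w -> continuousCN f w) ->
  (forall w l b, U w -> is_rderive f w (rdir l b) (f' l b w)) ->
  (forall l b, Ck k U (f' l b)) -> Ck k.+1 U f.
Proof.
move=> cf df Cf'; split=> // l b; split=> [w Uw|].
  exact: is_rderive_able (df w l b Uw).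
by apply: Ck_ext (Cf' l b) => w Uw; rewrite (rderive_val (df w l b Uw)).
Qed.

Lemma Ck_cst k a : Ck k U (fun=> a).
Proof.
elim: k a => [|k IH] a; first by split=> // w _; exact: cst_continuous.
apply: (Ck_build (f' := fun _ _ _ => 0)) => // [w _|w l b _].
  exact: cst_continuous.
exact: is_rderive_cst.
Qed.

Lemma CkD k f g : Ck k U f -> Ck k U g -> Ck k U (fun w => f w + g w).
Proof.
elim: k f g => [|k IH] f g Cf Cg.
  split=> // w Uw.
  exact: (continuousD (Ck_continuous Cf Uw) (Ck_continuous Cg Uw)).
apply: (Ck_build (f' := fun l b w => rderive (rdir l b) f w + rderive (rdir l b) g w)).
- move=> w Uw; exact: (continuousD (Ck_continuous Cf Uw) (Ck_continuous Cg Uw)).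
- move=> w l b Uw; apply: is_rderiveD; exact: (@Ck_rderive k).
- by move=> l b; apply: IH; [case: Cf => _ /(_ l b)[]|case: Cg => _ /(_ l b)[]].
Qed.

Lemma CkM k f g : Ck k U f -> Ck k U g -> Ck k U (fun w => f w * g w).
Proof.
elim: k f g => [|k IH] f g Cf Cg.
  split=> // w Uw.
  exact: (continuousM (Ck_continuous Cf Uw) (Ck_continuous Cg Uw)).
apply: (Ck_build (f' := fun l b w => rderive (rdir l b) f w * g w +
   f w * rderive (rdir l b) g w)).
- move=> w Uw; exact: (continuousM (Ck_continuous Cf Uw) (Ck_continuous Cg Uw)).
- move=> w l b Uw; apply: is_rderiveM; exact: (@Ck_rderive k).
- move=> l b; apply: CkD; apply: IH; rewrite //; try exact: CkW.
    by case: Cf => _ /(_ l b)[].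
  by case: Cg => _ /(_ l b)[].
Qed.

Lemma CkV k f : (forall w, U w -> f w != 0) -> Ck k U f ->
  Ck k U (fun w => (f w)^-1).
Proof.
move=> f0; elim: k => [|k IH] Cf.
  split=> // w Uw.
  exact: (continuousV (f0 w Uw) (Ck_continuous Cf Uw)).
apply: (Ck_build (f' := fun l b w => - rderive (rdir l b) f w / f w ^+ 2)).
- move=> w Uw; exact: (continuousV (f0 w Uw) (Ck_continuous Cf Uw)).
- move=> w l b Uw; apply: is_rderiveV; [exact: f0|exact: (@Ck_rderive k)].
(* The induction hypothesis covers [f^-1] alone, so [f^-2] is split into two such factors. *)
- move=> l b; have V1 := IH (CkW Cf); apply: (@Ck_ext _
    (fun w => -1 * rderive (rdir l b) f w * ((f w)^-1 * (f w)^-1))).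
    by move=> w Uw; rewrite mulN1r expr2 invfM.
  apply: CkM; apply: CkM => //; first exact: Ck_cst.
  by case: Cf => _ /(_ l b)[].
Qed.

Lemma Ck_conjc k f : Ck k U f -> Ck k U (fun w => conjc (f w)).
Proof.
have cJ g w : continuousCN g w -> continuousCN (fun w => conjc (g w)) w.
  move=> cg; apply: (@continuous_comp _ _ _ (g : 'rV[R[i]^o]_N -> R[i]^o)).
    exact: cg.
  exact: continuous_conjc.
elim: k f => [|k IH] f Cf.
  by split=> // w Uw; exact: cJ (Ck_continuous Cf Uw).
apply: (Ck_build (f' := fun l b w => conjc (rderive (rdir l b) f w))).
- by move=> w Uw; exact: cJ (Ck_continuous Cf Uw).
- move=> w l b Uw; apply: is_rderive_conjc; exact: (@Ck_rderive k).
- by move=> l b; apply: IH; case: Cf => _ /(_ l b)[].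
Qed.

Lemma Ck_sum (I : Type) (r : seq I) (P : pred I) k (F : I -> V -> C) :
  (forall i, P i -> Ck k U (F i)) -> Ck k U (fun w => \sum_(i <- r | P i) F i w).
Proof.
move=> sF; elim: r => [|i r IH].
  by apply: (Ck_ext _ (Ck_cst k 0)) => w _; rewrite big_nil.
have [Pi|Pi] := boolP (P i).
  by apply: (Ck_ext _ (CkD (sF i Pi) IH)) => w _; rewrite big_cons Pi.
by apply: (Ck_ext _ IH) => w _; rewrite big_cons (negPf Pi).
Qed.

End CkClosure.

Section Smooth.
Context {R : realType} {N : nat}.
Local Notation C := R[i].
Local Notation V := 'rV[C]_N.
Variable U : set V.
Hypothesis oU : openCN U.
Implicit Types (f g : V -> C) (v w : V) (a : C) (l : 'I_N) (b : bool).

Lemma smooth_ext f g : (forall w, U w -> f w = g w) -> smooth U f -> smooth U g.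
Proof. by move=> fg sf k; exact: (Ck_ext oU fg (sf k)). Qed.

Lemma smooth_cst a : smooth U (fun=> a).
Proof. by move=> k; exact: Ck_cst. Qed.

Lemma smoothD f g : smooth U f -> smooth U g -> smooth U (fun w => f w + g w).
Proof. by move=> sf sg k; exact: CkD. Qed.

Lemma smoothM f g : smooth U f -> smooth U g -> smooth U (fun w => f w * g w).
Proof. by move=> sf sg k; exact: CkM. Qed.

Lemma smoothV f : (forall w, U w -> f w != 0) -> smooth U f ->
  smooth U (fun w => (f w)^-1).
Proof. by move=> f0 sf k; exact: CkV. Qed.

Lemma smooth_conjc f : smooth U f -> smooth U (fun w => conjc (f w)).
Proof. by move=> sf k; exact: Ck_conjc. Qed.

Lemma smoothN f : smooth U f -> smooth U (fun w => - f w).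
Proof.
move=> sf; apply: (@smooth_ext (fun w => -1 * f w)).
  by move=> w _; rewrite mulN1r.
by apply: smoothM => //; exact: smooth_cst.
Qed.

Lemma smooth_sum (I : Type) (r : seq I) (P : pred I) (F : I -> V -> C) :
  (forall i, P i -> smooth U (F i)) ->
  smooth U (fun w => \sum_(i <- r | P i) F i w).
Proof.
by move=> sF k; apply: Ck_sum => // i Pi; exact: sF.
Qed.

Lemma smooth_prod (I : Type) (r : seq I) (P : pred I) (F : I -> V -> C) :
  (forall i, P i -> smooth U (F i)) ->
  smooth U (fun w => \prod_(i <- r | P i) F i w).
Proof.
move=> sF; elim: r => [|i r IH].
  by apply: (smooth_ext _ (smooth_cst 1)) => w _; rewrite big_nil.
have [Pi|Pi] := boolP (P i).
  by apply: (smooth_ext _ (smoothM (sF i Pi) IH)) => w _; rewrite big_cons Pi.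
by apply: (smooth_ext _ IH) => w _; rewrite big_cons (negPf Pi).
Qed.

Lemma smooth_is_rderive f w l b : smooth U f -> U w ->
  is_rderive f w (rdir l b) (rderive (rdir l b) f w).
Proof. by move=> sf Uw; have := @Ck_rderive _ _ U 0 f w l b (sf 1%N) Uw. Qed.

Lemma smooth_rderive f l b : smooth U f -> smooth U (rderive (rdir l b) f).
Proof. by move=> sf k; have [_ /(_ l b) []] := sf k.+1. Qed.

Lemma smooth_continuous f w : smooth U f -> U w -> continuousCN f w.
Proof. by move=> sf; exact: Ck_continuous (sf 0%N). Qed.

Lemma smoothS (U' : set V) f : U' `<=` U -> smooth U f -> smooth U' f.
Proof.
move=> sU sf k; elim: k f {sf}(sf k) => [|k IH] f /= [cf Hf].
  by split=> // w /sU; exact: cf.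
split=> [w /sU|l b]; first exact: cf.
have [dr Cf] := Hf l b; split=> [w /sU|]; [exact: dr|exact: IH].
Qed.

End Smooth.

(** * Mean value theorem and symmetry of second derivatives *)

Section MeanValue.
Context {R : realType} {N : nat}.
Local Notation C := R[i].
Local Notation V := 'rV[C]_N.
Implicit Types (G : V -> R) (u v w : V).

Lemma is_derive_shift0 (g : R -> R) (s d : R) :
  is_derive (0 : R) 1 (fun t => g (s + t)) d -> is_derive s 1 g d.
Proof.
have E : (fun h : R => h^-1 *: (((fun t => g (s + t)) \o shift 0) (h *: 1)
   - (fun t => g (s + t)) 0)) = (fun h : R => h^-1 *: ((g \o shift s) (h *: 1) - g s)).
  by apply/funext => h; rewrite /shift /= !addr0 [s + _]addrC.
by move=> [H1 H2]; split; [rewrite /derivable -E|rewrite /derive -E].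
Qed.

(** The intermediate point is located only by [|x| <= |h|]: this treats both signs of [h] alike and
    is enough for passing to the limit. *)
Lemma mean_value_line G w v (D : R -> R) (h : R) :
  (forall s, `|s| <= `|h| ->
     is_derive (0 : R) 1 (fun t => G (w + s%:C *: v + t%:C *: v)) (D s)) ->
  exists2 x, `|x| <= `|h| & G (w + h%:C *: v) - G w = D x * h.
Proof.
move=> dG; pose g t := G (w + t%:C *: v).
have dg (s : R) : `|s| <= `|h| -> is_derive s 1 g (D s).
  move=> /dG H; have gE : (fun t => G (w + s%:C *: v + t%:C *: v)) = (fun t => g (s + t)).
    by apply/funext => t; rewrite /g -addrA -scalerDl -rmorphD.
  by rewrite gE in H; exact: is_derive_shift0 H.
have g0 : g 0 = G w by rewrite /g scale0r addr0.
have cg (a b : R) : `|a| <= `|h| -> `|b| <= `|h| ->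
    {within `[a, b], continuous g}.
  move=> ah bh; apply: derivable_within_continuous => x.
  rewrite in_itv /= => /andP[ax xb].
  have /dg[] // : `|x| <= `|h|.
  rewrite ler_norml (le_trans _ ax) ?(le_trans xb)//.
    by apply: le_trans bh; exact: ler_norm.
  by rewrite lerNl (le_trans _ ah)// -normrN ler_norm.
have [h0|h0] := leP 0 h.
  have hh : `|h| = h by rewrite ger0_norm.
  have [||x] := @MVT_segment R g D 0 h h0.
  - move=> x; rewrite in_itv /= => /andP[x0 xh]; apply: dg.
    by rewrite hh ger0_norm ltW.
  - by apply: cg; rewrite ?normr0.
  rewrite in_itv /= => /andP[x0 xh]; rewrite g0 subr0 => E; exists x => //.
  by rewrite hh ger0_norm.
have hh : `|h| = - h by rewrite ltr0_norm.
have [||x] := @MVT_segment R g D h 0 (ltW h0).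
- move=> x; rewrite in_itv /= => /andP[x0 xh]; apply: dg.
  by rewrite hh ltr0_norm// lerN2 ltW.
- by apply: cg; rewrite ?normr0.
rewrite in_itv /= => /andP[x0 xh]; rewrite g0 sub0r mulrN => E; exists x => //.
  by rewrite hh ler0_norm// lerN2.
by apply: oppr_inj; rewrite -E opprB.
Qed.

Lemma nbhs_box w (O : set V) : nbhs (w : 'rV[R[i]^o]_N) O ->
  exists2 de : R, 0 < de & forall v,
    (forall l, `|complex.Re (v 0 l)| < de /\ `|complex.Im (v 0 l)| < de) ->
    O (w + v).
Proof.
move=> /nbhs_ballP[e /= e0 sO].
have [r er] : exists r : R, e = r%:C by apply/complex_realP; rewrite gtr0_real.
have r0 : 0 < r by rewrite -ltcR -er.
(* As [|z| <= |Re z| + |Im z|], each part may use half of the radius. *)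
exists (r / 2) => [|v vd]; first by rewrite divr_gt0.
apply: sO; split=> // i l; rewrite -ball_normE /= mxE opprD addrA subrr sub0r.
rewrite normrN (ord1 i) er (complexE (v 0 l)); have [vr vi] := vd l.
apply: le_lt_trans (ler_normD _ _) _.
rewrite normrM !normc_def /= expr0n /= expr1n !addr0 add0r sqrtr1 mul1r.
rewrite !sqrtr_sqr.
rewrite -rmorphD /= ltcR; lra.
Qed.

End MeanValue.

Section Schwarz.
Context {R : realType} {N : nat}.
Local Notation C := R[i].
Local Notation V := 'rV[C]_N.
Variable U : set V.
Hypothesis oU : openCN U.
Implicit Types (f : V -> C) (u v w : V) (c : bool).

(** The mean value theorem fails for complex values; the boolean lets one argument treat both real
    components. *)
Definition re_im c (z : C) : R := if c then complex.Im z else complex.Re z.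

Lemma re_im_eq (x y : C) : (forall c, re_im c x = re_im c y) -> x = y.
Proof.
move=> H; have /= r := H false; have /= i := H true.
by apply/eqP; rewrite eq_complex r i !eqxx.
Qed.

Lemma is_rderive_re_im f w v d c : is_rderive f w v d ->
  is_derive (0 : R) 1 (fun t : R => re_im c (f (w + t%:C *: v))) (re_im c d).
Proof. by case: c => -[dr di]; [exact: di|exact: dr]. Qed.

Lemma continuousCN_re_im f w c (e : R) : continuousCN f w -> 0 < e ->
  nbhs (w : 'rV[R[i]^o]_N) [set w' | `|re_im c (f w') - re_im c (f w)| < e].
Proof.
move=> cf e0.
have cp : {for w, continuous (fun w' : 'rV[R[i]^o]_N => re_im c (f w') : R)}.
  apply: (@continuous_comp _ _ _ (f : 'rV[R[i]^o]_N -> R[i]^o) (re_im c : R[i]^o -> R)).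
    exact: cf.
  by case: (c); [exact: continuous_Im|exact: continuous_Re].
by have := @cvgr_distC_lt _ _ _ _ _ _ _ cp e e0; apply.
Qed.

Lemma rdir_small (l : 'I_N) (b : bool) (s : R) (k : 'I_N) :
  `|complex.Re ((s%:C *: rdir l b) 0 k)| <= `|s| /\
  `|complex.Im ((s%:C *: rdir l b) 0 k)| <= `|s|.
Proof.
rewrite /rdir !mxE /=.
have [_|_] := eqVneq k l; last by rewrite !mulr0 normr0.
by case: b; rewrite ?mulr1 /= ?mulr0 ?mul0r ?mulr1 ?subr0 ?addr0 ?normr0.
Qed.

(* The second difference of f is symmetric in u and v, and the mean value theorem
   turns it into a value of either mixed derivative. *)
Lemma mixed_difference f f1 f12 w u v c (h : R) :
  (forall y, U y -> is_rderive f y u (f1 y)) ->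
  (forall y, U y -> is_rderive f1 y v (f12 y)) ->
  (forall s t : R, `|s| <= `|h| -> `|t| <= `|h| ->
     U (w + s%:C *: u + t%:C *: v)) ->
  exists s t : R, [/\ `|s| <= `|h|, `|t| <= `|h| &
    re_im c (f (w + h%:C *: u + h%:C *: v))
    - re_im c (f (w + h%:C *: u)) - (re_im c (f (w + h%:C *: v)) - re_im c (f w))
    = re_im c (f12 (w + s%:C *: u + t%:C *: v)) * h ^+ 2].
Proof.
move=> df df1 box.
have U0 (s : R) : `|s| <= `|h| -> U (w + s%:C *: u).
  by move=> sh; have := box s 0 sh; rewrite normr0 scale0r addr0; apply.
have [s sh|s sh E] := @mean_value_line R N
  (fun y => re_im c (f (y + h%:C *: v)) - re_im c (f y)) w u
  (fun s => re_im c (f1 (w + s%:C *: u + h%:C *: v))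
     - re_im c (f1 (w + s%:C *: u))) h.
  have H1 := is_rderive_re_im c (df _ (box s h sh (lexx _))).
  have H2 := is_rderive_re_im c (df _ (U0 s sh)).
  suff FE : (fun t : R => re_im c (f (w + s%:C *: u + t%:C *: u + h%:C *: v))
      - re_im c (f (w + s%:C *: u + t%:C *: u))) =
      (fun t : R => re_im c (f (w + s%:C *: u + h%:C *: v + t%:C *: u)))
      - (fun t : R => re_im c (f (w + s%:C *: u + t%:C *: u))).
    by rewrite FE; exact: is_deriveB H1 H2.
  by apply/funext => t; rewrite [w + _ + _ + _]addrAC.
have [t th|t th E'] := @mean_value_line R N (fun y => re_im c (f1 y))
   (w + s%:C *: u) v
   (fun t => re_im c (f12 (w + s%:C *: u + t%:C *: v))) h.
  apply: is_rderive_re_im; apply: df1; exact: box.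
by exists s, t; split; rewrite // expr2 mulrA -E' E.
Qed.

(** By contradiction: [mixed_difference] produces points near [w] where the two mixed derivatives
    share a value, yet each stays within half the gap of its own value at [w]. *)
Lemma mixed_derivatives f fu fv fuv fvu w u v :
  (forall y, U y -> is_rderive f y u (fu y)) ->
  (forall y, U y -> is_rderive f y v (fv y)) ->
  (forall y, U y -> is_rderive fu y v (fuv y)) ->
  (forall y, U y -> is_rderive fv y u (fvu y)) ->
  continuousCN fuv w -> continuousCN fvu w ->
  (forall (s : R) k, `|complex.Re ((s%:C *: u) 0 k)| <= `|s| /\
     `|complex.Im ((s%:C *: u) 0 k)| <= `|s|) ->
  (forall (s : R) k, `|complex.Re ((s%:C *: v) 0 k)| <= `|s| /\
     `|complex.Im ((s%:C *: v) 0 k)| <= `|s|) ->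
  U w -> fuv w = fvu w.
Proof.
move=> du dv duv dvu cuv cvu su sv Uw; apply: re_im_eq => c.
apply/eqP; apply: contraT => AB.
pose e := `|re_im c (fuv w) - re_im c (fvu w)| / 2.
have e0 : 0 < e by rewrite divr_gt0// normr_gt0 subr_eq0.
have nA := continuousCN_re_im c cuv e0.
have nB := continuousCN_re_im c cvu e0.
have nU : nbhs (w : 'rV[R[i]^o]_N) U by exact: (open_nbhs_nbhs (conj oU Uw)).
have [de de0 box] := nbhs_box (filterI nU (filterI nA nB)).
(* Two displacements of size at most [h] add up to at most [2 * de / 3 < de] in each real
   coordinate. *)
pose h := de / 3; have h0 : 0 < h by rewrite divr_gt0.
have hh : `|h| = h by rewrite gtr0_norm.
have small (s t : R) : `|s| <= `|h| -> `|t| <= `|h| -> forall k,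
   `|complex.Re ((s%:C *: u + t%:C *: v) 0 k)| < de /\
   `|complex.Im ((s%:C *: u + t%:C *: v) 0 k)| < de.
  rewrite hh => sh th k; rewrite [in X in X /\ _]mxE [in X in _ /\ X]mxE !raddfD /=.
  have [r1 i1] := su s k; have [r2 i2] := sv t k.
  by split; apply: (le_lt_trans (ler_normD _ _)); rewrite /h in sh th; lra.
have box' s t (sh : `|s| <= `|h|) (th : `|t| <= `|h|) := box _ (small s t sh th).
have [|s [t [sh th E]]] := @mixed_difference f fu fuv w u v c h du duv.
  by move=> s t sh th; rewrite -addrA; have [] := box' s t sh th.
have [|s' [t' [sh' th' E']]] := @mixed_difference f fv fvu w v u c h dv dvu.
  move=> x y xh yh; rewrite -addrA [_ *: v + _]addrC.
  by have [] := box' y x yh xh.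
have [_ [/= An _]] := box' s t sh th; rewrite addrA in An.
have [_ [_ /= Bn]] := box' t' s' th' sh'.
rewrite [_ *: u + _]addrC addrA in Bn.
have EE : re_im c (fuv (w + s%:C *: u + t%:C *: v)) =
    re_im c (fvu (w + s'%:C *: v + t'%:C *: u)).
  apply: (@mulIf _ (h ^+ 2)); first by rewrite expf_neq0 ?gt_eqF.
  by rewrite -E -E' [w + _ + _]addrAC; ring.
have : 2 * e = `|re_im c (fuv w) - re_im c (fvu w)| by rewrite /e; field.
move: An Bn; rewrite EE; set x := re_im c (fvu (_ + _)).
set a := re_im c (fuv w); set b := re_im c (fvu w) => An Bn E2.
have : `|a - b| < `|a - b|; last by rewrite ltxx.
rewrite -{2}E2 (_ : a - b = - (x - a) + (x - b)); last by ring.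
by apply: le_lt_trans (ler_normD _ _) _; rewrite normrN; lra.
Qed.

Lemma rderive_comm f w l b l' b' : smooth U f -> U w ->
  rderive (rdir l b) (rderive (rdir l' b') f) w =
  rderive (rdir l' b') (rderive (rdir l b) f) w.
Proof.
move=> sf Uw.
have s1 l1 b1 := smooth_rderive l1 b1 sf.
have s2 l1 b1 l2 b2 := smooth_rderive l1 b1 (s1 l2 b2).
apply: (@mixed_derivatives f (rderive (rdir l' b') f) (rderive (rdir l b) f) _ _ w
  (rdir l' b') (rdir l b)).
- by move=> y; exact: smooth_is_rderive.
- by move=> y; exact: smooth_is_rderive.
- by move=> y; exact: smooth_is_rderive.
- by move=> y; exact: smooth_is_rderive.
- exact: (smooth_continuous (s2 _ _ _ _)).
- exact: (smooth_continuous (s2 _ _ _ _)).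
- by move=> s k; exact: rdir_small.
- by move=> s k; exact: rdir_small.
- exact: Uw.
Qed.

End Schwarz.

(** * Chain rule along curves *)

Section ChainRule.
Context {R : realType} {N : nat}.
Local Notation C := R[i].
Local Notation V := 'rV[C]_N.
Variable U : set V.
Hypothesis oU : openCN U.
Implicit Types (f : V -> C) (u v w x : V) (c : bool).

Lemma derive0_small (a : R -> R) (a' e : R) :
  is_derive (0 : R) 1 a a' -> a 0 = 0 -> 0 < e -> \forall t \near 0, `|a t| < e.
Proof.
move=> [da _] a0 e0.
have /derivable1_diffP/differentiable_continuous ca := da.
have := @cvgr_distC_lt _ _ _ _ _ _ _ ca e e0.
by rewrite a0 => H; near=> t; rewrite -[a t]subr0; near: t; exact: H.
Unshelve. all: by end_near. Qed.

(** One step of the chain rule: a displacement [a t] in a single direction [u], from a base point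
    [y t] that itself moves towards [x]. The mean value theorem gives the increment as [D * a t],
    with [D] close to the derivative at [x]. *)
Lemma is_derive_increment f fu u x c (y : R -> V) (a : R -> R) (a' : R) :
  (forall w, U w -> is_rderive f w u (fu w)) -> continuousCN fu x -> U x ->
  is_derive (0 : R) 1 a a' -> a 0 = 0 ->
  (forall O : set V, nbhs (x : 'rV[R[i]^o]_N) O ->
     \forall t \near (0 : R), forall s : R, `|s| <= `|a t| -> O (y t + s%:C *: u)) ->
  is_derive (0 : R) 1
    (fun t => re_im c (f (y t + (a t)%:C *: u)) - re_im c (f (y t)))
    (a' * re_im c (fu x)).
Proof.
move=> df cf Ux da a0 near_y; apply/is_derive0P => e e0.
set D0 := re_im c (fu x).
have A0 : 0 < `|a'| + 1 by rewrite ltr_wpDl.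
have B0 : 0 < `|D0| + 1 by rewrite ltr_wpDl.
(* The error is [(D - D0) * a t + D0 * (a t - t * a')], and each term is to be at most
   [e / 2 * |t|]. The added 1 keeps the denominators positive; [e1 <= 1] gives
   [|a t| <= (|a'| + 1) * |t|]. *)
pose e2 := e / 2 / (`|a'| + 1); have e20 : 0 < e2 by rewrite !divr_gt0.
pose e1 := Num.min 1 (e / 2 / (`|D0| + 1)).
have e10 : 0 < e1 by rewrite lt_min ltr01 !divr_gt0.
have nU : nbhs (x : 'rV[R[i]^o]_N) U by exact: (open_nbhs_nbhs (conj oU Ux)).
have nD := near_y _ (@filterI _ (nbhs (x : 'rV[R[i]^o]_N)) (nbhs_filter _) _ _
  nU (continuousCN_re_im c cf e20)).
have na := (is_derive0P a a').1 da e1 e10.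
near=> t; rewrite a0 !scale0r addr0 subrr subr0.
have at_ : `|a t - t * a'| <= e1 * `|t| by rewrite -[a t]subr0 -a0; near: t.
have yt : forall s : R, `|s| <= `|a t| ->
  (U `&` [set w' | `|re_im c (fu w') - D0| < e2]) (y t + s%:C *: u) by near: t.
have [s sa|s sa ->] := @mean_value_line R N (fun w => re_im c (f w)) (y t) u
   (fun s => re_im c (fu (y t + s%:C *: u))) (a t).
  by apply: is_rderive_re_im; apply: df; have [] := yt s sa.
have [_ /= Ds] := yt s sa; set D := re_im c (fu (_ + _)) in Ds *.
have at2 : `|a t| <= (`|a'| + 1) * `|t|.
  rewrite (_ : a t = (a t - t * a') + t * a'); last by ring.
  rewrite (le_trans (ler_normD _ _))// mulrDl addrC lerD ?normrM 1?mulrC// mulrC.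
  by rewrite (le_trans at_)// ler_wpM2r// ge_min lexx.
rewrite (_ : _ - _ = (D - D0) * a t + D0 * (a t - t * a')); last by ring.
apply: (le_trans (ler_normD _ _)).
rewrite [e in X in _ <= X]splitr [X in _ <= X]mulrDl !normrM lerD//.
  apply: (le_trans (ler_pM _ _ (ltW Ds) at2)) => //.
  by rewrite mulrA /e2 divfK ?gt_eqF.
apply: (@le_trans _ _ (`|D0| * (e1 * `|t|))); first exact: ler_wpM2l.
rewrite mulrA ler_wpM2r// (@le_trans _ _ ((`|D0| + 1) * e1))//.
  by rewrite ler_wpM2r ?ltW// ltrDl.
rewrite (@le_trans _ _ ((`|D0| + 1) * (e / 2 / (`|D0| + 1))))//.
  by apply: ler_wpM2l; [exact: ltW|rewrite ge_min lexx orbT].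
by rewrite mulrC divfK ?gt_eqF.
Unshelve. all: by end_near. Qed.

Section Path.
Variables (f : V -> C) (f' : 'I_N * bool -> V -> C) (x : V).
Hypothesis df : forall q w, U w -> is_rderive f w (rdir q.1 q.2) (f' q w).
Hypothesis cf : forall q, continuousCN (f' q) x.
Hypothesis Ux : U x.
Variables (a : 'I_N * bool -> R -> R) (a' : 'I_N * bool -> R).
Hypothesis da : forall q, is_derive (0 : R) 1 (a q) (a' q).
Hypothesis a0 : forall q, a q 0 = 0.

Let path s t := \sum_(q <- s) (a q t)%:C *: rdir q.1 q.2 : V.

Let path_small s (e : R) : 0 < e -> \forall t \near (0 : R), forall k,
  `|complex.Re (path s t 0 k)| < e /\ `|complex.Im (path s t 0 k)| < e.
Proof.
elim: s e => [|q s IH] e e0.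
  by near=> t; move=> k; rewrite /path big_nil mxE normr0.
have e2 : 0 < e / 2 by rewrite divr_gt0.
have := IH _ e2; have := derive0_small (da q) (a0 q) e2 => na ns.
near=> t; move=> k; rewrite /path big_cons [in X in X /\ _]mxE [in X in _ /\ X]mxE !raddfD /=.
have [r1 i1] := rdir_small q.1 q.2 (a q t) k.
have [r2 i2] : `|complex.Re (path s t 0 k)| < e / 2 /\ `|complex.Im (path s t 0 k)| < e / 2.
  by move: k {r1 i1}; near: t.
have aq : `|a q t| < e / 2 by near: t.
by split; apply: (le_lt_trans (ler_normD _ _)); rewrite [e]splitr ltrD// (le_lt_trans _ aq).
Unshelve. all: by end_near. Qed.

(** Induction on the directions already used: the displacement in direction [q] starts from
    [x + path s t], which tends to [x], and the remaining difference is the path for [s]. Only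
    partial derivatives along [rdir] occur. *)
Let derive_path s c : is_derive (0 : R) 1 (fun t => re_im c (f (x + path s t)))
  (\sum_(q <- s) a' q * re_im c (f' q x)).
Proof.
elim: s => [|q s IH].
  rewrite big_nil (_ : (fun t => _) = cst (re_im c (f x))); first exact: is_derive_cst.
  by apply/funext => t; rewrite /path big_nil addr0.
have ny (O : set V) : nbhs (x : 'rV[R[i]^o]_N) O -> \forall t \near (0 : R),
    forall r : R, `|r| <= `|a q t| -> O (x + path s t + r%:C *: rdir q.1 q.2).
  move=> /nbhs_box[de de0 box].
  have d2 : 0 < de / 2 by rewrite divr_gt0.
  have na := derive0_small (da q) (a0 q) d2; have ns := path_small s d2.
  near=> t; move=> r ra; rewrite -addrA; apply: box => k.
  rewrite [in X in X /\ _]mxE [in X in _ /\ X]mxE !raddfD /=.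
  have [r1 i1] := rdir_small q.1 q.2 r k.
  have [r2 i2] : `|complex.Re (path s t 0 k)| < de / 2 /\ `|complex.Im (path s t 0 k)| < de / 2.
    by move: k {r1 i1}; near: t.
  have aq : `|a q t| < de / 2 by near: t.
  have {}ra := le_lt_trans ra aq.
  by split; apply: (le_lt_trans (ler_normD _ _)); rewrite [de]splitr ltrD// (le_lt_trans _ ra).
have H := is_derive_increment c (@df q) (@cf q) Ux (da q) (a0 q) ny.
rewrite big_cons; have := is_deriveD H IH.
set F := (X in is_derive _ _ X _); rewrite (_ : F = fun t => re_im c (f (x + path (q :: s) t)))//.
apply/funext => t; rewrite /F fctE /= subrK /path big_cons; congr (re_im c (f _)).
by rewrite [RHS]addrCA addrC.
Unshelve. all: by end_near. Qed.

Lemma re_im_real_mul c (r : R) (z : C) : re_im c (r%:C * z) = r * re_im c z.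
Proof. by case: c z => -[u v] /=; ring. Qed.

Lemma re_im_sum c (I : Type) (s : seq I) (F : I -> C) :
  re_im c (\sum_(i <- s) F i) = \sum_(i <- s) re_im c (F i).
Proof. by case: c; rewrite /re_im raddf_sum. Qed.

Lemma is_cderive_path : is_cderive
  (fun t => f (x + \sum_q (a q t)%:C *: rdir q.1 q.2))
  (\sum_q (a' q)%:C * f' q x).
Proof.
have E c : \sum_(q <- index_enum _) a' q * re_im c (f' q x) =
    re_im c (\sum_q (a' q)%:C * f' q x).
  by rewrite re_im_sum; apply: eq_bigr => q _; rewrite re_im_real_mul.
have Hr := derive_path (index_enum _) false; have Hi := derive_path (index_enum _) true.
by rewrite E in Hr; rewrite E in Hi; split; [exact: Hr|exact: Hi].
Qed.

End Path.

(** Splitting [g t - g 0] into its real coordinates makes it a path as above; regrouping the two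
    real directions of each complex coordinate gives the Wirtinger form. *)
Lemma is_cderive_comp f (g : R -> V) (d : 'I_N -> C) :
  smooth U f -> U (g 0) -> (forall l, is_cderive (fun t => g t 0 l) (d l)) ->
  is_cderive (fun t => f (g t))
    (\sum_l (dC l f (g 0) * d l + dCbar l f (g 0) * conjc (d l))).
Proof.
move=> sf Ug dg.
pose a (q : 'I_N * bool) t := re_im q.2 (g t 0 q.1) - re_im q.2 (g 0 0 q.1).
pose a' (q : 'I_N * bool) := re_im q.2 (d q.1).
have da q : is_derive (0 : R) 1 (a q) (a' q).
  have H : is_derive (0 : R) 1 (fun t => re_im q.2 (g t 0 q.1)) (a' q).
    rewrite /a'; case: q => l b /=; have [dr di] := dg l.
    by case: b; [exact: di|exact: dr].
  have H2 := is_derive_cst (re_im q.2 (g 0 0 q.1)) (0 : R) (1 : R).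
  by have := is_deriveB H H2; rewrite subr0.
have a0 q : a q 0 = 0 by rewrite /a subrr.
have gE t : g t = g 0 + \sum_q (a q t)%:C *: rdir q.1 q.2.
  rewrite -(pair_bigA _ (fun l b => (a (l, b) t)%:C *: rdir l b)) /=.
  apply/rowP => k; rewrite mxE summxE.
  rewrite (eq_bigr (fun l => if l == k then g t 0 k - g 0 0 k else 0)).
    by rewrite -big_mkcond big_pred1_eq addrC subrK.
  move=> l _; rewrite big_bool /= /rdir !mxE eqxx /=.
  have [->|lk] := eqVneq l k; last by rewrite !mulr0 addr0.
  rewrite /a /re_im /= !mulr1.
  by apply/eqP; rewrite eq_complex !raddfD !raddfN /=; apply/andP; split; apply/eqP; ring.
have := @is_cderive_path f (fun q => rderive (rdir q.1 q.2) f) (g 0) _ _ Ug a a' da a0.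
rewrite (_ : (fun t => f (_ + _)) = (fun t => f (g t))); last first.
  by apply/funext => t; rewrite [in RHS]gE.
rewrite (_ : \sum_q _ = \sum_l (dC l f (g 0) * d l + dCbar l f (g 0) * conjc (d l))).
  apply.
    by move=> q w Uw; exact: (smooth_is_rderive q.1 q.2 sf).
  by move=> q; apply: (@smooth_continuous _ _ U) => //; exact: smooth_rderive.
rewrite -(pair_bigA _ (fun l b => (a' (l, b))%:C * rderive (rdir l b) f (g 0))) /=.
apply: eq_bigr => l _; rewrite big_bool /= /a' /re_im /= /dC /dCbar.
set p := rderive (rdir l false) f (g 0); set q := rderive (rdir l true) f (g 0).
have i2 : 'i%C * 'i%C = -1 :> C by rewrite -expr2 sqr_i.
have dJ : conjc (d l) = (complex.Re (d l))%:C - 'i%C * (complex.Im (d l))%:C.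
  by case: (d l) => r s; apply/eqP; rewrite eq_complex /=; apply/andP; split; apply/eqP; ring.
have dE := complexE (d l).
set r := (complex.Re (d l))%:C in dJ dE *; set s := (complex.Im (d l))%:C in dJ dE *.
rewrite dJ dE; move: 'i%C i2 => j j2.
transitivity (r * p - j * j * s * q); first by rewrite j2; ring.
by field.
Qed.

End ChainRule.

Local Opaque rderive rdir.

(** * Wirtinger calculus *)

Section Wirtinger.
Context {R : realType} {N : nat}.
Local Notation C := R[i].
Local Notation V := 'rV[C]_N.
Variable U : set V.
Hypothesis oU : openCN U.
Implicit Types (f g : V -> C) (w : V) (l : 'I_N) (b : bool).

(** The boolean allows each rule to be proved once for both types; [true] is the conjugate
    derivative. *)
Definition wirt b l f w : C := if b then dCbar l f w else dC l f w.

Lemma wirtE b l f w : wirt b l f w =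
  (rderive (rdir l false) f w + (-1) ^+ (~~ b) * 'i%C * rderive (rdir l true) f w) / 2.
Proof. by case: b; rewrite /wirt /dC /dCbar ?mul1r ?mulN1r ?mulNr ?expr0 ?mul1r. Qed.

Local Opaque dC dCbar.

Lemma wirt_ext b l f g w : U w -> (forall w', U w' -> f w' = g w') ->
  wirt b l f w = wirt b l g w.
Proof.
move=> Uw fg; rewrite !wirtE.
by rewrite (rderive_ext _ oU Uw fg) (rderive_ext (rdir l true) oU Uw fg).
Qed.

Lemma wirt_is_rderive b l f w d0 d1 : is_rderive f w (rdir l false) d0 ->
  is_rderive f w (rdir l true) d1 ->
  wirt b l f w = (d0 + (-1) ^+ (~~ b) * 'i%C * d1) / 2.
Proof. by move=> /rderive_val H0 /rderive_val H1; rewrite wirtE H0 H1. Qed.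

Lemma wirt_cst b l (a : C) w : wirt b l (fun=> a) w = 0.
Proof.
rewrite (wirt_is_rderive b (is_rderive_cst a w _) (is_rderive_cst a w _)).
by rewrite mulr0 addr0 mul0r.
Qed.

Lemma wirtD b l f g w : smooth U f -> smooth U g -> U w ->
  wirt b l (fun w => f w + g w) w = wirt b l f w + wirt b l g w.
Proof.
move=> sf sg Uw; have D c := is_rderiveD (smooth_is_rderive l c sf Uw)
  (smooth_is_rderive l c sg Uw).
rewrite (wirt_is_rderive b (D _) (D _)).
rewrite !wirtE.
by rewrite -mulrDl mulrDr addrACA.
Qed.

Lemma wirtM b l f g w : smooth U f -> smooth U g -> U w ->
  wirt b l (fun w => f w * g w) w = wirt b l f w * g w + f w * wirt b l g w.
Proof.
move=> sf sg Uw; have D c := is_rderiveM (smooth_is_rderive l c sf Uw)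
  (smooth_is_rderive l c sg Uw).
rewrite (wirt_is_rderive b (D _) (D _)) !wirtE.
move: (rderive (rdir l false) f w) (rderive (rdir l true) f w).
move: (rderive (rdir l false) g w) (rderive (rdir l true) g w) (f w) (g w).
by move=> *; ring.
Qed.

Lemma wirt_conjc b l f w : smooth U f -> U w ->
  wirt b l (fun w => conjc (f w)) w = conjc (wirt (~~ b) l f w).
Proof.
move=> sf Uw; have D c := is_rderive_conjc (smooth_is_rderive l c sf Uw).
rewrite (wirt_is_rderive b (D _) (D _)) !wirtE negbK.
move: (rderive (rdir l false) f w) (rderive (rdir l true) f w) => {D} p q.
rewrite rmorphM rmorphD !rmorphM fmorphV rmorph_nat /=.
rewrite (_ : (0 +i* (-1)) = - 'i%C :> C); last by apply/eqP; rewrite eq_complex /= oppr0 !eqxx.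
by rewrite rmorphXn rmorphN rmorph1; case: b; rewrite /= ?expr0 ?expr1; ring.
Qed.

Lemma smooth_wirt b l f : smooth U f -> smooth U (wirt b l f).
Proof.
move=> sf; have E : wirt b l f = fun w => (rderive (rdir l false) f w +
    (-1) ^+ (~~ b) * 'i%C * rderive (rdir l true) f w) / 2.
  by apply/funext => w; exact: wirtE.
rewrite E; apply: smoothM => //; last exact: smooth_cst.
apply: smoothD => //; first exact: smooth_rderive.
apply: smoothM => //; last exact: smooth_rderive.
exact: smooth_cst.
Qed.

Lemma wirtN b l f w : smooth U f -> U w ->
  wirt b l (fun w => - f w) w = - wirt b l f w.
Proof.
move=> sf Uw; rewrite (@wirt_ext b l _ (fun w => -1 * f w) w) //; last first.
  by move=> w' _; rewrite mulN1r.
by rewrite wirtM//; [rewrite wirt_cst mul0r add0r mulN1r|exact: smooth_cst].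
Qed.

Lemma wirt_sum (I : Type) (r : seq I) (P : pred I) b l (F : I -> V -> C) w :
  (forall i, P i -> smooth U (F i)) -> U w ->
  wirt b l (fun w => \sum_(i <- r | P i) F i w) w =
  \sum_(i <- r | P i) wirt b l (F i) w.
Proof.
move=> sF Uw; elim: r => [|i r IH].
  rewrite big_nil (@wirt_ext b l _ (fun=> 0) w) ?wirt_cst// => w' _.
  by rewrite big_nil.
rewrite big_cons; have [Pi|Pi] := boolP (P i); last first.
  rewrite -IH; apply: wirt_ext => // w' _; by rewrite big_cons (negPf Pi).
rewrite -IH -wirtD//; [|exact: sF|exact: smooth_sum].
by apply: wirt_ext => // w' _; rewrite big_cons Pi.
Qed.

Lemma wirt_comm b l b' l' f w : smooth U f -> U w ->
  wirt b l (wirt b' l' f) w = wirt b' l' (wirt b l f) w.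
Proof.
move=> sf Uw.
have sr c k := smooth_rderive k c sf.
have D (c c' : bool) (k k' : 'I_N) d0 d1 :
    is_rderive (rderive (rdir k false) f) w (rdir k' c') d0 ->
    is_rderive (rderive (rdir k true) f) w (rdir k' c') d1 ->
    is_rderive (wirt c k f) w (rdir k' c') ((d0 + (-1) ^+ (~~ c) * 'i%C * d1) / 2).
  move=> r0 r1; apply: (@is_rderive_ext _ _ U (fun w => (rderive (rdir k false) f w +
      (-1) ^+ (~~ c) * 'i%C * rderive (rdir k true) f w) * 2^-1)) => //.
    by move=> w' _; rewrite wirtE.
  have ci := is_rderive_cst ((-1) ^+ (~~ c) * 'i%C) w (rdir k' c').
  have c2 := is_rderive_cst (2^-1 : C) w (rdir k' c').
  have := is_rderiveM (is_rderiveD r0 (is_rderiveM ci r1)) c2.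
  by rewrite mulr0 addr0 mul0r add0r.
pose DD c c' := rderive (rdir l c) (rderive (rdir l' c') f) w.
have H1 c c' : is_rderive (rderive (rdir l' c') f) w (rdir l c) (DD c c').
  exact: (smooth_is_rderive l c (sr c' l') Uw).
have H2 c c' : is_rderive (rderive (rdir l c) f) w (rdir l' c') (DD c c').
  have -> : DD c c' = rderive (rdir l' c') (rderive (rdir l c) f) w.
    exact: (rderive_comm oU l c l' c' sf Uw).
  exact: (smooth_is_rderive l' c' (sr c l) Uw).
move: DD H1 H2 => DD H1 H2.
rewrite (wirt_is_rderive b (D b' _ _ _ _ _ (H1 _ _) (H1 _ _)) (D b' _ _ _ _ _ (H1 _ _) (H1 _ _))).
rewrite (wirt_is_rderive b' (D b _ _ _ _ _ (H2 _ _) (H2 _ _)) (D b _ _ _ _ _ (H2 _ _) (H2 _ _))).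
by ring.
Qed.

End Wirtinger.

Section Coordinates.
Context {R : realType} {N : nat}.
Local Notation C := R[i].
Local Notation V := 'rV[C]_N.
Variable U : set V.
Hypothesis oU : openCN U.
Implicit Types (f : V -> C) (v w : V) (l k : 'I_N) (b : bool).

Lemma is_rderive_coord k w v : is_rderive (fun w => w 0 k) w v (v 0 k).
Proof.
have Hid : is_cderive (fun t : R => t%:C) 1.
  by have := is_cderive_real (@is_derive_id _ _ (0 : R) 1).
have := is_cderiveD (is_cderive_cst (w 0 k)) (is_cderiveM Hid (is_cderive_cst (v 0 k))).
rewrite mul1r mulr0 addr0 add0r; apply: is_cderive_near.
by near=> t; rewrite !mxE.
Unshelve. all: by end_near. Qed.

Lemma smooth_coord k : smooth U (fun w => w 0 k).
Proof.
case=> [|j]; first by split=> // w _; exact: (@coord_continuous R[i] 1 N 0 k w).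
apply: (Ck_build oU (f' := fun l b _ => rdir l b 0 k)).
- by move=> w _; exact: (@coord_continuous R[i] 1 N 0 k w).
- by move=> w l b _; exact: is_rderive_coord.
- by move=> l b; exact: Ck_cst.
Qed.

Lemma wirt_coord b l k w : wirt b l (fun w => w 0 k) w = (~~ b && (l == k))%:R.
Proof.
rewrite (wirt_is_rderive b (is_rderive_coord _ _ _) (is_rderive_coord _ _ _)).
Transparent rdir.
rewrite /rdir !mxE eqxx /= eq_sym.
have i2 : 'i%C * 'i%C = -1 :> C by rewrite -expr2 sqr_i.
rewrite mulrA -[_ * 'i * 'i]mulrA i2.
by case: b; case: (l == k) => /=; rewrite ?expr0 ?expr1 /=; field.
Qed.
Local Opaque rdir.

Lemma is_rderive_smooth f w v : smooth U f -> U w ->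
  is_rderive f w v (\sum_l (dC l f w * v 0 l + dCbar l f w * conjc (v 0 l))).
Proof.
move=> sf Uw; have w0 : w + (0 : R)%:C *: v = w by rewrite scale0r addr0.
have := @is_cderive_comp R N U oU f (fun t => w + t%:C *: v) (fun l => v 0 l) sf.
rewrite w0; apply=> // l; exact: (is_rderive_coord l w v).
Qed.

End Coordinates.

(** * Holomorphic substitutions and pullbacks from the base *)

Section Composition.
Context {R : realType} {N N' : nat}.
Local Notation C := R[i].
Variables (U : set 'rV[C]_N) (U' : set 'rV[C]_N') (phi : 'rV[C]_N -> 'rV[C]_N').
Hypotheses (oU : openCN U) (oU' : openCN U').
Hypothesis phiU : forall w, U w -> U' (phi w).
Hypothesis hphi : forall p, holomorphic U (fun w => phi w 0 p).

Lemma continuousCN_comp (f : 'rV[C]_N' -> C) w :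
  continuousCN f (phi w) -> (forall p, continuousCN (fun w => phi w 0 p) w) ->
  continuousCN (fun w => f (phi w)) w.
Proof.
move=> cf cphi.
apply: (@continuous_comp _ _ _ (phi : 'rV[R[i]^o]_N -> 'rV[R[i]^o]_N')); last exact: cf.
move=> A [P Pn PA]; rewrite nbhs_simpl /=.
have := @filter_forall 'rV[R[i]^o]_N _ (fun p w' => P 0 p (phi w' 0 p))
  (nbhs (w : 'rV[R[i]^o]_N)) (nbhs_filter _)
  (fun p => cphi p _ (Pn 0 p)).
apply: (@filterS 'rV[R[i]^o]_N (nbhs (w : 'rV[R[i]^o]_N)) (nbhs_filter _)) => w' H.
by apply: PA => i p; rewrite (ord1 i); exact: H.
Qed.

(** Induction on the order for all [f] simultaneously: the partial derivatives of the composite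
    contain [dC p f] and [dCbar p f] composed with [phi], to which the hypothesis applies again. *)
Lemma smooth_comp (f : 'rV[C]_N' -> C) : smooth U' f -> smooth U (fun w => f (phi w)).
Proof.
move=> sf k; elim: k f sf => [|k IH] f sf.
  split=> // w Uw; apply: continuousCN_comp; first exact: smooth_continuous sf (phiU Uw).
  by move=> p; exact: smooth_continuous (hphi p).1 Uw.
pose D p l c := rderive (rdir l c) (fun w => phi w 0 p).
apply: (Ck_build oU (f' := fun l c w =>
   \sum_p (dC p f (phi w) * D p l c w + dCbar p f (phi w) * conjc (D p l c w)))).
- move=> w Uw; apply: continuousCN_comp; first exact: smooth_continuous sf (phiU Uw).
  by move=> p; exact: smooth_continuous (hphi p).1 Uw.
- move=> w l c Uw.
  have w0 : w + (0 : R)%:C *: rdir l c = w by rewrite scale0r addr0.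
  have := @is_cderive_comp R N' U' oU' f (fun t => phi (w + t%:C *: rdir l c))
    (fun p => D p l c w) sf.
  rewrite w0; apply=> [|p]; first exact: phiU.
  exact: (smooth_is_rderive l c (hphi p).1 Uw).
- move=> l c; have sD p : smooth U (D p l c) by apply: smooth_rderive; exact: (hphi p).1.
  apply: Ck_sum => // p _; apply: CkD => //; apply: CkM => //.
  + exact: (IH _ (smooth_wirt oU' false p sf)).
  + exact: sD.
  + exact: (IH _ (smooth_wirt oU' true p sf)).
  + exact: (smooth_conjc oU (sD p)).
Qed.

(** For holomorphic [phi] the cross terms cancel, so the two types of derivative never mix. This is
    what later makes delta and delta_bar transform separately. *)
Lemma wirt_comp b l (f : 'rV[C]_N' -> C) w : smooth U' f -> U w ->
  wirt b l (fun w => f (phi w)) w =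
  \sum_p wirt b p f (phi w) *
    (if b then conjc (dC l (fun w => phi w 0 p) w) else dC l (fun w => phi w 0 p) w).
Proof.
move=> sf Uw.
pose D p c := rderive (rdir l c) (fun w => phi w 0 p) w.
have dphi c : is_rderive (fun w => f (phi w)) w (rdir l c)
    (\sum_p (dC p f (phi w) * D p c + dCbar p f (phi w) * conjc (D p c))).
  have w0 : w + (0 : R)%:C *: rdir l c = w by rewrite scale0r addr0.
  have := @is_cderive_comp R N' U' oU' f (fun t => phi (w + t%:C *: rdir l c))
    (fun p => D p c) sf.
  rewrite w0; apply=> [|p]; first exact: phiU.
  exact: (smooth_is_rderive l c (hphi p).1 Uw).
(* Cauchy-Riemann equation, read off from the vanishing of [dCbar]. *)
have hD p : D p true = 'i%C * D p false.
  have := (hphi p).2 w l Uw; rewrite -/(wirt true l _ w) wirtE -!/(D p _) /= expr0 mul1r.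
  move=> /eqP; rewrite mulf_eq0 invr_eq0 pnatr_eq0 orbF addrC addr_eq0 => /eqP E.
  have i2 : 'i%C * 'i%C = -1 :> C by rewrite -expr2 sqr_i.
  move: (D p true) (D p false) E => x y E.
  by transitivity (- ('i%C * ('i%C * x))); [rewrite mulrA i2 mulN1r opprK|rewrite E mulrN opprK].
have dCD p : dC l (fun w => phi w 0 p) w = D p false.
  rewrite -/(wirt false l _ w) wirtE -!/(D p _) hD /= expr1 mulN1r mulrA.
  have i2 : 'i%C * 'i%C = -1 :> C by rewrite -expr2 sqr_i.
  by rewrite mulNr i2; field.
rewrite (wirt_is_rderive b (dphi _) (dphi _)) mulr_sumr -big_split mulr_suml.
apply: eq_bigr => p _; rewrite dCD hD {dCD hD dphi}.
have i2 : 'i%C * 'i%C = -1 :> C by rewrite -expr2 sqr_i.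
have iJ : conjc 'i = - 'i%C :> C by apply/eqP; rewrite eq_complex /= oppr0 !eqxx.
have hJ : conjc ('i%C * D p false) = - 'i%C * conjc (D p false).
  by rewrite -iJ; exact: (rmorphM (@conjc R)).
rewrite hJ; move: (D p false) (conjc (D p false)) => d d' {hJ}.
rewrite /wirt; move: (dC p f (phi w)) (dCbar p f (phi w)) => x y.
case: b => /=; rewrite ?expr0 ?expr1 ?mul1r.
  transitivity ((x * d * (1 + 'i%C * 'i%C) + y * d' * (1 - 'i%C * 'i%C)) / 2).
    by ring.
  by rewrite i2; field.
transitivity ((x * d * (1 - 'i%C * 'i%C) + y * d' * (1 + 'i%C * 'i%C)) / 2).
  by ring.
by rewrite i2; field.
Qed.

End Composition.

Section Pullback.
Context {R : realType} {n m : nat}.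
Local Notation C := R[i].
Variable O : set 'rV[C]_n.
Hypothesis oO : openCN O.
Implicit Types (f : 'rV[C]_n -> C) (w : 'rV[C]_(n + m)).

Definition base_preimage : set 'rV[C]_(n + m) := [set w | O (lsubmx w)].

Lemma base_preimage_open : openCN base_preimage.
Proof.
apply: (@open_comp _ _ (lsubmx : 'rV[R[i]^o]_(n + m) -> 'rV[R[i]^o]_n)) => // w _.
by apply: differentiable_continuous; exact: differentiable_lsubmx.
Qed.

Transparent rdir rderive.
Lemma lsubmx_line_l k c (t : R) w :
  lsubmx (w + t%:C *: rdir (lshift m k) c) = lsubmx w + t%:C *: rdir k c.
Proof. by apply/rowP => j; rewrite !mxE eqE /=. Qed.

Lemma rderive_lsub_l k c f w :
  rderive (rdir (lshift m k) c) (fun w => f (lsubmx w)) w = rderive (rdir k c) f (lsubmx w).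
Proof.
by rewrite /rderive; congr (_ +i* _); congr (derive1 _ 0); apply/funext => t;
  rewrite lsubmx_line_l.
Qed.

Lemma is_rderive_lsub_l k c f w d : is_rderive f (lsubmx w) (rdir k c) d ->
  is_rderive (fun w => f (lsubmx w)) w (rdir (lshift m k) c) d.
Proof.
apply: is_cderive_near; near=> t; by rewrite lsubmx_line_l.
Unshelve. all: by end_near. Qed.

Lemma lsubmx_line_r a c (t : R) w : lsubmx (w + t%:C *: rdir (rshift n a) c) = lsubmx w.
Proof. by apply/rowP => j; rewrite !mxE eq_lrshift /= !mulr0 addr0. Qed.
Local Opaque rdir rderive.

Lemma is_rderive_lsub_r a c f w :
  is_rderive (fun w => f (lsubmx w)) w (rdir (rshift n a) c) 0.
Proof.
apply: is_cderive_near (is_cderive_cst (f (lsubmx w))).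
by near=> t; rewrite lsubmx_line_r.
Unshelve. all: by end_near. Qed.

Lemma wirt_lsub_l b k f w :
  wirt b (lshift m k) (fun w => f (lsubmx w)) w = wirt b k f (lsubmx w).
Proof. by rewrite !wirtE !rderive_lsub_l. Qed.

Lemma wirt_lsub_r b a f w : wirt b (rshift n a) (fun w => f (lsubmx w)) w = 0.
Proof.
rewrite (wirt_is_rderive b (is_rderive_lsub_r _ _ _ _) (is_rderive_lsub_r _ _ _ _)).
by rewrite mulr0 addr0 mul0r.
Qed.

Lemma smooth_lsub f : smooth O f -> smooth base_preimage (fun w => f (lsubmx w)).
Proof.
have cl g w : continuousCN g (lsubmx w) -> continuousCN (fun w => g (lsubmx w)) w.
  move=> cg; apply: (@continuous_comp _ _ _ (lsubmx : 'rV[R[i]^o]_(n + m) -> 'rV[R[i]^o]_n)).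
    by apply: differentiable_continuous; exact: differentiable_lsubmx.
  exact: cg.
move=> sf k; elim: k f sf => [|k IH] f sf.
  by split=> // w Ow; apply: cl; exact: smooth_continuous sf Ow.
apply: (Ck_build base_preimage_open (f' := fun l c w => match fintype.split l with
   | inl k => rderive (rdir k c) f (lsubmx w) | inr _ => 0 end)).
- by move=> w Ow; apply: cl; exact: smooth_continuous sf Ow.
- move=> w l c Ow; case: splitP => [j|a] lj.
    rewrite (_ : l = lshift m j); last exact: val_inj.
    apply: is_rderive_lsub_l; exact: (smooth_is_rderive j c sf Ow).
  rewrite (_ : l = rshift n a); last exact: val_inj.
  exact: is_rderive_lsub_r.
- move=> l c; case: (fintype.split l) => [j|a]; last exact: (Ck_cst base_preimage_open).
  by apply: IH; exact: smooth_rderive.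
Qed.

End Pullback.

Local Opaque rderive rdir dC dCbar.

(** * First-order operators and brackets *)

Section VectorFields.
Context {R : realType} {n m : nat}.
Local Notation C := R[i].
Local Notation V := 'rV[C]_(n + m).
Local Notation vfield := (@vfield R n m).
Variable U : set V.
Hypothesis oU : openCN U.
Implicit Types (f g : V -> C) (w : V) (Y Z : vfield).

Definition smooth_field Y := forall l, smooth U (Y l).

(* [vapp false] and [vapp true] are convertible to [vapply] and [vapply_bar]. *)
Definition vapp (b : bool) (Y : vfield) f w : C :=
  \sum_l (if b then conjc (Y l w) else Y l w) * wirt b l f w.

Lemma smooth_coef b Y l : smooth_field Y ->
  smooth U (fun w => if b then conjc (Y l w) else Y l w).
Proof. by move=> sY; case: b; [apply: smooth_conjc|]; rewrite //; exact: sY. Qed.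

Lemma smooth_vapp b Y f : smooth_field Y -> smooth U f -> smooth U (vapp b Y f).
Proof.
move=> sY sf; apply: smooth_sum => // l _; apply: smoothM => //.
  exact: smooth_coef.
exact: smooth_wirt.
Qed.

Lemma vapp_ext b Y f g w : U w -> (forall w', U w' -> f w' = g w') ->
  vapp b Y f w = vapp b Y g w.
Proof. by move=> Uw fg; apply: eq_bigr => l _; rewrite (wirt_ext oU b l Uw fg). Qed.

Lemma vapp_cst b Y (a : C) w : vapp b Y (fun=> a) w = 0.
Proof. by rewrite /vapp big1 // => l _; rewrite wirt_cst mulr0. Qed.

Lemma vappD b Y f g w : smooth U f -> smooth U g -> U w ->
  vapp b Y (fun w => f w + g w) w = vapp b Y f w + vapp b Y g w.
Proof.
by move=> sf sg Uw; rewrite /vapp -big_split; apply: eq_bigr => l _;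
  rewrite (wirtD (U := U))// mulrDr.
Qed.

Lemma vappM b Y f g w : smooth U f -> smooth U g -> U w ->
  vapp b Y (fun w => f w * g w) w = vapp b Y f w * g w + f w * vapp b Y g w.
Proof.
move=> sf sg Uw; rewrite /vapp mulr_suml mulr_sumr -big_split; apply: eq_bigr => l _.
by rewrite (wirtM (U := U))// mulrDr mulrA [f w * (_ * _)]mulrCA.
Qed.

Lemma vappZ b Y (a : C) f w : smooth U f -> U w ->
  vapp b Y (fun w => a * f w) w = a * vapp b Y f w.
Proof.
by move=> sf Uw; rewrite vappM ?vapp_cst ?mul0r ?add0r //; exact: smooth_cst.
Qed.

Lemma vappN b Y f w : smooth U f -> U w ->
  vapp b Y (fun w => - f w) w = - vapp b Y f w.
Proof.
move=> sf Uw; rewrite -[RHS]mulN1r -(vappZ b Y (-1) sf Uw); apply: vapp_ext Uw _ => w' _.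
by rewrite mulN1r.
Qed.

Lemma vapp_sum (I : Type) (r : seq I) (P : pred I) b Y (F : I -> V -> C) w :
  (forall i, P i -> smooth U (F i)) -> U w ->
  vapp b Y (fun w => \sum_(i <- r | P i) F i w) w =
  \sum_(i <- r | P i) vapp b Y (F i) w.
Proof.
move=> sF Uw; rewrite /vapp exchange_big; apply: eq_bigr => l _.
by rewrite (wirt_sum oU)// mulr_sumr.
Qed.

Lemma vapp_prod (I : finType) b Y (F : I -> V -> C) w :
  (forall i, smooth U (F i)) -> U w ->
  vapp b Y (fun w => \prod_i F i w) w =
  \sum_i \prod_k (if k == i then vapp b Y (F k) w else F k w).
Proof.
move=> sF Uw.
suff H (r : seq I) : uniq r -> vapp b Y (fun w => \prod_(i <- r) F i w) w =
    \sum_(i <- r) \prod_(k <- r) (if k == i then vapp b Y (F k) w else F k w).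
  exact: (H _ (index_enum_uniq _)).
elim: r => [_|i r IH /= /andP[ir ur]].
  rewrite big_nil (@vapp_ext _ _ _ (fun=> 1) w) ?vapp_cst// => w' _.
  by rewrite big_nil.
rewrite (@vapp_ext _ _ _ (fun w => F i w * \prod_(k <- r) F k w) w)//; last first.
  by move=> w' _; rewrite big_cons.
rewrite vappM//; last by apply: smooth_prod => *.
rewrite IH// big_cons big_cons eqxx /=; congr (_ * _ + _).
  by apply: eq_big_seq => k kr; case: eqVneq => // ki; rewrite -ki kr in ir.
rewrite mulr_sumr; apply: eq_big_seq => j jr; rewrite big_cons.
by case: eqVneq => // ij; rewrite ij jr in ir.
Qed.

Lemma vapp_conjc b Y f w : smooth U f -> U w ->
  vapp b Y (fun w => conjc (f w)) w = conjc (vapp (~~ b) Y f w).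
Proof.
move=> sf Uw; rewrite /vapp rmorph_sum; apply: eq_bigr => l _.
rewrite (wirt_conjc (U := U))// rmorphM; congr (_ * _).
by case: b => //=; rewrite conjcK.
Qed.

Lemma bracket_cst Y Z l (a a' : C) w : Y l = (fun=> a) -> Z l = (fun=> a') ->
  bracket Y Z l w = 0.
Proof.
have vc Y1 (a1 : C) : vapply Y1 (fun=> a1) w = 0 by exact: (vapp_cst false).
by move=> Ya Za; rewrite /bracket Ya Za !vc subrr.
Qed.

Lemma bracket_vapp Y Z f w : smooth_field Y -> smooth_field Z -> smooth U f -> U w ->
  vapp false Y (vapp false Z f) w - vapp false Z (vapp false Y f) w =
  vapp false (bracket Y Z) f w.
Proof.
move=> sY sZ sf Uw.
have E Y1 Z1 : smooth_field Y1 -> smooth_field Z1 ->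
    vapp false Y1 (vapp false Z1 f) w =
    \sum_l vapp false Y1 (Z1 l) w * wirt false l f w +
    \sum_l \sum_k Y1 k w * Z1 l w * wirt false k (wirt false l f) w.
  move=> sY1 sZ1; rewrite -[vapp false Z1 f]/(fun w => \sum_l Z1 l w * wirt false l f w).
  rewrite vapp_sum// => [|l _]; last first.
    by apply: smoothM => //; exact: smooth_wirt.
  rewrite -big_split; apply: eq_bigr => l _.
  rewrite vappM//; last exact: smooth_wirt.
  by rewrite {2}/vapp mulr_sumr; congr (_ + _); apply: eq_bigr => k _; rewrite mulrCA mulrA.
(* The second-order parts agree because Wirtinger derivatives commute; only derivatives of the
   coefficients survive in the commutator. *)
have Q : \sum_l \sum_k Y k w * Z l w * wirt false k (wirt false l f) w =
    \sum_l \sum_k Z k w * Y l w * wirt false k (wirt false l f) w.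
  rewrite exchange_big; apply: eq_bigr => l _; apply: eq_bigr => k _.
  by rewrite (wirt_comm oU false l false k sf Uw) [Y _ _ * _]mulrC.
rewrite (E Y Z sY sZ) (E Z Y sZ sY) Q opprD addrACA subrr addr0 -sumrB {E Q}.
apply: eq_bigr => l _.
by rewrite -mulrBl.
Qed.

Lemma bracket_annihilates Y Z f : smooth_field Y -> smooth_field Z -> smooth U f ->
  (forall w, U w -> vapp false Y f w = 0) ->
  (forall w, U w -> vapp false Z f w = 0) ->
  forall w, U w -> vapp false (bracket Y Z) f w = 0.
Proof.
move=> sY sZ sf Yf Zf w Uw; rewrite -(bracket_vapp sY sZ sf Uw).
rewrite (vapp_ext false Y Uw Zf) (vapp_ext false Z Uw Yf).
by rewrite !vapp_cst subrr.
Qed.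

Lemma vapp_comm b Y Z f w : smooth_field Y -> smooth_field Z -> smooth U f ->
  (forall l w, U w -> bracket Y Z l w = 0) -> U w ->
  vapp b Y (vapp b Z f) w = vapp b Z (vapp b Y f) w.
Proof.
move=> sY sZ sf YZ Uw.
have C0 g : smooth U g -> vapp false Y (vapp false Z g) w = vapp false Z (vapp false Y g) w.
  move=> sg; apply/eqP; rewrite -subr_eq0 (bracket_vapp sY sZ sg Uw).
  by rewrite /vapp big1 // => l _; rewrite YZ// mul0r.
case: b; last exact: C0.
(* The barred operators on [f] are the conjugates of the unbarred ones on [conjc f], which reduces
   the second type to the first. *)
have TT Y1 Z1 : smooth_field Y1 -> smooth_field Z1 -> vapp true Y1 (vapp true Z1 f) w =
    conjc (vapp false Y1 (vapp false Z1 (fun w => conjc (f w))) w).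
  move=> sY1 sZ1; rewrite -[LHS]conjcK -(vapp_conjc false Y1 (smooth_vapp true sZ1 sf) Uw).
  congr conjc; apply: vapp_ext Uw _ => w' Uw'.
  by rewrite -(vapp_conjc false Z1 sf Uw').
by rewrite (TT Y Z)// (TT Z Y)// C0//; exact: smooth_conjc.
Qed.

End VectorFields.

(** * Coordinate domains and their overlaps *)

Section Charts.
Context {R : realType} {n : nat} {M : topologicalType}.
Context {X : complex_manifold R n M} {m : nat} {E : M -> lmodType R[i]}.
Context {B : holomorphic_bundle X m E}.
Local Notation C := R[i].
Local Notation coords := 'rV[C]_(n + m).
Implicit Types (c : echart B) (w : coords).

Lemma crd_img_open (i : chart X) (A : set M) : open A -> openCN (crd i @` (cdom i `&` A)).
Proof.
move=> oA; rewrite /openCN openE => _ [x [ix Ax] <-]; rewrite /interior.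
have O1 : nbhs (crd i x : 'rV[R[i]^o]_n) (crd i @` cdom i).
  by apply: open_nbhs_nbhs; split; [exact: cimg_open|exists x].
have ci := @cpt_continuous _ _ _ X i (crd i x) (ex_intro2 _ _ x ix erefl).
have O2 : nbhs (crd i x : 'rV[R[i]^o]_n) [set z | A (cpt i z)].
  by apply: ci; rewrite crdK//; apply: open_nbhs_nbhs.
apply: (@filterS _ (nbhs (crd i x : 'rV[R[i]^o]_n)) _ _ _ _ (@filterI _ (nbhs _) _ _ _ O1 O2)).
by move=> _ [[y iy <-] /=]; rewrite crdK// => Ay; exists y.
Qed.

Lemma eta_neq0_open : openCN [set w : coords | rsubmx w <> 0].
Proof.
rewrite (_ : [set w | _] = \bigcup_(a in [set: 'I_m]) [set w : coords | w 0 (rshift n a) != 0]).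
  apply: bigcup_open => a _.
  apply: (@open_comp _ _ (fun w : 'rV[R[i]^o]_(n + m) => w 0 (rshift n a)) [set z | z != 0]).
    by move=> w _; exact: (@coord_continuous R[i]).
  rewrite (_ : [set z | _] = ~` [set (0 : R[i]^o)]); last first.
    by apply/seteqP; split=> z /= /eqP.
  apply: closed_openC; apply: accessible_closed_set1; apply: hausdorff_accessible.
  exact: norm_hausdorff.
apply/seteqP; split=> [w w0|w [a _ wa] w0].
  apply: contrapT => H; apply: w0; apply/rowP => a; rewrite !mxE.
  by apply/eqP; apply: contraT => wa; case: H; exists a.
by move: w0 wa => /rowP/(_ a); rewrite !mxE => /= ->; rewrite eqxx.
Qed.

Lemma edom_open c : openCN (edom c).
Proof.
have oc : openCN (crd c.1 @` (cdom c.1 `&` fdom c.2)) by apply: crd_img_open; exact: fdom_open.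
exact: (openI (base_preimage_open (m := m) oc) eta_neq0_open).
Qed.

(** The second factor is a preimage from the base, so openness is inherited; [overlapP] gives the
    pointwise reading. *)
Definition overlap c c' : set coords :=
  edom c `&` base_preimage (m := m) (crd c.1 @` (cdom c.1 `&` (cdom c'.1 `&` fdom c'.2))).

Lemma overlap_open c c' : openCN (overlap c c').
Proof.
apply: openI; first exact: edom_open.
by apply: base_preimage_open; apply: crd_img_open; apply: openI; [exact: cdom_open|exact: fdom_open].
Qed.

Lemma edom_base c w : edom c w ->
  [/\ cdom c.1 (base_pt c w), fdom c.2 (base_pt c w) & crd c.1 (base_pt c w) = lsubmx w].
Proof. by rewrite /base_pt => -[[x [cx fx] <-] _]; rewrite crdK. Qed.

Lemma overlapP c c' w : overlap c c' w <->
  [/\ edom c w, cdom c'.1 (base_pt c w) & fdom c'.2 (base_pt c w)].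
Proof.
split=> [[ew [x [cx [c'x f'x] xw]]]|[ew c'x f'x]].
  by rewrite /base_pt -xw crdK.
split=> //; have [cx _ xw] := edom_base ew.
by exists (base_pt c w).
Qed.

End Charts.

Section SmoothMatrices.
Context {R : realType} {N : nat}.
Local Notation C := R[i].
Variable U : set 'rV[C]_N.
Hypothesis oU : openCN U.

Lemma smooth_det p (A : 'rV[C]_N -> 'M[C]_p) :
  (forall i j, smooth U (fun w => A w i j)) -> smooth U (fun w => \det (A w)).
Proof.
move=> sA; rewrite /determinant; apply: smooth_sum => // s _.
apply: smoothM => //; first exact: smooth_cst.
by apply: smooth_prod.
Qed.

(** Cramer's rule: cofactors are polynomial in the entries, and the determinant has no zero on
    [U]. *)
Lemma smooth_invmx p (A : 'rV[C]_N -> 'M[C]_p) i j :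
  (forall i j, smooth U (fun w => A w i j)) ->
  (forall w, U w -> A w \in unitmx) -> smooth U (fun w => invmx (A w) i j).
Proof.
move=> sA uA; have dA w : U w -> \det (A w) != 0.
  by move=> Uw; have := uA w Uw; rewrite unitmxE unitfE.
apply: (@smooth_ext _ _ U oU (fun w => (\det (A w))^-1 *
    ((-1) ^+ (j + i) * \det (row' j (col' i (A w)))))).
  by move=> w Uw; rewrite /invmx uA// !mxE.
apply: smoothM => //; first by apply: smoothV => //; exact: smooth_det.
apply: smoothM => //; first exact: smooth_cst.
apply: smooth_det => k l; apply: smooth_ext (sA (lift j k) (lift i l)) => // w _.
by rewrite !mxE.
Qed.

End SmoothMatrices.

(** * The Chern-Finsler connection in a chart *)

Section FinslerChart.
Context {R : realType} {n : nat} {M : topologicalType}.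
Context {X : complex_manifold R n M} {m : nat} {E : M -> lmodType R[i]}.
Context {B : holomorphic_bundle X m E}.
Variable F : forall x : M, E x -> R.
Hypothesis hF : complex_finsler B F.
Local Notation C := R[i].
Local Notation coords := 'rV[C]_(n + m).
Variable c : echart B.
Implicit Types (w : coords) (f : coords -> C).

Local Notation U := (edom c).
Local Notation G := (Fsq F c).
Local Notation h := (hmx F c).
Local Notation delta := (delta_field F c).
Let oU : openCN U. Proof. exact: edom_open. Qed.

Lemma smooth_Fsq : smooth U G.
Proof. by case: hF. Qed.
Let sG := smooth_Fsq.

Definition dbarFsq (d : 'I_m) : coords -> C := wirt true (rshift n d) G.

Lemma smooth_dbarFsq d : smooth U (dbarFsq d).
Proof. exact: smooth_wirt. Qed.

Lemma hmxE w a d : h w a d = wirt false (rshift n a) (dbarFsq d) w.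
Proof. by rewrite mxE. Qed.

Lemma smooth_hmx a d : smooth U (fun w => h w a d).
Proof.
apply: (smooth_ext oU _ (smooth_wirt oU false (rshift n a) (smooth_dbarFsq d))) => w _.
by rewrite hmxE.
Qed.

(** A left null vector [v] of h would give the value 0 to the Hermitian form at [v], against strict
    pseudoconvexity. *)
Lemma hmx_unit w : U w -> h w \in unitmx.
Proof.
move=> Uw; rewrite unitmxE unitfE; apply/det0P => -[v v0 vh].
case: hF => _ _ _ _ /(_ c w Uw v v0).
rewrite exchange_big big1 ?ltxx// => b _; rewrite -mulr_suml.
have /rowP/(_ b) := vh; rewrite !mxE => E0.
rewrite (eq_bigr (fun j => v 0 j * h w j b)) => [|a _]; last by rewrite mulrC.
by rewrite E0 mul0r.
Qed.

(** The form in which invertibility is used: identities between vertical components are tested by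
    contraction with h, and no derivative of [invmx] is ever computed. *)
Lemma hmx_eq0 w (v : 'I_m -> C) : U w -> (forall d, \sum_a v a * h w a d = 0) ->
  forall a, v a = 0.
Proof.
move=> Uw v0 a; have : (\row_a v a) *m h w = 0.
  by apply/rowP => d; rewrite !mxE -[RHS](v0 d); apply: eq_bigr => b _; rewrite mxE.
move=> /(congr1 (mulmx^~ (invmx (h w)))); rewrite -mulmxA mulmxV ?hmx_unit//.
by rewrite mulmx1 mul0mx => /rowP/(_ a); rewrite !mxE.
Qed.

Lemma Ncoef_spec w k d : U w ->
  \sum_a Ncoef F c a k w * h w a d = wirt false (lshift m k) (dbarFsq d) w.
Proof.
move=> Uw; rewrite /Ncoef.
transitivity (\sum_e (invmx (h w) *m h w) e d * wirt false (lshift m k) (dbarFsq e) w).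
  under eq_bigr => a _ do rewrite mulr_suml.
  rewrite exchange_big; apply: eq_bigr => e _; rewrite mxE mulr_suml.
  by apply: eq_bigr => a _; rewrite mulrAC.
rewrite mulVmx ?hmx_unit// (bigD1 d)//= big1 => [|e ed]; last by rewrite mxE (negPf ed) mul0r.
by rewrite mxE eqxx mul1r addr0.
Qed.

Lemma Ncoef_spec_wirt k d w : U w ->
  \sum_a Ncoef F c a k w * wirt false (rshift n a) (dbarFsq d) w =
  wirt false (lshift m k) (dbarFsq d) w.
Proof.
by move=> Uw; rewrite -(Ncoef_spec k d Uw); apply: eq_bigr => a _; rewrite hmxE.
Qed.

Lemma hmx_eq0_wirt w (v : 'I_m -> C) : U w ->
  (forall d, \sum_a v a * wirt false (rshift n a) (dbarFsq d) w = 0) -> forall a, v a = 0.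
Proof.
move=> Uw H; apply: (hmx_eq0 Uw) => d; rewrite -[RHS](H d).
by apply: eq_bigr => a _; rewrite hmxE.
Qed.

Lemma smooth_Ncoef a k : smooth U (Ncoef F c a k).
Proof.
apply: smooth_sum => // d _; apply: smoothM => //.
  by apply: smooth_invmx => //; [exact: smooth_hmx|exact: hmx_unit].
exact: (smooth_wirt oU false (lshift m k) (smooth_dbarFsq d)).
Qed.

Lemma delta_l k j : delta k (lshift m j) = fun=> (j == k)%:R.
Proof. by apply/funext => w; rewrite /delta_field (unsplitK (inl _ j)). Qed.

Lemma delta_r k a : delta k (rshift n a) = fun w => - Ncoef F c a k w.
Proof. by apply/funext => w; rewrite /delta_field (unsplitK (inr _ a)). Qed.

Lemma smooth_delta k : smooth_field U (delta k).
Proof.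
move=> l; rewrite -(splitK l); case: (fintype.split l) => [j|a] /=.
  by rewrite delta_l; exact: smooth_cst.
by rewrite delta_r; apply: smoothN => //; exact: smooth_Ncoef.
Qed.

Lemma vapp_delta b k f w : vapp b (delta k) f w = wirt b (lshift m k) f w -
  \sum_a (if b then conjc (Ncoef F c a k w) else Ncoef F c a k w) * wirt b (rshift n a) f w.
Proof.
rewrite /vapp big_split_ord /= (bigD1 k)//= big1 => [|j jk]; last first.
  by rewrite delta_l (negPf jk); case: b; rewrite ?rmorph0 mul0r.
rewrite delta_l eqxx addr0; congr (_ + _).
  by case: b; rewrite ?rmorph1 mul1r.
rewrite -sumrN; apply: eq_bigr => a _; rewrite delta_r.
by case: b; rewrite ?rmorphN mulNr.
Qed.

Lemma delta_dbarFsq k d w : U w -> vapp false (delta k) (dbarFsq d) w = 0.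
Proof.
move=> Uw; rewrite vapp_delta -(Ncoef_spec k d Uw).
by rewrite -sumrB big1 // => a _; rewrite hmxE subrr.
Qed.

(* Both fields annihilate every d(F^2)/d(conj eta^d), hence so does their bracket,
   which is vertical; h is invertible. *)
Lemma bracket_delta j k l w : U w -> bracket (delta j) (delta k) l w = 0.
Proof.
move=> Uw.
have bl i : bracket (delta j) (delta k) (lshift m i) w = 0.
  exact: (bracket_cst w (delta_l j i) (delta_l k i)).
rewrite -(splitK l); case: (fintype.split l) => [i|a] //=.
apply: (hmx_eq0 Uw (v := fun a => bracket (delta j) (delta k) (rshift n a) w)) => d.
have := bracket_annihilates oU (smooth_delta j) (smooth_delta k) (smooth_dbarFsq d)
  (delta_dbarFsq j d) (delta_dbarFsq k d) Uw.
move: (bracket _ _) bl => Y bl.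
rewrite /vapp big_split_ord /= big1 => [|i _]; last by rewrite bl mul0r.
by rewrite add0r => H; rewrite -[RHS]H; apply: eq_bigr => b _; rewrite hmxE.
Qed.

Lemma delta_comm b j k f w : smooth U f -> U w ->
  vapp b (delta j) (vapp b (delta k) f) w = vapp b (delta k) (vapp b (delta j) f) w.
Proof.
move=> sf Uw; apply: (vapp_comm oU) => //; [exact: smooth_delta|exact: smooth_delta|].
by move=> l w' Uw'; exact: bracket_delta.
Qed.

(** [vert_field] has constant components, and so have the base components of [delta_field]. The
    bracket is therefore vertical, and what remains is minus the vertical derivative of [- N]. *)
Lemma LcoefE a b k w : U w -> Lcoef F c a b k w = wirt false (rshift n b) (Ncoef F c a k) w.
Proof.
move=> Uw; rewrite /Lcoef /bott /vproj.
have vb f : vapply (vert_field (R := R) b) f w = wirt false (rshift n b) f w.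
  rewrite /vapply (bigD1 (rshift n b))//= big1 => [|l lb].
    by rewrite /vert_field eqxx mul1r addr0.
  by rewrite /vert_field (negPf lb) mul0r.
have bE l : bracket (delta k) (vert_field b) l w = - wirt false (rshift n b) (delta k l) w.
  by rewrite /bracket vb [X in X - _](vapp_cst false) sub0r.
rewrite bE delta_r (wirtN oU _ _ (smooth_Ncoef a k) Uw) opprK big1 ?addr0// => i _.
by rewrite bE delta_l wirt_cst oppr0 mulr0.
Qed.

Lemma smooth_Lcoef a b k : smooth U (Lcoef F c a b k).
Proof.
have H := smooth_wirt oU false (rshift n b) (smooth_Ncoef a k).
by apply: smooth_ext H => // w Uw; rewrite LcoefE.
Qed.

End FinslerChart.

(** * The Euler field and homogeneity in the fibre *)

Section Euler.
Context {R : realType} {n m : nat}.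
Local Notation C := R[i].
Local Notation V := 'rV[C]_(n + m).
Variable U : set V.
Hypothesis oU : openCN U.
Implicit Types (f g : V -> C) (w : V).

(** The radial field eta^a d/d(eta^a) of the fibres; [vapp true] turns it into the conjugate
    field. *)
Definition euler : vfield (R := R) (n := n) (m := m) :=
  fun l w => if fintype.split l is inr _ then w 0 l else 0.

Lemma euler_l k : euler (lshift m k) = fun=> 0.
Proof. by apply/funext => w; rewrite /euler (unsplitK (inl _ k)). Qed.

Lemma euler_r a : euler (rshift n a) = fun w => w 0 (rshift n a).
Proof. by apply/funext => w; rewrite /euler (unsplitK (inr _ a)). Qed.

Lemma vapp_euler b f w : vapp b euler f w = \sum_a
  (if b then conjc (w 0 (rshift n a)) else w 0 (rshift n a)) * wirt b (rshift n a) f w.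
Proof.
rewrite /vapp big_split_ord /= big1 ?add0r => [|k _]; last first.
  by rewrite euler_l; case: b; rewrite ?rmorph0 mul0r.
by apply: eq_bigr => a _; rewrite euler_r.
Qed.

(** The coefficients are the fibre coordinates, or their conjugates when [b] is true. So only a
    vertical derivative of the same type as the Euler operator picks up an extra term. *)
Lemma wirt_euler b b' l f w : smooth U f -> U w ->
  wirt b' l (vapp b euler f) w =
  (b == b')%:R * \sum_a (l == rshift n a)%:R * wirt b (rshift n a) f w +
  vapp b euler (wirt b' l f) w.
Proof.
move=> sf Uw.
pose y a : V -> C := fun w => if b then conjc (w 0 (rshift n a)) else w 0 (rshift n a).
have sc a : smooth U (fun w : V => w 0 (rshift n a)) by exact: smooth_coord.
have sy a : smooth U (y a) by rewrite /y; case: (b); [exact: smooth_conjc|].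
have wy a : wirt b' l (y a) w = ((b == b') && (l == rshift n a))%:R.
  rewrite /y; case: (b); rewrite ?(wirt_conjc _ _ (sc a) Uw) wirt_coord.
    by rewrite negbK rmorph_nat; case: (b').
  by case: (b').
have sw a : smooth U (wirt b (rshift n a) f) by exact: smooth_wirt.
transitivity (wirt b' l (fun w => \sum_a y a w * wirt b (rshift n a) f w) w).
  by apply: (wirt_ext oU) => // w' _; rewrite vapp_euler.
rewrite (wirt_sum oU) => [||//]; last by move=> a _; apply: smoothM.
rewrite vapp_euler mulr_sumr -big_split; apply: eq_bigr => a _.
rewrite (wirtM _ _ (sy a) (sw a) Uw) wy; congr (_ + _).
  by rewrite mulrA -natrM mulnb.
by rewrite (wirt_comm oU b' l b (rshift n a) sf Uw).
Qed.

Lemma wirt_euler_neq b l f w : smooth U f -> U w ->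
  wirt b l (vapp (~~ b) euler f) w = vapp (~~ b) euler (wirt b l f) w.
Proof. by move=> sf Uw; rewrite wirt_euler//; case: (b); rewrite mul0r add0r. Qed.

Lemma wirt_euler_r b a f w : smooth U f -> U w ->
  wirt b (rshift n a) (vapp b euler f) w =
  wirt b (rshift n a) f w + vapp b euler (wirt b (rshift n a) f) w.
Proof.
move=> sf Uw; rewrite wirt_euler// eqxx mul1r (bigD1 a)//= eqxx mul1r.
rewrite big1 ?addr0// => a' aa'; by rewrite eq_rshift eq_sym (negPf aa') mul0r.
Qed.

Definition fscale (lam : C) w : V := row_mx (lsubmx w) (lam *: rsubmx w).

(** The derivative at [t = 0] of [f (fscale (1 + t mu) w)] is computed both by the chain rule and
    from homogeneity of bidegree (1,1). The values [mu = 1] and [mu = 'i] separate the two Euler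
    fields. *)
Lemma euler_homogeneous b f w : smooth U f -> U w ->
  (forall lam, f (fscale lam w) = lam * conjc lam * f w) -> vapp b euler f w = f w.
Proof.
move=> sf Uw hom.
have key mu : mu * vapp false euler f w + conjc mu * vapp true euler f w =
    (mu + conjc mu) * f w.
  pose v : V := row_mx 0 (mu *: rsubmx w).
  have E (t : R) : w + t%:C *: v = fscale (1 + t%:C * mu) w.
    rewrite /v /fscale -{1}(hsubmxK w) scale_row_mx add_row_mx scaler0 addr0.
    by rewrite scalerDl scale1r scalerA.
  have H1 := is_rderive_smooth oU v sf Uw.
  have Hid : is_cderive (fun t : R => t%:C) 1.
    by have := is_cderive_real (@is_derive_id _ _ (0 : R) 1).
  have P nu : is_cderive (fun t : R => 1 + t%:C * nu) nu.
    have := is_cderiveD (is_cderive_cst (1 : C)) (is_cderiveM Hid (is_cderive_cst nu)).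
    by rewrite mul1r mulr0 addr0 add0r.
  have H2 := is_cderiveM (is_cderiveM (P mu) (P (conjc mu))) (is_cderive_cst (f w)).
  rewrite !mul0r !addr0 mulr0 addr0 mul1r mulr1 in H2.
  have H3 : is_cderive (fun t : R => (1 + t%:C * mu) * (1 + t%:C * conjc mu) * f w)
      (\sum_l (dC l f w * v 0 l + dCbar l f w * conjc (v 0 l))).
    apply: is_cderive_near H1; near=> t; rewrite E hom rmorphD rmorph1 rmorphM.
    by rewrite /= oppr0.
  rewrite -(is_cderive_unique H3 H2) big_split_ord /= big1 ?add0r => [|k _]; last first.
    by rewrite /v row_mxEl mxE rmorph0 !mulr0 addr0.
  rewrite !vapp_euler !mulr_sumr -big_split; apply: eq_bigr => a _.
  rewrite /v row_mxEr !mxE rmorphM /=.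
  by rewrite [dC _ _ _ * _]mulrC [dCbar _ _ _ * _]mulrC !mulrA.
suff [Ef Ebf] : vapp false euler f w = f w /\ vapp true euler f w = f w by case: (b).
move: key; move: (vapp false euler f w) (vapp true euler f w) (f w) => x y z key {hom}.
have := key 'i%C; have := key 1; rewrite rmorph1 !mul1r => E1.
have -> : conjc 'i = - 'i%C :> C by apply/eqP; rewrite eq_complex /= oppr0 !eqxx.
rewrite subrr mul0r mulNr -mulrBr => /eqP; rewrite mulf_eq0 => /orP[|/eqP xy].
  by rewrite eq_complex /= oner_eq0 andbF.
have {}xy : x = y by apply/eqP; rewrite -subr_eq0 xy.
have zx : z = x.
  rewrite -xy in E1; apply: (@mulfI _ (1 + 1)); first by rewrite (_ : 1 + 1 = 2%:R) ?pnatr_eq0.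
  by rewrite -E1 mulrDl !mul1r.
by rewrite -xy zx.
Unshelve. all: by end_near. Qed.

End Euler.

Section Homogeneity.
Context {R : realType} {n : nat} {M : topologicalType}.
Context {X : complex_manifold R n M} {m : nat} {E : M -> lmodType R[i]}.
Context {B : holomorphic_bundle X m E}.
Variable F : forall x : M, E x -> R.
Hypothesis hF : complex_finsler B F.
Local Notation C := R[i].
Local Notation coords := 'rV[C]_(n + m).
Variable c : echart B.
Implicit Types (w : coords) (f : coords -> C).

Local Notation U := (edom c).
Local Notation G := (Fsq F c).
Local Notation h := (hmx F c).
Let oU : openCN U. Proof. exact: edom_open. Qed.
Let sG := smooth_Fsq hF c.

Definition fibre_at (z : 'rV[C]_n) (eta : 'rV[C]_m) : E (cpt c.1 z) :=
  \sum_a eta 0 a *: frame c.2 (cpt c.1 z) a.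

Lemma FsqE w : G w = (F (fibre_at (lsubmx w) (rsubmx w)) ^+ 2)%:C.
Proof.
rewrite /Fsq; congr ((F _ ^+ 2)%:C); apply: eq_bigr => a _.
by rewrite mxE.
Qed.

Lemma Fsq_fscale lam w : G (fscale lam w) = lam * conjc lam * G w.
Proof.
rewrite !FsqE /fscale row_mxKl row_mxKr -sqr_normc.
move: (lsubmx w) (rsubmx w) => z eta.
have -> : fibre_at z (lam *: eta) = lam *: fibre_at z eta.
  by rewrite /fibre_at scaler_sumr; apply: eq_bigr => a _; rewrite mxE scalerA.
case: hF => _ _ F0 Fh _.
rewrite [LHS](rmorphXn (real_complex R)) [(_ ^+ 2)%:C](rmorphXn (real_complex R)) -exprMn /=.
(* The homogeneity axiom excludes [lam = 0]; there both sides vanish, because F is 0 on the zero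
   vector. *)
have [->|lam0] := eqVneq lam 0; last by rewrite Fh.
by rewrite scale0r (F0 _ 0).2// normr0 mul0r.
Qed.

Lemma euler_Fsq b w : U w -> vapp b (euler (n := n)) G w = G w.
Proof. by move=> Uw; apply: (euler_homogeneous oU) => // lam; exact: Fsq_fscale. Qed.

(** F^2 has bidegree (1,1) in eta and its conjugate, so one conjugate derivative leaves bidegree
    (1,0). This lemma expresses the degree in eta, [eulerbar_dbarFsq] the one in the conjugate. *)
Lemma euler_dbarFsq d w : U w -> \sum_a w 0 (rshift n a) * h w a d = dbarFsq F c d w.
Proof.
move=> Uw; have := wirt_euler_neq oU true (rshift n d) sG Uw.
rewrite (wirt_ext oU true (rshift n d) Uw (euler_Fsq false)) => E1.
rewrite [RHS]E1 vapp_euler; apply: eq_bigr => a _.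
by rewrite hmxE.
Qed.

Lemma euler_dbarFsq_wirt d w : U w ->
  \sum_a w 0 (rshift n a) * wirt false (rshift n a) (dbarFsq F c d) w = dbarFsq F c d w.
Proof.
by move=> Uw; rewrite -[RHS](euler_dbarFsq d Uw); apply: eq_bigr => a _; rewrite hmxE.
Qed.

Lemma eulerbar_dbarFsq d w : U w -> vapp true (euler (n := n)) (dbarFsq F c d) w = 0.
Proof.
move=> Uw; have := wirt_euler_r oU true d sG Uw.
rewrite (wirt_ext oU true (rshift n d) Uw (euler_Fsq true)).
by rewrite -[X in X = _]addr0 => /addrI /esym.
Qed.

Lemma eulerbar_dbarFsq_wirt d l w : U w -> vapp true (euler (n := n)) (wirt false l (dbarFsq F c d)) w = 0.
Proof.
move=> Uw; rewrite -(wirt_euler_neq oU false l (smooth_dbarFsq hF c d) Uw).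
by rewrite (wirt_ext oU false l Uw (eulerbar_dbarFsq d)) wirt_cst.
Qed.

Lemma eulerbar_hmx a d w : U w -> vapp true (euler (n := n)) (fun w => h w a d) w = 0.
Proof.
move=> Uw; rewrite -[RHS](eulerbar_dbarFsq_wirt d (rshift n a) Uw).
by apply: (vapp_ext oU _ _ Uw) => w' _; rewrite hmxE.
Qed.

(* Under a conformal change, delta_bar varies by a multiple of the conjugate Euler
   field, so this is what makes the new curvature computable with the old one. *)
Lemma eulerbar_Ncoef a k w : U w -> vapp true (euler (n := n)) (Ncoef F c a k) w = 0.
Proof.
move=> Uw; apply: (hmx_eq0 hF Uw (v := fun a => vapp true (euler (n := n)) (Ncoef F c a k) w)) => d.
have sN b : smooth U (Ncoef F c b k) by exact: smooth_Ncoef.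
have sh b : smooth U (fun w => h w b d) by exact: smooth_hmx.
rewrite -[RHS](eulerbar_dbarFsq_wirt d (lshift m k) Uw).
rewrite -(vapp_ext oU true (euler (n := n)) Uw (fun w' => Ncoef_spec hF k d (w := w'))).
rewrite (vapp_sum oU) => [||//]; last by move=> b _; apply: smoothM.
apply: eq_bigr => b _; rewrite (vappM _ _ (sN b) (sh b) Uw).
by rewrite eulerbar_hmx// mulr0 addr0.
Qed.

Lemma eulerbar_Lcoef a b k w : U w -> vapp true (euler (n := n)) (Lcoef F c a b k) w = 0.
Proof.
move=> Uw; rewrite (vapp_ext oU true (euler (n := n)) Uw (fun w' => LcoefE hF a b k (w := w'))).
rewrite -(wirt_euler_neq oU false (rshift n b) (smooth_Ncoef hF c a k) Uw).
by rewrite (wirt_ext oU false (rshift n b) Uw (eulerbar_Ncoef a k)) wirt_cst.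
Qed.

(** Two Euler identities give F^2 as the Hermitian form h evaluated at eta, which is positive for
    nonzero eta. *)
Lemma Fsq_neq0 w : U w -> G w != 0.
Proof.
move=> Uw; rewrite -(euler_Fsq true Uw) vapp_euler.
have [v0|eta0] := eqVneq (rsubmx w) 0; first by case: Uw => _; rewrite v0.
case: hF => _ _ _ _ /(_ c w Uw (rsubmx w) eta0); rewrite exchange_big.
rewrite (eq_bigr (fun d => conjc (w 0 (rshift n d)) * dbarFsq F c d w)) => [|d _].
  by rewrite lt0r => /andP[].
rewrite -mulr_suml mulrC mxE; congr (_ * _); rewrite -(euler_dbarFsq d Uw).
by apply: eq_bigr => a _; rewrite [rsubmx w _ _]mxE mulrC.
Qed.

End Homogeneity.

(** * Conformal change *)

Section AbstractRescaling.
Context {R : realType} {n m : nat}.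
Local Notation C := R[i].
Local Notation V := 'rV[C]_(n + m).
Variables (U : set V) (oU : openCN U).
Implicit Types (w : V).

(** [H d] stands for d(F^2)/d(conj eta^d) and [S] for the conformal factor. Differentiating [S * H]
    in the base adds the term [S_k * H]. As [H] has degree 1 in eta, this is a contraction of eta
    with h, hence a correction of [N] along eta. *)
Lemma rescaled_coef (S : V -> C) (H Ht N Nt : 'I_m -> V -> C) (k : 'I_n) :
  smooth U S -> (forall d, smooth U (H d)) ->
  (forall w, U w -> S w != 0) ->
  (forall a w, U w -> wirt false (rshift n a) S w = 0) ->
  (forall d w, U w -> Ht d w = S w * H d w) ->
  (forall w, U w -> forall v : 'I_m -> C,
     (forall d, \sum_a v a * wirt false (rshift n a) (H d) w = 0) -> forall a, v a = 0) ->
  (forall d w, U w ->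
     \sum_a N a w * wirt false (rshift n a) (H d) w = wirt false (lshift m k) (H d) w) ->
  (forall d w, U w ->
     \sum_a Nt a w * wirt false (rshift n a) (Ht d) w = wirt false (lshift m k) (Ht d) w) ->
  (forall d w, U w -> \sum_a w 0 (rshift n a) * wirt false (rshift n a) (H d) w = H d w) ->
  forall a w, U w ->
  Nt a w = N a w + wirt false (lshift m k) S w / S w * w 0 (rshift n a).
Proof.
move=> sS sH S0 Sv HtE nondeg NH NtH eH a w Uw.
have HtW l d : wirt false l (Ht d) w =
    wirt false l S w * H d w + S w * wirt false l (H d) w.
  by rewrite -(wirtM false l sS (sH d) Uw); apply: (wirt_ext oU false l Uw) => w'; exact: HtE.
apply/eqP; rewrite -subr_eq0; apply/eqP; move: a.
apply: (nondeg w Uw) => d; apply: (mulfI (S0 w Uw)); rewrite mulr0.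
have E1 : S w * \sum_a Nt a w * wirt false (rshift n a) (H d) w =
    wirt false (lshift m k) S w * H d w + S w * wirt false (lshift m k) (H d) w.
  rewrite -HtW -(NtH d w Uw) mulr_sumr; apply: eq_bigr => b _.
  by rewrite HtW Sv// mul0r add0r mulrCA.
have E2 := NH d w Uw; have E3 := eH d w Uw.
rewrite (eq_bigr (fun a => Nt a w * wirt false (rshift n a) (H d) w -
   (N a w * wirt false (rshift n a) (H d) w + wirt false (lshift m k) S w / S w *
   (w 0 (rshift n a) * wirt false (rshift n a) (H d) w)))); last first.
  by move=> b _; rewrite mulrBl mulrDl mulrA.
rewrite sumrB big_split -mulr_sumr mulrBr E1 [in X in _ - X]E2 E3 mulrDr.
move: (wirt false (lshift m k) S w) (wirt false (lshift m k) (H d) w) => p q.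
by rewrite [X in _ - (_ + X)]mulrCA [p / _ * _]mulrC mulrCA; have := S0 w Uw;
  move: (S w) (H d w) => s x s0; field.
Qed.

Lemma wirt_add_vertical (N Nt al : V -> C) (a b : 'I_m) w :
  smooth U N -> smooth U al -> (forall w, U w -> wirt false (rshift n b) al w = 0) ->
  (forall w, U w -> Nt w = N w + al w * w 0 (rshift n a)) -> U w ->
  wirt false (rshift n b) Nt w = wirt false (rshift n b) N w + (a == b)%:R * al w.
Proof.
move=> sN sA Av NtE Uw.
have sc : smooth U (fun w : V => w 0 (rshift n a)) by exact: smooth_coord.
rewrite (wirt_ext oU false (rshift n b) Uw NtE).
rewrite (wirtD false (rshift n b) sN (smoothM oU sA sc) Uw).
rewrite (wirtM _ _ sA sc Uw) Av// mul0r add0r wirt_coord /= eq_rshift eq_sym mulrC.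
by [].
Qed.

End AbstractRescaling.

Section Conformal.
Context {R : realType} {n : nat} {M : topologicalType}.
Context {X : complex_manifold R n M} {m : nat} {E : M -> lmodType R[i]}.
Context {B : holomorphic_bundle X m E}.
Variables (F Ft : forall x : M, E x -> R) (sigma : M -> R).
Hypotheses (hF : complex_finsler B F) (hFt : complex_finsler B Ft).
Hypothesis hFtE : forall x (v : E x), Ft v ^+ 2 = expR (sigma x) * F v ^+ 2.
Local Notation C := R[i].
Local Notation coords := 'rV[C]_(n + m).
Implicit Types (w : coords) (c : echart B).

Definition conf_factor c w : C := (expR (sigma (base_pt c w)))%:C.

(** This is d sigma/dz^k, written as a logarithmic derivative because e^sigma is the function that
    enters the metric. *)
Definition conf_form c (k : 'I_n) w : C :=
  wirt false (lshift m k) (conf_factor c) w / conf_factor c w.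

Let s c (z : 'rV[C]_n) : C := (expR (sigma (cpt c.1 z)))%:C.

Lemma conf_factor_neq0 c w : conf_factor c w != 0.
Proof. by rewrite -[0]/((0 : R)%:C) (inj_eq (@complexI R)) gt_eqF// expR_gt0. Qed.

Lemma Fsq_conf c w : Fsq Ft c w = conf_factor c w * Fsq F c w.
Proof. by rewrite /Fsq hFtE [LHS](rmorphM (real_complex R)). Qed.

(** The factor is the quotient of the two smooth functions F~^2 and F^2, the latter without zeros on
    the domain. *)
Lemma smooth_conf_factor c : smooth (edom c) (conf_factor c).
Proof.
have oU : openCN (edom c) by exact: edom_open.
apply: (@smooth_ext _ _ _ oU (fun w => Fsq Ft c w * (Fsq F c w)^-1)).
  by move=> w Uw; rewrite Fsq_conf mulfK// (Fsq_neq0 hF).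
apply: smoothM => //; first exact: smooth_Fsq.
by apply: smoothV => //; [exact: Fsq_neq0|exact: smooth_Fsq].
Qed.

Let conf_factorE c : conf_factor c = fun w => s c (lsubmx w).
Proof. by []. Qed.

Lemma wirt_conf_factor b c a w : wirt b (rshift n a) (conf_factor c) w = 0.
Proof. by rewrite conf_factorE wirt_lsub_r. Qed.

Lemma conf_form_lsub c k w :
  conf_form c k w = (fun z => wirt false k (s c) z / s c z) (lsubmx w).
Proof. by rewrite /conf_form conf_factorE wirt_lsub_l. Qed.

Lemma wirt_conf_form b c k a w : wirt b (rshift n a) (conf_form c k) w = 0.
Proof.
rewrite (_ : conf_form c k = fun w => (fun z => wirt false k (s c) z / s c z) (lsubmx w)).
  exact: (wirt_lsub_r b a (fun z => wirt false k (s c) z / s c z)).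
by apply/funext => w'; exact: conf_form_lsub.
Qed.

Lemma smooth_conf_form c k : smooth (edom c) (conf_form c k).
Proof.
have oU : openCN (edom c) by exact: edom_open.
apply: smoothM => //; first exact: (smooth_wirt oU _ _ (smooth_conf_factor c)).
by apply: smoothV => //; [move=> w _; exact: conf_factor_neq0|exact: smooth_conf_factor].
Qed.

Lemma dbarFsq_conf c d w : edom c w -> dbarFsq Ft c d w = conf_factor c w * dbarFsq F c d w.
Proof.
move=> Uw; have oU : openCN (edom c) by exact: edom_open.
have sS := smooth_conf_factor c; have sG := smooth_Fsq hF c.
have := wirtM true (rshift n d) sS sG Uw; rewrite wirt_conf_factor mul0r add0r => <-.
by apply: (wirt_ext oU true (rshift n d) Uw) => w' _; exact: Fsq_conf.
Qed.

Lemma Ncoef_conf c a k w : edom c w ->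
  Ncoef Ft c a k w = Ncoef F c a k w + conf_form c k w * w 0 (rshift n a).
Proof.
move=> Uw; have oU : openCN (edom c) by exact: edom_open.
exact: (rescaled_coef oU (smooth_conf_factor c) (fun d => smooth_dbarFsq hF c d)
  (fun w' _ => conf_factor_neq0 c w') (fun a' w' _ => wirt_conf_factor false c a' w')
  (fun d w' Uw' => dbarFsq_conf d Uw') (fun w' Uw' v => hmx_eq0_wirt hF Uw' (v := v))
  (fun d w' Uw' => Ncoef_spec_wirt hF k d Uw') (fun d w' Uw' => Ncoef_spec_wirt hFt k d Uw')
  (fun d w' Uw' => euler_dbarFsq_wirt hF d Uw') a Uw).
Qed.

Lemma Lcoef_conf c a b k w : edom c w ->
  Lcoef Ft c a b k w = Lcoef F c a b k w + (a == b)%:R * conf_form c k w.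
Proof.
move=> Uw; have oU : openCN (edom c) by exact: edom_open.
apply: (etrans (LcoefE hFt a b k Uw)).
apply: (etrans (wirt_add_vertical oU (smooth_Ncoef hF c a k) (smooth_conf_form c k)
  (fun w' _ => wirt_conf_form false c k b w') (fun w' Uw' => Ncoef_conf a k Uw') Uw)).
by congr (_ + _); rewrite (LcoefE hF).
Qed.

Lemma delta_bar_conf c k (f : coords -> C) w : edom c w ->
  vapp true (euler (n := n)) f w = 0 -> delta_bar Ft c k f w = delta_bar F c k f w.
Proof.
move=> Uw; rewrite vapp_euler => E0.
apply: (etrans (vapp_delta Ft c true k f w)).
apply: (etrans _ (esym (vapp_delta F c true k f w))).
apply: (congr1 (fun x => wirt true (lshift m k) f w - x)).
transitivity (\sum_e (conjc (Ncoef F c e k w) * wirt true (rshift n e) f w +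
   conjc (conf_form c k w) * (conjc (w 0 (rshift n e)) * wirt true (rshift n e) f w))).
  by apply: eq_bigr => e _; rewrite (Ncoef_conf e k Uw) rmorphD rmorphM mulrDl mulrA.
by rewrite big_split -mulr_sumr E0 mulr0; exact: addr0.
Qed.

Lemma Omega_conf c a b j k w : edom c w ->
  Omega Ft c a b j k w = - delta_bar F c k (Lcoef Ft c a b j) w.
Proof.
move=> Uw; apply: (congr1 (@GRing.opp C)).
exact: (delta_bar_conf k Uw (eulerbar_Lcoef hFt a b j Uw)).
Qed.

End Conformal.

(** * Change of chart and frame *)

Section AbstractChange.
Context {R : realType} {n m : nat}.
Local Notation C := R[i].
Local Notation V := 'rV[C]_(n + m).
Variables (W U' : set V) (oW : openCN W) (oU' : openCN U') (e : V -> V).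
Hypothesis eW : forall w, W w -> U' (e w).
Hypothesis he : forall p, holomorphic W (fun w => e w 0 p).
Implicit Types (w : V) (f : V -> C).

(** Holomorphic Jacobian of the coordinate change. Two features of a bundle change are recorded
    next: base coordinates do not depend on the fibre, and fibre coordinates are at most affine in
    it. *)
Definition dmap l p : V -> C := wirt false l (fun w => e w 0 p).

Hypothesis dmap_rl : forall b l w, W w -> dmap (rshift n b) (lshift m l) w = 0.
Hypothesis dmap_rrr : forall b d a w, W w ->
  wirt false (rshift n d) (dmap (rshift n b) (rshift n a)) w = 0.

Lemma smooth_dmap l p : smooth W (dmap l p).
Proof. by apply: smooth_wirt => //; have [] := he p. Qed.

Lemma wirt_true_dmap l l' p w : W w -> wirt true l (dmap l' p) w = 0.
Proof.
move=> Ww; have [sp hp] := he p; rewrite /dmap (wirt_comm oW true l false l' sp Ww).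
rewrite (wirt_ext oW false l' (g := fun=> 0) Ww) ?wirt_cst// => w' Ww'.
exact: hp.
Qed.

Lemma vapp_true_dmap Y l p w : W w -> vapp true Y (dmap l p) w = 0.
Proof. by move=> Ww; rewrite /vapp big1 // => k _; rewrite wirt_true_dmap// mulr0. Qed.

Lemma wirt_r_J d k l w : W w -> wirt false (rshift n d) (dmap (lshift m k) (lshift m l)) w = 0.
Proof.
move=> Ww; have [sp hp] := he (lshift m l).
rewrite /dmap (wirt_comm oW _ _ _ _ sp Ww).
by rewrite (wirt_ext oW false (lshift m k) (g := fun=> 0) Ww) ?wirt_cst// => w' Ww'; exact: dmap_rl.
Qed.

Lemma wirt_e b l f w : smooth U' f -> W w -> wirt b l (fun w => f (e w)) w =
  \sum_p wirt b p f (e w) * (if b then conjc (dmap l p w) else dmap l p w).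
Proof. by move=> sf Ww; rewrite (wirt_comp oU' eW he b l sf Ww). Qed.

Lemma wirt_e_r b a f w : smooth U' f -> W w -> wirt b (rshift n a) (fun w => f (e w)) w =
  \sum_c wirt b (rshift n c) f (e w) *
    (if b then conjc (dmap (rshift n a) (rshift n c) w) else dmap (rshift n a) (rshift n c) w).
Proof.
move=> sf Ww; rewrite wirt_e// big_split_ord /= big1 ?add0r// => l _.
by rewrite dmap_rl// rmorph0; case: b; rewrite mulr0.
Qed.

Lemma vapp_e b Y f w : smooth U' f -> W w -> vapp b Y (fun w => f (e w)) w =
  \sum_p (if b then conjc (\sum_l Y l w * dmap l p w) else \sum_l Y l w * dmap l p w) *
     wirt b p f (e w).
Proof.
move=> sf Ww; rewrite /vapp.
under eq_bigr => l _ do rewrite wirt_e// mulr_sumr.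
rewrite exchange_big; apply: eq_bigr => p _.
have -> : (if b then conjc (\sum_l Y l w * dmap l p w) else \sum_l Y l w * dmap l p w) =
   \sum_l (if b then conjc (Y l w) else Y l w) * (if b then conjc (dmap l p w) else dmap l p w).
  by case: b => //; rewrite rmorph_sum; apply: eq_bigr => l _; rewrite rmorphM.
by rewrite mulr_suml; apply: eq_bigr => l _; rewrite mulrCA mulrC.
Qed.

(** For a field carried by [e] to a combination of the [Y']. Since [e] is holomorphic, the same
    coefficients serve the barred operators after conjugation. *)
Lemma vapp_push (I : finType) b Y (Y' : I -> vfield) (J : I -> C) f w :
  smooth U' f -> W w ->
  (forall p, \sum_l Y l w * dmap l p w = \sum_i J i * Y' i p (e w)) ->
  vapp b Y (fun w => f (e w)) w =
  \sum_i (if b then conjc (J i) else J i) * vapp b (Y' i) f (e w).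
Proof.
move=> sf Ww H; rewrite vapp_e//; under eq_bigr => p _ do rewrite H.
rewrite /vapp; under [RHS]eq_bigr => i _ do rewrite mulr_sumr.
rewrite [RHS]exchange_big; apply: eq_bigr => p _.
have -> : (if b then conjc (\sum_i J i * Y' i p (e w)) else \sum_i J i * Y' i p (e w)) =
   \sum_i (if b then conjc (J i) else J i) * (if b then conjc (Y' i p (e w)) else Y' i p (e w)).
  by case: b => //; rewrite rmorph_sum; apply: eq_bigr => l _; rewrite rmorphM.
by rewrite mulr_suml; apply: eq_bigr => i _; rewrite mulrA.
Qed.

Lemma wirt_true_r_e (G G' : V -> C) d w : smooth U' G' -> (forall w, W w -> G w = G' (e w)) ->
  W w -> wirt true (rshift n d) G w =
  \sum_a conjc (dmap (rshift n d) (rshift n a) w) * wirt true (rshift n a) G' (e w).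
Proof.
move=> sG' GE Ww; rewrite (wirt_ext oW true (rshift n d) Ww GE) wirt_e_r//.
by apply: eq_bigr => a _; rewrite mulrC.
Qed.

Section Connection.
Variables (H H' : 'I_m -> V -> C).
Let J k l := dmap (lshift m k) (lshift m l).
Let Mat a b := dmap (rshift n b) (rshift n a).
Hypothesis smooth_H' : forall d, smooth U' (H' d).
Hypothesis HE : forall d w, W w -> H d w = \sum_a conjc (Mat a d w) * H' a (e w).
Hypothesis unit_h : forall w, W w ->
  \matrix_(a, d) wirt false (rshift n a) (H d) w \in unitmx.
Hypothesis nondeg' : forall w, U' w -> forall v : 'I_m -> C,
  (forall d, \sum_a v a * wirt false (rshift n a) (H' d) w = 0) -> forall a, v a = 0.
Variables (N N' : 'I_m -> 'I_n -> V -> C) (Y Y' : 'I_n -> vfield (R := R) (n := n) (m := m)).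
Hypothesis sN : forall a k, smooth W (N a k).
Hypothesis sN' : forall a k, smooth U' (N' a k).
Hypothesis N'E : forall l d w, U' w ->
  \sum_a N' a l w * wirt false (rshift n a) (H' d) w = wirt false (lshift m l) (H' d) w.
Hypothesis Yl : forall k j w, Y k (lshift m j) w = (j == k)%:R.
Hypothesis Yr : forall k a w, Y k (rshift n a) w = - N a k w.
Hypothesis Y'l : forall k j w, Y' k (lshift m j) w = (j == k)%:R.
Hypothesis Y'r : forall k a w, Y' k (rshift n a) w = - N' a k w.
Hypothesis YH : forall k d w, W w -> vapp false (Y k) (H d) w = 0.

Lemma smooth_H'e d : smooth W (fun w => H' d (e w)).
Proof. exact: (smooth_comp oW oU' eW he (smooth_H' d)). Qed.

Lemma smooth_conjD l p : smooth W (fun w => conjc (dmap l p w)).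
Proof. by apply: smooth_conjc => //; exact: smooth_dmap. Qed.

(** The factor [conjc (Mat a d w)] is antiholomorphic, hence constant for derivatives of type
    (1,0). *)
Lemma wirt_HE l d w : W w -> wirt false l (H d) w =
  \sum_a conjc (Mat a d w) * wirt false l (fun w => H' a (e w)) w.
Proof.
move=> Ww; rewrite (wirt_ext oW false l Ww (fun w' Ww' => HE d Ww')).
rewrite (wirt_sum oW) => [||//]; last first.
  by move=> a _; apply: smoothM => //; [exact: smooth_conjD|exact: smooth_H'e].
apply: eq_bigr => a _.
rewrite (wirtM false l (smooth_conjD _ _) (smooth_H'e a) Ww).
rewrite (wirt_conjc false l (smooth_dmap _ _) Ww) wirt_true_dmap//.
by rewrite [conjc 0]rmorph0 mul0r add0r.
Qed.

Lemma vapp_HE Z d w : W w -> vapp false Z (H d) w =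
  \sum_a conjc (Mat a d w) * vapp false Z (fun w => H' a (e w)) w.
Proof.
move=> Ww; transitivity (\sum_l \sum_a
    conjc (Mat a d w) * (Z l w * wirt false l (fun w => H' a (e w)) w)).
  apply: eq_bigr => l _; rewrite (wirt_HE l d Ww) mulr_sumr.
  by apply: eq_bigr => a _; rewrite mulrCA.
by rewrite exchange_big; apply: eq_bigr => a _; rewrite mulr_sumr.
Qed.

Definition fibre_mx w : 'M[C]_m := \matrix_(a, b) Mat a b w.

Lemma hE w : W w -> \matrix_(a, d) wirt false (rshift n a) (H d) w =
  (fibre_mx w)^T *m (\matrix_(a, d) wirt false (rshift n a) (H' d) (e w)) *m map_mx conjc (fibre_mx w).
Proof.
move=> Ww; apply/matrixP => a d; rewrite !mxE wirt_HE//; apply: eq_bigr => b _.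
rewrite mxE mulrC wirt_e_r ?[map_mx _ _ _ _]mxE; [|exact: smooth_H'|by []].
rewrite [fibre_mx w b d]mxE; congr (_ * _); apply: eq_bigr => x _.
by rewrite !mxE mulrC.
Qed.

(** By [hE] the frame change is a factor of the invertible matrix h, so no inverse change of frame
    has to be composed with it. *)
Lemma unit_fibre_mx w : W w -> fibre_mx w \in unitmx.
Proof.
move=> Ww; have := unit_h Ww; rewrite (hE Ww).
by rewrite unitmx_mul => /andP[+ _]; rewrite unitmx_mul unitmx_tr => /andP[].
Qed.

Lemma conjMx_eq0 w (x : 'I_m -> C) : W w ->
  (forall d, \sum_a conjc (Mat a d w) * x a = 0) -> forall a, x a = 0.
Proof.
move=> Ww x0 a; have uM : map_mx conjc (fibre_mx w) \in unitmx.
  by rewrite (map_unitmx (@conjc R)) unit_fibre_mx.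
have : (\row_a x a) *m map_mx conjc (fibre_mx w) = 0.
  by apply/rowP => d; rewrite !mxE -[RHS](x0 d); apply: eq_bigr => b _; rewrite !mxE mulrC.
move=> /(congr1 (mulmx^~ (invmx (map_mx conjc (fibre_mx w))))); rewrite -mulmxA mulmxV//.
by rewrite mulmx1 mul0mx => /rowP/(_ a); rewrite !mxE.
Qed.

(** The image of delta_k under [e] annihilates every [H' d], because delta_k annihilates [H] and the
    conjugate frame change is invertible. Its base part is [J], and nondegeneracy of h' then forces
    its vertical part. *)
Lemma push_r k a w : W w ->
  \sum_l Y k l w * dmap l (rshift n a) w = - \sum_l J k l w * N' a l (e w).
Proof.
move=> Ww; apply/eqP; rewrite -addr_eq0; apply/eqP; move: a.
apply: (nondeg' (eW Ww)) => d.
have VH a : vapp false (Y k) (fun w => H' a (e w)) w = 0.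
  move: a; apply: (conjMx_eq0 Ww) => d'; rewrite -[RHS](YH k d' Ww).
  by rewrite vapp_HE.
rewrite -[RHS](VH d) (vapp_e false (Y k) (smooth_H' d) Ww) big_split_ord /=.
have -> : \sum_j (\sum_l Y k l w * dmap l (lshift m j) w) * wirt false (lshift m j) (H' d) (e w) =
    \sum_j J k j w * \sum_a N' a j (e w) * wirt false (rshift n a) (H' d) (e w).
  apply: eq_bigr => j _; rewrite N'E//; last exact: eW.
  congr (_ * _); rewrite big_split_ord /= [X in _ + X]big1 ?addr0 => [|b _]; last first.
    by rewrite dmap_rl// mulr0.
  rewrite (bigD1 k)//= big1 ?addr0 => [|i ik]; first by rewrite Yl eqxx mul1r.
  by rewrite Yl (negPf ik) mul0r.
rewrite addrC.
have -> : \sum_j J k j w * \sum_a N' a j (e w) * wirt false (rshift n a) (H' d) (e w) =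
    \sum_a (\sum_j J k j w * N' a j (e w)) * wirt false (rshift n a) (H' d) (e w).
  under eq_bigr => j _ do rewrite mulr_sumr.
  rewrite exchange_big; apply: eq_bigr => a _; rewrite mulr_suml.
  by apply: eq_bigr => j _; rewrite mulrA.
by rewrite -[RHS]big_split; apply: eq_bigr => a _; rewrite mulrDl.
Qed.

Lemma push k p w : W w ->
  \sum_l Y k l w * dmap l p w = \sum_j J k j w * Y' j p (e w).
Proof.
move=> Ww; rewrite -(splitK p); case: (fintype.split p) => [j|a] /=; last first.
  by rewrite push_r// -sumrN; apply: eq_bigr => j _; rewrite Y'r mulrN.
rewrite big_split_ord /= [X in _ + X]big1 ?addr0 => [|b _]; last first.
  by rewrite dmap_rl// mulr0.
rewrite (bigD1 k)//= big1 ?addr0 => [|i ik]; last by rewrite Yl (negPf ik) mul0r.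
rewrite Yl eqxx mul1r (bigD1 j)//= big1 ?addr0 => [|i ij].
  by rewrite Y'l eqxx mulr1.
by rewrite Y'l eq_sym (negPf ij) mulr0.
Qed.

Lemma N_change k a w : W w -> \sum_b Mat a b w * N b k w =
  dmap (lshift m k) (rshift n a) w + \sum_j J k j w * N' a j (e w).
Proof.
move=> Ww; have := push_r k a Ww; rewrite big_split_ord /= (bigD1 k)//= big1 ?addr0; last first.
  by move=> i ik; rewrite Yl (negPf ik) mul0r.
rewrite Yl eqxx mul1r (eq_bigr (fun b => - (Mat a b w * N b k w))); last first.
  by move=> b _; rewrite Yr mulNr mulrC.
rewrite sumrN => /eqP; rewrite subr_eq => /eqP ->.
by rewrite addrAC addNr add0r.
Qed.

Lemma L_change k a d w : W w -> \sum_b Mat a b w * wirt false (rshift n d) (N b k) w =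
  wirt false (lshift m k) (Mat a d) w +
  \sum_j J k j w * \sum_c wirt false (rshift n c) (N' a j) (e w) * Mat c d w.
Proof.
move=> Ww; have sN'e j : smooth W (fun w => N' a j (e w)).
  exact: (smooth_comp oW oU' eW he (sN' a j)).
have sD l p : smooth W (dmap l p) by exact: smooth_dmap.
transitivity (wirt false (rshift n d) (fun w => \sum_b Mat a b w * N b k w) w).
  rewrite (wirt_sum oW) => [||//]; last by move=> b _; apply: smoothM; rewrite // /Mat.
  apply: eq_bigr => b _; rewrite (wirtM false (rshift n d) (sD _ _) (sN b k) Ww).
  by rewrite dmap_rrr// mul0r add0r.
rewrite (wirt_ext oW false (rshift n d) Ww (fun w' Ww' => N_change k a Ww')).
have sS j : smooth W (fun w => J k j w * N' a j (e w)) by exact: (smoothM oW (sD _ _) (sN'e j)).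
rewrite (wirtD false (rshift n d) (sD _ _) (smooth_sum oW _ (fun j _ => sS j)) Ww).
have [se _] := he (rshift n a).
rewrite {1}/dmap (wirt_comm oW _ _ _ _ se Ww); congr (_ + _).
rewrite (wirt_sum oW) => [||//]; last by move=> j _; exact: sS.
apply: eq_bigr => j _; rewrite (wirtM false (rshift n d) (sD _ _) (sN'e j) Ww).
by rewrite wirt_r_J// mul0r add0r (wirt_e_r false d (sN' a j) Ww).
Qed.

Let L a b k := wirt false (rshift n b) (N a k).
Let L' a b k := wirt false (rshift n b) (N' a k).

(** The inhomogeneous term d_k [Mat] in the law for L is holomorphic. It is killed by the conjugate
    fields, so the curvature is tensorial although L is not. *)
Lemma curvature_change k j a d w : W w ->
  \sum_b Mat a b w * vapp true (Y j) (L b d k) w =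
  \sum_l \sum_i J k l w * conjc (J j i w) *
    \sum_c vapp true (Y' i) (L' a c l) (e w) * Mat c d w.
Proof.
move=> Ww; have sD l p : smooth W (dmap l p) by exact: smooth_dmap.
have sL b : smooth W (L b d k) by exact: smooth_wirt.
have sL' c l : smooth U' (L' a c l) by exact: smooth_wirt.
have sL'e c l : smooth W (fun w => L' a c l (e w)) by exact: (smooth_comp oW oU' eW he).
transitivity (vapp true (Y j) (fun w => \sum_b Mat a b w * L b d k w) w).
  rewrite (vapp_sum oW) => [||//]; last by move=> b _; apply: smoothM; rewrite // /Mat.
  apply: eq_bigr => b _; rewrite (vappM _ _ (sD _ _) (sL b) Ww).
  by rewrite vapp_true_dmap// mul0r add0r.
rewrite (vapp_ext oW true (Y j) Ww (fun w' Ww' => L_change k a d Ww')).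
have sLM l c : smooth W (fun w => L' a c l (e w) * Mat c d w).
  exact: (smoothM oW (sL'e c l) (sD _ _)).
have sS l : smooth W (fun w => J k l w * \sum_c L' a c l (e w) * Mat c d w).
  exact: (smoothM oW (sD _ _) (smooth_sum oW _ (fun c _ => sLM l c))).
rewrite (vappD _ _ (smooth_wirt oW _ _ (sD _ _)) (smooth_sum oW _ (fun l _ => sS l)) Ww).
have -> : vapp true (Y j) (wirt false (lshift m k) (Mat a d)) w = 0.
  rewrite /vapp big1 // => l _; rewrite (wirt_comm oW _ _ _ _ (sD _ _) Ww).
  rewrite (wirt_ext oW false (lshift m k) (g := fun=> 0) Ww) ?wirt_cst ?mulr0// => w' Ww'.
  exact: wirt_true_dmap.
rewrite add0r (vapp_sum oW) => [||//]; last by move=> l _; exact: sS.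
apply: eq_bigr => l _.
rewrite (vappM _ _ (sD _ _) (smooth_sum oW _ (fun c _ => sLM l c)) Ww).
rewrite vapp_true_dmap// mul0r add0r (vapp_sum oW) => [||//]; last by move=> c _; exact: sLM.
under [RHS]eq_bigr => i _ do rewrite -mulrA.
rewrite -[RHS]mulr_sumr; congr (_ * _).
under [RHS]eq_bigr => i _ do rewrite mulr_sumr.
rewrite [RHS]exchange_big; apply: eq_bigr => c _.
rewrite (vappM _ _ (sL'e c l) (sD _ _) Ww) vapp_true_dmap// mulr0 addr0.
rewrite (vapp_push true (J := fun i => J j i w) (sL' c l) Ww (fun p => push j p Ww)).
by rewrite mulr_suml; apply: eq_bigr => i _; rewrite mulrA.
Qed.

End Connection.
End AbstractChange.

(** * Coordinate changes of the bundle *)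

Section Overlap.
Context {R : realType} {n : nat} {M : topologicalType}.
Context {X : complex_manifold R n M} {m : nat} {E : M -> lmodType R[i]}.
Context {B : holomorphic_bundle X m E}.
Local Notation C := R[i].
Local Notation coords := 'rV[C]_(n + m).
Variables (c c' : echart B).
Implicit Types (w : coords).

Local Notation W := (overlap c c').
Local Notation U' := (edom c').
Local Notation e := (echange c c').

Lemma base_echange w : W w -> base_pt c' (e w) = base_pt c w.
Proof.
move=> /overlapP[ew c'x _].
by rewrite /base_pt /echange row_mxKl crdK.
Qed.

Lemma frame_change x (eta : 'rV[C]_m) : fdom c.2 x -> fdom c'.2 x ->
  \sum_a eta 0 a *: frame c.2 x a =
  \sum_a (eta *m (Defs.ftrans c.2 c'.2 x)^T) 0 a *: frame c'.2 x a.
Proof.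
move=> fx f'x.
transitivity (\sum_b \sum_a (eta 0 b * Defs.ftrans c.2 c'.2 x a b) *: frame c'.2 x a).
  apply: eq_bigr => b _; rewrite (Defs.ftransE fx f'x) scaler_sumr.
  by apply: eq_bigr => a _; rewrite scalerA.
rewrite exchange_big; apply: eq_bigr => a _; rewrite mxE scaler_suml.
by apply: eq_bigr => b _; rewrite mxE.
Qed.

Lemma echange_edom w : W w -> U' (e w).
Proof.
move=> Ww; have /overlapP[ew c'x f'x] := Ww; have [cx fx xw] := edom_base ew.
rewrite /edom /= /echange row_mxKl row_mxKr; split.
  by exists (base_pt c w).
move=> eta0; have [_ /(_ _)] := ew; apply.
have := frame_change (rsubmx w) fx f'x; rewrite eta0 => E0.
(* If the new fibre coordinates vanished, the vector would be zero, and uniqueness of components in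
   the old frame would give eta = 0. *)
have [eta [_ uniq]] := frame_basis fx (\sum_a rsubmx w 0 a *: frame c.2 (base_pt c w) a).
rewrite -(uniq _ erefl); apply: uniq; rewrite E0.
by rewrite !big1 // => a _; rewrite mxE scale0r.
Qed.

Lemma Fsq_echange (F : forall x : M, E x -> R) w : W w -> Fsq F c w = Fsq F c' (e w).
Proof.
move=> Ww; have /overlapP[ew c'x f'x] := Ww; have [cx fx xw] := edom_base ew.
pose Q (al : fidx B) x (eta : 'rV[C]_m) : C := (F x (\sum_a eta 0 a *: frame al x a) ^+ 2)%:C.
have QE c1 w1 : Fsq F c1 w1 = Q c1.2 (base_pt c1 w1) (rsubmx w1) by exact: FsqE.
rewrite (QE c) (QE c') base_echange// /echange row_mxKr /Q.
by rewrite (frame_change _ fx f'x).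
Qed.

Let oW : openCN W. Proof. exact: overlap_open. Qed.

Let zfun l (z : 'rV[C]_n) : C := crd c'.1 (cpt c.1 z) 0 l.
Let Mfun a b (z : 'rV[C]_n) : C := Defs.ftrans c.2 c'.2 (cpt c.1 z) a b.

Lemma echange_l l : (fun w => e w 0 (lshift m l)) = fun w => zfun l (lsubmx w).
Proof. by apply/funext => w; rewrite /echange row_mxEl. Qed.

Lemma echange_r a : (fun w => e w 0 (rshift n a)) =
  fun w => \sum_b w 0 (rshift n b) * Mfun a b (lsubmx w).
Proof.
apply/funext => w; rewrite /echange row_mxEr mxE; apply: eq_bigr => b _.
by rewrite !mxE.
Qed.

Lemma holomorphic_lsub (O : set 'rV[C]_n) (f : 'rV[C]_n -> C) : openCN O ->
  W `<=` base_preimage (m := m) O -> holomorphic O f ->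
  holomorphic W (fun w => f (lsubmx w)).
Proof.
move=> oO WO [sf hf]; split; first by apply: smoothS WO _; exact: smooth_lsub.
move=> w l Ww; rewrite -(splitK l); case: (fintype.split l) => [k|a] /=.
  exact: (etrans (wirt_lsub_l true k f w) (hf _ _ (WO _ Ww))).
exact: (wirt_lsub_r true a f w).
Qed.

Lemma holomorphic_zfun l : holomorphic W (fun w => zfun l (lsubmx w)).
Proof.
apply: holomorphic_lsub (crd_holomorphic c.1 c'.1 l).
  by apply: crd_img_open; exact: cdom_open.
by move=> w [_ [x [cx [c'x _]] xw]]; exists x.
Qed.

Lemma holomorphic_Mfun a b : holomorphic W (fun w => Mfun a b (lsubmx w)).
Proof.
apply: holomorphic_lsub (ftrans_holomorphic c.1 c.2 c'.2 a b).
  rewrite -setIA; apply: crd_img_open; apply: openI; exact: fdom_open.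
move=> w Ww; have /overlapP[ew c'x f'x] := Ww; have [cx fx xw] := edom_base ew.
by exists (base_pt c w).
Qed.

Lemma wirt_e_r_sum b l a w : W w -> wirt b l (fun w => e w 0 (rshift n a)) w =
  \sum_d ((~~ b && (l == rshift n d))%:R * Mfun a d (lsubmx w) +
    w 0 (rshift n d) * wirt b l (fun w => Mfun a d (lsubmx w)) w).
Proof.
move=> Ww; have sM d : smooth W (fun w => Mfun a d (lsubmx w)) by have [] := holomorphic_Mfun a d.
have sc d : smooth W (fun w : coords => w 0 (rshift n d)) by exact: smooth_coord.
rewrite echange_r (wirt_sum oW) => [||//]; last by move=> d _; exact: (smoothM oW (sc d) (sM d)).
by apply: eq_bigr => d _; rewrite (wirtM b l (sc d) (sM d) Ww) wirt_coord.
Qed.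

Lemma holomorphic_echange p : holomorphic W (fun w => e w 0 p).
Proof.
rewrite -(splitK p); case: (fintype.split p) => [l|a] /=.
  by rewrite echange_l; exact: holomorphic_zfun.
split=> [|w l Ww].
  rewrite echange_r; apply: smooth_sum => // b _; apply: smoothM => //.
    exact: smooth_coord.
  by have [] := holomorphic_Mfun a b.
apply: (etrans (wirt_e_r_sum true l a Ww)); rewrite big1 // => d _ /=.
have [_ hM] := holomorphic_Mfun a d.
by rewrite hM// mul0r mulr0 addr0.
Qed.

Lemma dmap_echange_rl b l w : W w -> dmap e (rshift n b) (lshift m l) w = 0.
Proof. by move=> Ww; rewrite /dmap echange_l wirt_lsub_r. Qed.

Lemma dmap_echange_rr b a w : W w -> dmap e (rshift n b) (rshift n a) w = Mfun a b (lsubmx w).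
Proof.
move=> Ww; rewrite /dmap wirt_e_r_sum// (bigD1 b)//= eqxx mul1r.
have Mv d : dC (rshift n b) (fun w => Mfun a d (lsubmx w)) w = 0.
  exact: (wirt_lsub_r false b (Mfun a d) w).
rewrite Mv mulr0 addr0 big1 ?addr0// => d db.
by rewrite Mv mulr0 addr0 eq_rshift eq_sym (negPf db) mul0r.
Qed.

Lemma dmap_echange_rrr b d a w : W w ->
  wirt false (rshift n d) (dmap e (rshift n b) (rshift n a)) w = 0.
Proof.
move=> Ww; rewrite (wirt_ext oW false (rshift n d) Ww (dmap_echange_rr b a)).
exact: wirt_lsub_r.
Qed.

Lemma jacE k l w : jac c c' k l w = dmap e (lshift m k) (lshift m l) w.
Proof.
by rewrite /dmap echange_l; exact: (esym (wirt_lsub_l false k (zfun l) w)).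
Qed.

Lemma delta_lE (F : forall x : M, E x -> R) (c1 : echart B) k j w :
  delta_field F c1 k (lshift m j) w = (j == k)%:R.
Proof. by rewrite delta_l. Qed.

Lemma delta_rE (F : forall x : M, E x -> R) (c1 : echart B) k a w :
  delta_field F c1 k (rshift n a) w = - Ncoef F c1 a k w.
Proof. by rewrite delta_r. Qed.

Section Curvature.
Variable F : forall x : M, E x -> R.
Hypothesis hF : complex_finsler B F.

Lemma W_edom w : W w -> edom c w. Proof. by case. Qed.

Let dbarFsqE d w (Ww : W w) := wirt_true_r_e oW (edom_open (c := c')) echange_edom
  holomorphic_echange dmap_echange_rl d (smooth_Fsq hF c') (Fsq_echange F) Ww.

Let unit_h w : W w ->
  \matrix_(a, d) wirt false (rshift n a) (dbarFsq F c d) w \in unitmx.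
Proof.
move=> Ww; have := hmx_unit hF (W_edom Ww).
by congr (_ \in _); apply/matrixP => a d; rewrite [RHS]mxE hmxE.
Qed.

Lemma echange_unit w : W w -> fibre_mx e w \in unitmx.
Proof.
move=> Ww; exact: (unit_fibre_mx oW (edom_open (c := c')) echange_edom
  holomorphic_echange dmap_echange_rl (smooth_dbarFsq hF c') dbarFsqE unit_h Ww).
Qed.

Lemma Omega_echange k j a d w : W w ->
  \sum_b dmap e (rshift n b) (rshift n a) w * Omega F c b d k j w =
  \sum_l \sum_i jac c c' k l w * conjc (jac c c' j i w) *
    \sum_b Omega F c' a b l i (e w) * dmap e (rshift n d) (rshift n b) w.
Proof.
move=> Ww.
have OE (c1 : echart B) b1 d1 k1 j1 w1 : edom c1 w1 -> Omega F c1 b1 d1 k1 j1 w1 =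
    - vapp true (delta_field F c1 j1) (wirt false (rshift n d1) (Ncoef F c1 b1 k1)) w1.
  move=> Uw1; apply: (congr1 (@GRing.opp C)).
  exact: (vapp_ext (edom_open (c := c1)) true (delta_field F c1 j1) Uw1
    (fun w2 Uw2 => LcoefE hF b1 d1 k1 Uw2)).
have oU' := edom_open (c := c').
have K := curvature_change oW oU' echange_edom holomorphic_echange dmap_echange_rl
  dmap_echange_rrr (smooth_dbarFsq hF c') dbarFsqE unit_h
  (fun w1 Uw1 v => @hmx_eq0_wirt _ _ _ _ _ _ _ _ hF c' w1 v Uw1)
  (fun a1 k1 => smoothS (fun w1 Ww1 => W_edom Ww1) (smooth_Ncoef hF c a1 k1))
  (smooth_Ncoef hF c') (fun l1 d1 w1 Uw1 => Ncoef_spec_wirt hF l1 d1 Uw1)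
  (@delta_lE F c) (@delta_rE F c) (@delta_lE F c') (@delta_rE F c')
  (fun k1 d1 w1 Ww1 => delta_dbarFsq hF k1 d1 (W_edom Ww1)) k j a d Ww.
transitivity (- \sum_b dmap e (rshift n b) (rshift n a) w *
    vapp true (delta_field F c j) (wirt false (rshift n d) (Ncoef F c b k)) w).
  rewrite -sumrN; apply: eq_bigr => b _; rewrite -mulrN.
  by apply: (congr1 (GRing.mul _)); exact: OE (W_edom Ww).
apply: (etrans (congr1 (@GRing.opp C) K)).
rewrite -sumrN; apply: eq_bigr => l _; rewrite -sumrN; apply: eq_bigr => i _.
rewrite !jacE -mulrN; apply: (congr1 (GRing.mul _)).
rewrite -sumrN; apply: eq_bigr => b _; rewrite -mulNr.
by apply: (congr1 (fun x => x * _)); exact: esym (OE c' _ _ _ _ _ (echange_edom Ww)).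
Qed.

End Curvature.

(** The factor e^sigma is one function on M, read in two charts. Its vertical derivatives vanish, so
    the chain rule involves only the base block of the Jacobian. *)
Lemma conf_form_echange (F Ft : forall x : M, E x -> R) (sigma : M -> R) k w :
  complex_finsler B F -> complex_finsler B Ft ->
  (forall x (v : E x), Ft x v ^+ 2 = expR (sigma x) * F x v ^+ 2) -> W w ->
  conf_form sigma c k w = \sum_l jac c c' k l w * conf_form sigma c' l (e w).
Proof.
move=> hF hFt hFtE Ww; have SE w' : W w' -> conf_factor sigma c w' = conf_factor sigma c' (e w').
  by move=> Ww'; rewrite /conf_factor base_echange.
rewrite /conf_form (wirt_ext oW false (lshift m k) Ww SE) (SE w Ww).
have sS := smooth_conf_factor hF hFt hFtE c'.
rewrite (wirt_e (edom_open (c := c')) echange_edom holomorphic_echange false _ sS Ww).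
have v0 : \sum_a wirt false (rshift n a) (conf_factor sigma c') (e w) *
    dmap e (lshift m k) (rshift n a) w = 0.
  by rewrite big1 // => a _; rewrite wirt_conf_factor mul0r.
rewrite big_split_ord [X in (X / _) = _](congr1 (GRing.add _) v0) addr0 mulr_suml.
apply: eq_bigr => l _; rewrite jacE [in RHS]mulrA.
by apply: (congr1 (fun x => x / _)); rewrite [RHS]mulrC.
Qed.

End Overlap.

(** * Polarized determinants and alternating forms *)

Section Polarized.
Context {K : comUnitRingType} {m : nat}.

Lemma prod_eq_ffun (j : nat) (f g : {ffun 'I_j -> 'I_m}) :
  \prod_r (f r == g r)%:R = (f == g)%:R :> K.
Proof.
have [->|fg] := eqVneq f g; first by rewrite big1 // => r _; rewrite eqxx.
have [r fgr] : exists r, f r != g r.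
  by apply/existsP; apply: contraT; rewrite negb_exists => /forallP H;
    case/eqP: fg; apply/ffunP => r; have /negPn/eqP := H r.
by rewrite (bigD1 r)//= (negPf fgr) mul0r.
Qed.

(* Polarization of a determinant coefficient: for constant A, [polar_det A] is j!
   times the sum of the principal minors of size j. *)
Definition polar_det (j : nat) (A : 'I_j -> 'M[K]_m) : K :=
  \sum_(s : 'S_j) (-1) ^+ s * \sum_(a : {ffun 'I_j -> 'I_m}) \prod_r A r (a r) (a (s r)).

Lemma eq_polar_det j (A A' : 'I_j -> 'M[K]_m) :
  (forall r, A r = A' r) -> polar_det A = polar_det A'.
Proof.
move=> AA'; apply: eq_bigr => s _; congr (_ * _); apply: eq_bigr => a _.
by apply: eq_bigr => r _; rewrite AA'.
Qed.

(** For each permutation the sum over [a] is a product of traces of products along cycles, so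
    conjugation cancels between neighbouring factors. *)
Lemma polar_det_conj j (g : 'M[K]_m) (A A' : 'I_j -> 'M[K]_m) : g \in unitmx ->
  (forall r, g *m A r = A' r *m g) -> polar_det A = polar_det A'.
Proof.
move=> ug gA; apply: eq_bigr => s _; congr (_ * _).
have AE r x y : A r x y = \sum_u \sum_v invmx g x u * A' r u v * g v y.
  have -> : A r = invmx g *m A' r *m g by rewrite -mulmxA -gA mulKmx.
  rewrite mxE exchange_big; apply: eq_bigr => v _; rewrite mxE mulr_suml.
  by [].
transitivity (\sum_(a : {ffun 'I_j -> 'I_m}) \sum_(u : {ffun 'I_j -> 'I_m})
    \sum_(v : {ffun 'I_j -> 'I_m}) \prod_r A' r (u r) (v r) *
    \prod_r (invmx g (a r) (u r) * g (v (s^-1%g r)) (a r))).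
  apply: eq_bigr => a _.
  transitivity (\sum_(u : {ffun 'I_j -> 'I_m}) \sum_(v : {ffun 'I_j -> 'I_m})
     \prod_r (invmx g (a r) (u r) * A' r (u r) (v r) * g (v r) (a (s r)))).
    rewrite (eq_bigr (fun r => \sum_u \sum_v invmx g (a r) u * A' r u v * g v (a (s r)))).
      rewrite bigA_distr_bigA; apply: eq_bigr => u _.
      by rewrite bigA_distr_bigA.
    by move=> r _; rewrite AE.
  apply: eq_bigr => u _; apply: eq_bigr => v _; rewrite !big_split /=.
  (* Reindexing by [s] pairs the entry of [g] with column [a r] and the entry of [invmx g] with row
     [a r]; the sum over [a] then contracts them to an identity matrix. *)
  have -> : \prod_i g (v i) (a (s i)) = \prod_i g (v (s^-1%g i)) (a i).
    rewrite [RHS](reindex_inj (@perm_inj _ s)); apply: eq_bigr => i _.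
    by rewrite permK.
  by rewrite mulrAC mulrC.
have key (u v : {ffun 'I_j -> 'I_m}) : \sum_(a : {ffun 'I_j -> 'I_m})
    \prod_r (invmx g (a r) (u r) * g (v (s^-1%g r)) (a r)) =
    ([ffun r => v (s^-1%g r)] == u)%:R.
  rewrite -(bigA_distr_bigA (fun r x => invmx g x (u r) * g (v (s^-1%g r)) x)).
  rewrite -prod_eq_ffun; apply: eq_bigr => r _; rewrite ffunE.
  have := congr1 (fun B : 'M_m => B (v (s^-1%g r)) (u r)) (mulmxV ug).
  by rewrite !mxE => <-; apply: eq_bigr => x _; rewrite mulrC.
rewrite exchange_big; apply: eq_bigr => u _; rewrite exchange_big.
transitivity (\sum_(v : {ffun 'I_j -> 'I_m})
    \prod_r A' r (u r) (v r) * ([ffun r => v (s^-1%g r)] == u)%:R).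
  by apply: eq_bigr => v _; rewrite -mulr_sumr key.
rewrite (bigD1 [ffun r => u (s r)])//= [X in _ + X]big1 ?addr0 => [|v vu].
  rewrite (_ : _ == u) ?mulr1; last by apply/eqP/ffunP => r; rewrite !ffunE permKV.
  by apply: eq_bigr => r _; rewrite ffunE.
case: eqVneq => [E|]; last by rewrite mulr0.
by case/eqP: vu; apply/ffunP => r; rewrite ffunE -E ffunE permK.
Qed.

(** By the Leibniz formula the generalized Kronecker symbol is the signed sum over [s] of the
    indicator of [b = a o s], which leaves only rearrangements of [a]. *)
Lemma gen_kroneckerE (j : nat) (F : {ffun 'I_j -> 'I_m} -> {ffun 'I_j -> 'I_m} -> K) :
  \sum_(a : {ffun 'I_j -> 'I_m}) \sum_(b : {ffun 'I_j -> 'I_m})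
    \det (\matrix_(r < j, s < j) (b r == a s)%:R) * F a b =
  \sum_(s : 'S_j) (-1) ^+ s * \sum_(a : {ffun 'I_j -> 'I_m}) F a [ffun r => a (s r)].
Proof.
under [RHS]eq_bigr => s _ do rewrite mulr_sumr.
rewrite [RHS]exchange_big; apply: eq_bigr => a _; rewrite /determinant.
transitivity (\sum_(b : {ffun 'I_j -> 'I_m}) \sum_(s : 'S_j)
    (-1) ^+ s * ((b == [ffun r => a (s r)])%:R * F a b)).
  apply: eq_bigr => b _; rewrite mulr_suml; apply: eq_bigr => s _.
  rewrite -mulrA -prod_eq_ffun; congr (_ * (_ * _)).
  by apply: eq_bigr => r _; rewrite mxE ffunE.
rewrite exchange_big; apply: eq_bigr => s _; rewrite -mulr_sumr; congr (_ * _).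
rewrite (bigD1 [ffun r => a (s r)])//= eqxx mul1r big1 ?addr0// => b ba.
by rewrite (negPf ba) mul0r.
Qed.

Lemma polar_det_multilinear j (I : finType) (a : 'I_j -> I -> K)
    (T : 'I_j -> I -> 'M[K]_m) :
  polar_det (fun r => \sum_l a r l *: T r l) =
  \sum_(f : {ffun 'I_j -> I}) (\prod_r a r (f r)) * polar_det (fun r => T r (f r)).
Proof.
rewrite /polar_det; under [RHS]eq_bigr => f _ do rewrite mulr_sumr.
rewrite [RHS]exchange_big; apply: eq_bigr => s _.
under [RHS]eq_bigr => f _ do rewrite mulrCA.
rewrite -[RHS]mulr_sumr; congr (_ * _).
under [RHS]eq_bigr => f _ do rewrite mulr_sumr.
rewrite [RHS]exchange_big; apply: eq_bigr => x _.
transitivity (\prod_r \sum_l a r l * T r l (x r) (x (s r))).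
  by apply: eq_bigr => r _; rewrite summxE; apply: eq_bigr => l _; rewrite mxE.
by rewrite bigA_distr_bigA; apply: eq_bigr => f _; rewrite big_split.
Qed.

(** The slot [r0] stays out of the expansion: it will hold alpha I, which has no antiholomorphic
    index to transform. *)
Lemma polar_det_multilinear_but q (r0 : 'I_q.+1) (I : finType) (a : 'I_q -> I -> K)
    (T : 'I_q -> I -> 'M[K]_m) (Z : 'M[K]_m) :
  polar_det (fun r => if unlift r0 r is Some r' then \sum_l a r' l *: T r' l else Z) =
  \sum_(f : {ffun 'I_q -> I}) (\prod_r a r (f r)) *
    polar_det (fun r => if unlift r0 r is Some r' then T r' (f r') else Z).
Proof.
rewrite /polar_det; under [RHS]eq_bigr => f _ do rewrite mulr_sumr.
rewrite [RHS]exchange_big; apply: eq_bigr => s _.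
under [RHS]eq_bigr => f _ do rewrite mulrCA.
rewrite -[RHS]mulr_sumr; congr (_ * _).
under [RHS]eq_bigr => f _ do rewrite mulr_sumr.
rewrite [RHS]exchange_big; apply: eq_bigr => x _.
transitivity (Z (x r0) (x (s r0)) *
   \prod_r \sum_l a r l * T r l (x (lift r0 r)) (x (s (lift r0 r)))).
  rewrite (bigD1_ord r0)//= unlift_none; congr (_ * _).
  apply: eq_bigr => r _; rewrite liftK summxE.
  by apply: eq_bigr => l _; rewrite mxE.
rewrite bigA_distr_bigA mulr_sumr; apply: eq_bigr => f _.
rewrite big_split mulrCA; congr (_ * _).
rewrite (bigD1_ord r0)//= unlift_none; congr (_ * _).
by apply: eq_bigr => r _; rewrite liftK.
Qed.

Lemma polar_detD j (r0 : 'I_j) (A A1 A2 : 'I_j -> 'M[K]_m) :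
  A r0 = A1 r0 + A2 r0 -> (forall r, r != r0 -> A1 r = A r) ->
  (forall r, r != r0 -> A2 r = A r) -> polar_det A = polar_det A1 + polar_det A2.
Proof.
move=> E0 E1 E2; rewrite /polar_det -big_split /=; apply: eq_bigr => s _.
rewrite -mulrDr; congr (_ * _); rewrite -big_split /=; apply: eq_bigr => x _ /=.
rewrite (bigD1 r0)//= [in RHS](bigD1 r0)//= [X in _ = _ + X](bigD1 r0)//= E0 mxE mulrDl.
by congr (_ * _ + _ * _); apply: eq_bigr => r rr0; rewrite ?E1 ?E2.
Qed.

End Polarized.

Lemma sgn_permM (K : pzRingType) j (s t : 'S_j) :
  (-1) ^+ (s * t)%g = (-1) ^+ s * (-1) ^+ t :> K.
Proof. by rewrite odd_permM; exact: signr_addb. Qed.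

Lemma sgn_perm_sqr (K : pzRingType) j (s : 'S_j) : (-1) ^+ s * (-1) ^+ s = 1 :> K.
Proof. by rewrite -expr2 sqrr_sign. Qed.

(** * Signed sums over permutations *)

Section PermSums.
Context {K : numFieldType}.

(** A permutation of [q + 1] places amounts to the image [k] of [i] and a permutation of the others.
    Injectivity and the count (q+1)! = (q+1) q! give the bijection. *)
Lemma sum_lift_perm (V : nmodType) q (i : 'I_q.+1) (F : 'S_q.+1 -> V) :
  \sum_t F t = \sum_k \sum_(s : 'S_q) F (lift_perm i k s).
Proof.
rewrite pair_bigA /=; apply: (reindex (fun p => lift_perm i p.1 p.2)).
apply: onW_bij; apply: inj_card_bij.
  move=> [k s] [k' s'] /= E; have kk' : k = k'.
    by have := congr1 (fun u : 'S_q.+1 => u i) E; rewrite !lift_perm_id.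
  rewrite -kk' in E *; congr (_, _); apply/permP => r; apply: (@lift_inj _ k).
  by have := congr1 (fun u : 'S_q.+1 => u (lift i r)) E; rewrite !lift_perm_lift.
by rewrite card_prod card_ord !card_Sn factS.
Qed.

(** The way closedness acts: a coefficient symmetric in two antisymmetrized indices contributes a
    sum equal to its own opposite. *)
Lemma alternating_sum_eq0 (j : nat) (x y : 'I_j) (F : 'S_j -> K) : x != y ->
  (forall t, F (tperm x y * t)%g = F t) -> \sum_(t : 'S_j) (-1) ^+ t * F t = 0.
Proof.
move=> xy H; set S := \sum_t _.
have : S = - S.
  rewrite {1}/S (reindex_inj (mulgI (tperm x y))) -sumrN; apply: eq_bigr => t _.
  by rewrite H odd_mul_tperm xy signr_addb mulN1r mulNr.
by move=> /eqP; rewrite -subr_eq0 opprK -mulr2n mulrn_eq0 /= => /eqP.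
Qed.

End PermSums.

(** * Horizontal forms as alternated tensors *)

Section Forms.
Context {R : realType} {n : nat} {M : topologicalType}.
Context {X : complex_manifold R n M} {m : nat} {E : M -> lmodType R[i]}.
Context {B : holomorphic_bundle X m E}.
Local Notation C := R[i].
Local Notation coords := 'rV[C]_(n + m).
Implicit Types (c : echart B) (w : coords).

(** Coefficients of [tau_{IJ} dz^I /\ dzbar^J]. There is no factor 1/(p! q!), since the convention
    of [hcoef] already contains it. *)
Definition alt_form p q (tau : hcoef B p q) : hcoef B p q :=
  fun c I J w => \sum_(s : 'S_p) \sum_(t : 'S_q)
    (-1) ^+ s * (-1) ^+ t * tau c [ffun r => I (s r)] [ffun r => J (t r)] w.

Definition tensorial p q (tau : hcoef B p q) : Prop :=
  (forall c I J, smooth (edom c) (tau c I J)) /\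
  forall c c' w, overlap c c' w -> forall I J, tau c I J w =
    \sum_(K : {ffun 'I_p -> 'I_n}) \sum_(L : {ffun 'I_q -> 'I_n})
      (\prod_r jac c c' (I r) (K r) w) * (\prod_r conjc (jac c c' (J r) (L r) w)) *
      tau c' K L (echange c c' w).

Lemma hform_smooth p q (phi : hcoef B p q) c I J : hform phi -> smooth (edom c) (phi c I J).
Proof. by case. Qed.

Lemma ffun_perm_bij p (s : 'S_p) :
  bijective (fun K : {ffun 'I_p -> 'I_n} => [ffun r => K (s r)]).
Proof.
exists (fun K : {ffun 'I_p -> 'I_n} => [ffun r => K (s^-1%g r)]) => K;
  by apply/ffunP => r; rewrite !ffunE ?permK ?permKV.
Qed.

Lemma prod_ffun_perm p (f : 'I_n -> 'I_n -> C) (I K : {ffun 'I_p -> 'I_n}) (s : 'S_p) :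
  \prod_r f ([ffun r => I (s r)] r) ([ffun r => K (s r)] r) = \prod_r f (I r) (K r).
Proof.
rewrite [RHS](reindex_inj (@perm_inj _ s)); apply: eq_bigr => r _.
by rewrite !ffunE.
Qed.

(** The Jacobian products do not change when both index families are permuted together, so
    alternation commutes with a change of coordinates. *)
Lemma alternation_change p q (a b : 'I_n -> 'I_n -> C)
    (T T' : {ffun 'I_p -> 'I_n} -> {ffun 'I_q -> 'I_n} -> C) :
  (forall I J, T I J = \sum_(K : {ffun 'I_p -> 'I_n}) \sum_(L : {ffun 'I_q -> 'I_n})
      (\prod_r a (I r) (K r)) * (\prod_r b (J r) (L r)) * T' K L) ->
  forall (I : {ffun 'I_p -> 'I_n}) (J : {ffun 'I_q -> 'I_n}),
    \sum_(s : 'S_p) \sum_(t : 'S_q)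
      (-1) ^+ s * (-1) ^+ t * T [ffun r => I (s r)] [ffun r => J (t r)] =
    \sum_(K : {ffun 'I_p -> 'I_n}) \sum_(L : {ffun 'I_q -> 'I_n})
      (\prod_r a (I r) (K r)) * (\prod_r b (J r) (L r)) *
      \sum_(s : 'S_p) \sum_(t : 'S_q)
        (-1) ^+ s * (-1) ^+ t * T' [ffun r => K (s r)] [ffun r => L (t r)].
Proof.
move=> TE I J.
transitivity (\sum_(s : 'S_p) \sum_(t : 'S_q) \sum_(K : {ffun 'I_p -> 'I_n})
  \sum_(L : {ffun 'I_q -> 'I_n}) (-1) ^+ s * (-1) ^+ t *
    ((\prod_r a (I r) (K r)) * (\prod_r b (J r) (L r)) *
    T' [ffun r => K (s r)] [ffun r => L (t r)])).
  apply: eq_bigr => s _; apply: eq_bigr => t _; rewrite TE mulr_sumr.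
  rewrite (reindex _ (onW_bij _ (ffun_perm_bij s))); apply: eq_bigr => K _.
  rewrite mulr_sumr (reindex _ (onW_bij _ (ffun_perm_bij t))); apply: eq_bigr => L _.
  by rewrite (prod_ffun_perm a) (prod_ffun_perm b).
under eq_bigr => s _ do rewrite exchange_big.
rewrite exchange_big; apply: eq_bigr => K _.
under eq_bigr => s _ do rewrite exchange_big.
rewrite exchange_big; apply: eq_bigr => L _.
rewrite mulr_sumr; apply: eq_bigr => s _; rewrite mulr_sumr; apply: eq_bigr => t _.
by rewrite mulrCA.
Qed.

Lemma hform_alt p q (tau : hcoef B p q) : tensorial tau -> hform (alt_form tau).
Proof.
move=> [stau ptau]; split.
- move=> c I J; apply: smooth_sum; first exact: edom_open.
  move=> s _; apply: smooth_sum; first exact: edom_open.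
  move=> t _; apply: smoothM; first exact: edom_open.
    by apply: smooth_cst; exact: edom_open.
  exact: stau.
- move=> c w _ I J s t; rewrite /alt_form.
  rewrite mulr_sumr [RHS](reindex_inj (mulIg s)); apply: eq_bigr => s' _.
  rewrite mulr_sumr [RHS](reindex_inj (mulIg t)); apply: eq_bigr => t' _.
  rewrite !sgn_permM.
  have -> : [ffun r => [ffun r => I (s r)] (s' r)] = [ffun r => I ((s' * s)%g r)].
    by apply/ffunP => r; rewrite !ffunE permM.
  have -> : [ffun r => [ffun r => J (t r)] (t' r)] = [ffun r => J ((t' * t)%g r)].
    by apply/ffunP => r; rewrite !ffunE permM.
  rewrite mulrA; congr (_ * _).
  have := sgn_perm_sqr C s; have := sgn_perm_sqr C t.
  move: ((-1) ^+ s) ((-1) ^+ t) ((-1) ^+ s') ((-1) ^+ t') => x y z u yy xx.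
  by transitivity (x * x * (y * y) * (z * u)); [rewrite xx yy !mul1r|ring].
- move=> c c' w Uw c'x f'x; have Ww : overlap c c' w by apply/overlapP.
  exact: (@alternation_change p q (fun k l => jac c c' k l w)
    (fun k l => conjc (jac c c' k l w)) (fun I J => tau c I J w)
    (fun K L => tau c' K L (echange c c' w)) (ptau c c' w Ww)).
Qed.

Lemma hform_lincomb p q (I : finType) (a : I -> C) (phi : I -> hcoef B p q) :
  (forall i, hform (phi i)) -> hform (fun c K L w => \sum_i a i * phi i c K L w).
Proof.
move=> H; split.
- move=> c K L; apply: smooth_sum; first exact: edom_open.
  move=> i _; apply: smoothM; first exact: edom_open.
    by apply: smooth_cst; exact: edom_open.
  exact: hform_smooth (H i).
- move=> c w Uw K L s t; rewrite mulr_sumr; apply: eq_bigr => i _.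
  by have [_ -> //] := H i; rewrite mulrCA.
- move=> c c' w Uw c'x f'x K L.
  transitivity (\sum_i \sum_(K' : {ffun 'I_p -> 'I_n}) \sum_(L' : {ffun 'I_q -> 'I_n})
     a i * ((\prod_r jac c c' (K r) (K' r) w) * (\prod_r conjc (jac c c' (L r) (L' r) w)) *
     phi i c' K' L' (echange c c' w))).
    apply: eq_bigr => i _; have [_ _ pi] := H i; rewrite (pi _ _ _ Uw c'x f'x).
    by rewrite mulr_sumr; apply: eq_bigr => K' _; rewrite mulr_sumr.
  rewrite exchange_big; apply: eq_bigr => K' _; rewrite exchange_big; apply: eq_bigr => L' _.
  by rewrite mulr_sumr; apply: eq_bigr => i _; rewrite mulrCA.
Qed.

End Forms.

Section PolarChange.
Context {K : comUnitRingType} {m : nat} {I : finType}.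
Implicit Types (a b : I -> I -> K).

(** Conjugation by [g] is invisible to [polar_det]; multilinearity then extracts the Jacobian
    factors, the holomorphic ones before the antiholomorphic ones. *)
Lemma polar_det_change j (g : 'M[K]_m) a b (A A' : 'I_j -> I -> I -> 'M[K]_m) :
  g \in unitmx ->
  (forall r k l, g *m A r k l =
    (\sum_k' \sum_l' (a k k' * b l l') *: A' r k' l') *m g) ->
  forall P Q : {ffun 'I_j -> I}, polar_det (fun r => A r (P r) (Q r)) =
  \sum_(P' : {ffun 'I_j -> I}) \sum_(Q' : {ffun 'I_j -> I})
    (\prod_r a (P r) (P' r)) * (\prod_r b (Q r) (Q' r)) *
    polar_det (fun r => A' r (P' r) (Q' r)).
Proof.
move=> ug gA P Q.
rewrite (polar_det_conj (A' := fun r => \sum_k' a (P r) k' *: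
  \sum_l' b (Q r) l' *: A' r k' l') ug); last first.
  move=> r; rewrite gA; congr (_ *m _); apply: eq_bigr => k' _.
  by rewrite scaler_sumr; apply: eq_bigr => l' _; rewrite scalerA.
rewrite (polar_det_multilinear (fun r k' => a (P r) k')
  (fun r k' => \sum_l' b (Q r) l' *: A' r k' l')).
apply: eq_bigr => P' _.
rewrite (polar_det_multilinear (fun r l' => b (Q r) l') (fun r l' => A' r (P' r) l')).
by rewrite mulr_sumr; apply: eq_bigr => Q' _; rewrite mulrA.
Qed.

(** A scalar matrix commutes with [g], so the special slot obeys the same conjugation relation as
    the others. *)
Lemma polar_det_change_but q (r0 : 'I_q.+1) (g : 'M[K]_m) a b
    (A A' : 'I_q.+1 -> I -> I -> 'M[K]_m) (x x' : I -> K) :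
  g \in unitmx ->
  (forall r k l, g *m A r k l =
    (\sum_k' \sum_l' (a k k' * b l l') *: A' r k' l') *m g) ->
  (forall k, x k = \sum_k' a k k' * x' k') ->
  forall (P : {ffun 'I_q.+1 -> I}) (Q : {ffun 'I_q -> I}),
  polar_det (fun r => if unlift r0 r is Some r' then A r (P r) (Q r') else (x (P r))%:M) =
  \sum_(P' : {ffun 'I_q.+1 -> I}) \sum_(Q' : {ffun 'I_q -> I})
    (\prod_r a (P r) (P' r)) * (\prod_r b (Q r) (Q' r)) *
    polar_det (fun r => if unlift r0 r is Some r' then A' r (P' r) (Q' r')
                        else (x' (P' r))%:M).
Proof.
move=> ug gA xE P Q.
pose T r k' := if unlift r0 r is Some r' then \sum_l' b (Q r') l' *: A' r k' l' else (x' k')%:M.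
rewrite (polar_det_conj (A' := fun r => \sum_k' a (P r) k' *: T r k') ug); last first.
  move=> r; rewrite /T; case: (unlift r0 r) => [r'|].
    rewrite gA; congr (_ *m _); apply: eq_bigr => k' _.
    by rewrite scaler_sumr; apply: eq_bigr => l' _; rewrite scalerA.
  rewrite scalar_mxC; congr (_ *m _); rewrite xE (raddf_sum (@scalar_mx K m)).
  by apply: eq_bigr => k' _; rewrite scale_scalar_mx.
rewrite (polar_det_multilinear (fun r k' => a (P r) k') T).
apply: eq_bigr => P' _; rewrite /T.
rewrite (eq_polar_det (A' := fun r => if unlift r0 r is Some r' then
    \sum_l' b (Q r') l' *: A' (lift r0 r') (P' (lift r0 r')) l' else (x' (P' r0))%:M)); last first.
  by move=> r; case: unliftP => [r' ->|->].
rewrite (polar_det_multilinear_but r0 (fun r' l' => b (Q r') l')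
   (fun r' l' => A' (lift r0 r') (P' (lift r0 r')) l')).
rewrite mulr_sumr; apply: eq_bigr => Q' _; rewrite mulrA; congr (_ * _).
by apply: eq_polar_det => r; case: unliftP => [r' ->|->].
Qed.

End PolarChange.

(** * Polarized forms and their image under d''^h *)

Section PolarForms.
Context {R : realType} {n : nat} {M : topologicalType}.
Context {X : complex_manifold R n M} {m : nat} {E : M -> lmodType R[i]}.
Context {B : holomorphic_bundle X m E}.
Local Notation C := R[i].
Local Notation coords := 'rV[C]_(n + m).
Implicit Types (c : echart B) (w : coords).

Definition endo_field := echart B -> 'I_n -> 'I_n -> coords -> 'M[C]_m.

(** A (1,1)-form with values in the endomorphisms of the vertical bundle; the law is written as M T
    = T' M to avoid inverses. *)
Definition endo_tensor (T : endo_field) : Prop :=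
  (forall c k l a b, smooth (edom c) (fun w => T c k l w a b)) /\
  (forall c c' w, overlap c c' w -> forall k l,
    fibre_mx (echange c c') w *m T c k l w =
    (\sum_k' \sum_l' (jac c c' k k' w * conjc (jac c c' l l' w)) *:
       T c' k' l' (echange c c' w)) *m fibre_mx (echange c c') w).

Definition covector (al : echart B -> 'I_n -> coords -> C) : Prop :=
  (forall c k, smooth (edom c) (al c k)) /\
  (forall c c' w, overlap c c' w -> forall k,
    al c k w = \sum_k' jac c c' k k' w * al c' k' (echange c c' w)).

Definition polar_form j (T : 'I_j -> endo_field) : hcoef B j j :=
  fun c K L w => polar_det (fun r => T r c (K r) (L r) w).

(** The [q] antiholomorphic indices are distributed by [unlift] over the slots other than [r0]. Slot
    [r0], holding alpha I, has only a holomorphic index, hence the type (q+1, q). *)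
Definition polar_form_but q (r0 : 'I_q.+1) al (T : 'I_q.+1 -> endo_field) : hcoef B q.+1 q :=
  fun c K L w => polar_det (fun r => if unlift r0 r is Some r' then T r c (K r) (L r') w
                                     else (al c (K r) w)%:M).

Lemma smooth_polar_det (U : set coords) j (A : 'I_j -> coords -> 'M[C]_m) : openCN U ->
  (forall r a b, smooth U (fun w => A r w a b)) ->
  smooth U (fun w => polar_det (fun r => A r w)).
Proof.
move=> oU sA; apply: smooth_sum => // s _; apply: smoothM => //; first exact: smooth_cst.
by apply: smooth_sum => // x _; apply: smooth_prod.
Qed.

Lemma vapp_polar_det (U : set coords) j (A : 'I_j -> coords -> 'M[C]_m) b Y w : openCN U ->
  (forall r a b, smooth U (fun w => A r w a b)) -> U w ->
  vapp b Y (fun w => polar_det (fun r => A r w)) w =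
  \sum_r1 polar_det (fun r => if r == r1 then
     \matrix_(a, d) vapp b Y (fun w => A r w a d) w else A r w).
Proof.
move=> oU sA Uw; have sP (s : 'S_j) (x : {ffun 'I_j -> 'I_m}) :
    smooth U (fun w => \prod_r A r w (x r) (x (s r))) by exact: smooth_prod.
have sS (s : 'S_j) : smooth U (fun w =>
    \sum_(x : {ffun 'I_j -> 'I_m}) \prod_r A r w (x r) (x (s r))).
  by apply: smooth_sum.
rewrite /polar_det exchange_big (vapp_sum oU) => [||//]; last first.
  by move=> s _; apply: smoothM => //; exact: smooth_cst.
apply: eq_bigr => s _; rewrite (vappZ oU _ _ _ (sS s) Uw) -mulr_sumr; congr (_ * _).
rewrite exchange_big (vapp_sum oU) => [||//]; last by move=> x _; exact: sP.
apply: eq_bigr => x _; rewrite (vapp_prod oU)//; apply: eq_bigr => r1 _.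
by apply: eq_bigr => r _; case: ifP => _ //; rewrite mxE.
Qed.

Hypothesis uM : forall c c' w, overlap c c' w -> fibre_mx (echange c c') w \in unitmx.

Lemma tensorial_polar_form j (T : 'I_j -> endo_field) :
  (forall r, endo_tensor (T r)) -> tensorial (polar_form T).
Proof.
move=> tT; split=> [c K L|c c' w Ww K L].
  apply: smooth_polar_det; first exact: edom_open.
  by move=> r a b; have [] := tT r.
exact: (polar_det_change (a := fun k k' => jac c c' k k' w)
  (b := fun l l' => conjc (jac c c' l l' w)) (A := fun r k l => T r c k l w)
  (A' := fun r k l => T r c' k l (echange c c' w)) (uM Ww)
  (fun r k l => (tT r).2 c c' w Ww k l) K L).
Qed.

Lemma tensorial_polar_form_but q (r0 : 'I_q.+1) al (T : 'I_q.+1 -> endo_field) :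
  covector al -> (forall r, endo_tensor (T r)) -> tensorial (polar_form_but r0 al T).
Proof.
move=> [sal pal] tT; split=> [c K L|c c' w Ww K L].
  apply: (smooth_polar_det (A := fun r w => if unlift r0 r is Some r' then
    T r c (K r) (L r') w else (al c (K r) w)%:M)); first exact: edom_open.
  move=> r a b; case: (unlift r0 r) => [r'|]; first by have [] := tT r.
  have oU : openCN (edom c) by exact: edom_open.
  apply: (smooth_ext oU _ (smoothM oU (sal c (K r)) (smooth_cst oU (a == b)%:R))).
  by move=> w _; rewrite mxE mulr_natr.
exact: (polar_det_change_but r0 (a := fun k k' => jac c c' k k' w)
  (b := fun l l' => conjc (jac c c' l l' w)) (A := fun r k l => T r c k l w)
  (A' := fun r k l => T r c' k l (echange c c' w)) (x := fun k => al c k w)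
  (x' := fun k => al c' k (echange c c' w)) (uM Ww)
  (fun r k l => (tT r).2 c c' w Ww k l) (pal c c' w Ww) K L).
Qed.

Variable F : forall x : M, E x -> R.

(** The index [k] of d''^h and a permutation of the other [q] indices together form a permutation of
    [q + 1] places. The new index may occupy any place [r0]: moving it there from the front costs
    [(-1) ^+ r0]. *)
Lemma dbarh_alt p q (r0 : 'I_q.+1) (tau : hcoef B p q) c
    (I : {ffun 'I_p -> 'I_n}) (J : {ffun 'I_q.+1 -> 'I_n}) w :
  (forall c I J, smooth (edom c) (tau c I J)) -> edom c w ->
  dbarh F (alt_form tau) c I J w =
  (-1) ^+ p * (-1) ^+ r0 * \sum_(s : 'S_p) \sum_(t : 'S_q.+1) (-1) ^+ s * (-1) ^+ t *
    delta_bar F c (J (t r0))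
      (tau c [ffun r => I (s r)] [ffun r => J (t (lift r0 r))]) w.
Proof.
move=> stau Uw; have oU : openCN (edom c) by exact: edom_open.
rewrite /dbarh -mulrA; congr (_ * _).
have dE k (J' : {ffun 'I_q -> 'I_n}) : delta_bar F c k (alt_form tau c I J') w =
    \sum_(s : 'S_p) \sum_(t : 'S_q) (-1) ^+ s * (-1) ^+ t *
    delta_bar F c k (tau c [ffun r => I (s r)] [ffun r => J' (t r)]) w.
  have V f : delta_bar F c k f w = vapp true (delta_field F c k) f w by [].
  rewrite V /alt_form (vapp_sum oU) => [||//]; last first.
    move=> s _; apply: smooth_sum => // t _; apply: smoothM => //; exact: smooth_cst.
  apply: eq_bigr => s _; rewrite (vapp_sum oU) => [||//]; last first.
    by move=> t _; apply: smoothM => //; exact: smooth_cst.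
  by apply: eq_bigr => t _; rewrite (vappZ oU _ _ _ (stau c _ _) Uw) V.
under eq_bigr => k _ do rewrite dE mulr_sumr.
rewrite exchange_big mulr_sumr; apply: eq_bigr => s _.
rewrite (sum_lift_perm r0) mulr_sumr; apply: eq_bigr => k _.
rewrite !mulr_sumr; apply: eq_bigr => t _.
rewrite lift_perm_id odd_lift_perm.
have -> : [ffun r => [ffun r1 => J (lift k r1)] (t r)] =
    [ffun r => J (lift_perm r0 k t (lift r0 r))].
  by apply/ffunP => r; rewrite !ffunE lift_perm_lift.
have -> : (-1) ^+ (odd r0 (+) odd k (+) t) = (-1) ^+ r0 * (-1) ^+ k * (-1) ^+ t :> C.
  by rewrite !signr_addb !signr_odd.
have := sqrr_sign C r0; rewrite -signr_odd expr2 signr_odd.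
move: (delta_bar _ _ _ _ _) ((-1) ^+ r0) ((-1) ^+ k) ((-1) ^+ s) ((-1) ^+ t) => x y z u v yy.
by transitivity (y * y * (z * u * v * x)); [rewrite yy mul1r; ring|ring].
Qed.

Lemma dbarh_lincomb p q (I : finType) (a : I -> C) (phi : I -> hcoef B p q) :
  (forall i, hform (phi i)) -> forall c w, edom c w -> forall K L,
  dbarh F (fun c K L w => \sum_i a i * phi i c K L w) c K L w =
  \sum_i a i * dbarh F (phi i) c K L w.
Proof.
move=> H c w Uw K L; have oU : openCN (edom c) by exact: edom_open.
have V f k : delta_bar F c k f w = vapp true (delta_field F c k) f w by [].
rewrite /dbarh; under [RHS]eq_bigr => i _ do rewrite mulrCA mulr_sumr.
rewrite -[RHS]mulr_sumr; congr (_ * _); rewrite [RHS]exchange_big.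
apply: eq_bigr => k _; rewrite V (vapp_sum oU) => [||//]; last first.
  move=> i _; apply: smoothM => //; first exact: smooth_cst.
  exact: hform_smooth (H i).
rewrite mulr_sumr; apply: eq_bigr => i _.
by rewrite (vappZ oU _ _ _ (hform_smooth c K _ (H i)) Uw) mulrCA -V.
Qed.

(** Closedness of every matrix entry, expressed as symmetry in the index of differentiation and the
    antiholomorphic index. *)
Definition endo_closed (T : endo_field) : Prop := forall c k l l' a b w, edom c w ->
  delta_bar F c l' (fun w => T c k l w a b) w = delta_bar F c l (fun w => T c k l' w a b) w.

Lemma dbarh_polar_form j (T : 'I_j -> endo_field) c I J w :
  (forall r, endo_tensor (T r)) -> (forall r, endo_closed (T r)) -> edom c w ->
  dbarh F (alt_form (polar_form T)) c I J w = 0.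
Proof.
move=> tT cT Uw; have oU : openCN (edom c) by exact: edom_open.
rewrite (dbarh_alt ord0)//; last by move=> c' I' J'; have [] := tensorial_polar_form tT.
rewrite big1 ?mulr0// => s _.
under eq_bigr => t _.
  have V f k : delta_bar F c k f w = vapp true (delta_field F c k) f w by [].
  rewrite V (vapp_polar_det (A := fun r w => T r c ([ffun r => I (s r)] r)
    ([ffun r => J (t (lift ord0 r))] r) w) true _ oU) => [||//]; last first.
    by move=> r a b; have [] := tT r.
  rewrite -mulrA mulr_sumr mulr_sumr.
  over.
rewrite exchange_big big1// => r1 _; rewrite -mulr_sumr.
(* When the derivative falls on slot [r1], this transposition exchanges its index with the
   antiholomorphic index of that slot; closedness makes the term symmetric. *)
rewrite [X in _ * X](alternating_sum_eq0 (x := ord0) (y := lift ord0 r1)) ?mulr0 ?neq_lift//.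
move=> t; apply: eq_polar_det => r; rewrite !ffunE !permM tpermL.
have [->|rr1] := eqVneq r r1.
  rewrite tpermR; apply/matrixP => a b; rewrite !mxE.
  exact: cT.
by rewrite tpermD ?neq_lift// (inj_eq lift_inj) eq_sym.
Qed.

(** The new index is placed at [r0], the place that lacks an antiholomorphic index, so the
    derivative of alpha I lands there in the right position. The sign combines [(-1) ^+ p] for
    [p = q + 1] with the cost of that placement. *)
Lemma dbarh_polar_form_but q (r0 : 'I_q.+1) al (T : 'I_q.+1 -> endo_field) c I J w :
  covector al -> (forall r, endo_tensor (T r)) -> (forall r, endo_closed (T r)) -> edom c w ->
  dbarh F (alt_form (polar_form_but r0 al T)) c I J w = (-1) ^+ q.+1 * (-1) ^+ r0 *
  alt_form (polar_form (fun r => if r == r0 then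
    fun c k l w => (delta_bar F c l (al c k) w)%:M else T r)) c I J w.
Proof.
move=> cal tT cT Uw; have oU : openCN (edom c) by exact: edom_open.
rewrite (dbarh_alt r0)//; last by move=> c' I' J'; have [] := tensorial_polar_form_but r0 cal tT.
congr (_ * _); apply: eq_bigr => s _.
have V f k : delta_bar F c k f w = vapp true (delta_field F c k) f w by [].
pose A (t : 'S_q.+1) r w : 'M[C]_m := if r == r0 then (al c (I (s r)) w)%:M
   else T r c (I (s r)) (J (t r)) w.
have sA t r a b : smooth (edom c) (fun w => A t r w a b).
  rewrite /A; case: eqP => _; last by have [] := tT r.
  apply: (smooth_ext oU _ (smoothM oU (cal.1 c (I (s r))) (smooth_cst oU (a == b)%:R))).
  by move=> w' _; rewrite mxE mulr_natr.
under eq_bigr => t _.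
  rewrite V (_ : polar_form_but _ _ _ _ _ _ = fun w => polar_det (fun r => A t r w)); last first.
    apply/funext => w'; apply: eq_polar_det => r; rewrite /A !ffunE.
    by case: unliftP => [r' ->|->]; rewrite ?eqxx// eq_sym (negPf (neq_lift _ _)) !ffunE.
  rewrite (vapp_polar_det true _ oU (sA t) Uw) (bigD1 r0)//= mulrDr [X in _ + X]mulr_sumr.
  over.
rewrite big_split /= [X in _ + X]exchange_big [X in _ + X]big1 ?addr0 => [|r1 r1r0].
  apply: eq_bigr => t _; congr (_ * _); apply: eq_polar_det => r.
  rewrite /A !ffunE; have [->|rr0] := eqVneq r r0; last by [].
  apply/matrixP => a b; rewrite !mxE.
  transitivity (vapp true (delta_field F c (J (t r0))) (fun w => (a == b)%:R * al c (I (s r0)) w) w).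
    by apply: (vapp_ext oU) => // w' _; rewrite mxE mulr_natl.
  by rewrite (vappZ oU _ _ _ (cal.1 c _) Uw) mulr_natl V.
(* The derivative falls on a closed slot [r1 != r0]: transposing [r0] and [r1] preserves the term,
   so its alternating sum vanishes. *)
under eq_bigr => t _ do rewrite -mulrA.
rewrite -mulr_sumr [X in _ * X](alternating_sum_eq0 (x := r0) (y := r1)) ?mulr0 1?eq_sym//.
move=> t; apply: eq_polar_det => r; rewrite /A !permM tpermL.
have [->|rr1] := eqVneq r r1.
  apply/matrixP => a b; rewrite !mxE (negPf r1r0) tpermR.
  exact: cT.
by case: eqVneq => // rr0; rewrite tpermD// eq_sym.
Qed.

End PolarForms.

(** * Forms of Chern type *)

Section Cohomologous.
Context {R : realType} {n : nat} {M : topologicalType}.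
Context {X : complex_manifold R n M} {m : nat} {E : M -> lmodType R[i]}.
Context {B : holomorphic_bundle X m E}.
Variable F : forall x : M, E x -> R.
Local Notation C := R[i].
Local Notation coords := 'rV[C]_(n + m).
Implicit Types (c : echart B) (w : coords).

Lemma hexact_lincomb2 p q (a1 a2 : C) (phi phi1 phi2 : hcoef B p q) :
  (forall c w, edom c w -> forall K L,
     phi c K L w = a1 * phi1 c K L w + a2 * phi2 c K L w) ->
  hexact F phi1 -> hexact F phi2 -> hexact F phi.
Proof.
case: q phi phi1 phi2 => [|q] phi phi1 phi2 phiE /=.
  by move=> H1 H2 c w Uw K L; rewrite phiE// H1// H2// /hzero !mulr0 addr0.
move=> [psi1 [h1 E1]] [psi2 [h2 E2]].
pose a b := if b then a1 else a2; pose psi b := if b then psi1 else psi2.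
have hpsi b : hform (psi b) by case: b.
exists (fun c K L w => \sum_b a b * psi b c K L w); split; first exact: hform_lincomb.
by move=> c w Uw K L; rewrite (dbarh_lincomb F a hpsi)// big_bool /= phiE// E1// E2.
Qed.

Lemma hclass_eq p q (phi1 phi2 : hcoef B p q) :
  hexact F (hsub phi1 phi2) -> hclass F phi1 = hclass F phi2.
Proof.
move=> H; apply/seteqP; split=> chi [cchi xchi]; split=> //.
  apply: (hexact_lincomb2 (a1 := 1) (a2 := 1)) xchi H => c w _ K L.
  by rewrite /hsub; ring.
apply: (hexact_lincomb2 (a1 := 1) (a2 := -1)) xchi H => c w _ K L.
by rewrite /hsub; ring.
Qed.

End Cohomologous.

(** * Curvature forms and the primitive of their difference *)

Section Curvature.
Context {R : realType} {n : nat} {M : topologicalType}.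
Context {X : complex_manifold R n M} {m : nat} {E : M -> lmodType R[i]}.
Context {B : holomorphic_bundle X m E}.
Local Notation C := R[i].
Local Notation coords := 'rV[C]_(n + m).
Implicit Types (c : echart B) (w : coords) (F : forall x : M, E x -> R).

Definition curvature_mx F : endo_field (B := B) :=
  fun c k l w => \matrix_(a, b) Omega F c a b k l w.

(** The normalization of the Chern form times the sign of [wedge11], which comes from moving every
    dz to the left. *)
Definition chern_coef j : C :=
  (-1) ^+ j / ((2 * (pi : R)%:C * 'i%C) ^+ j * j`!%:R) * (-1) ^+ 'C(j, 2).

(** Three independent permutations occur: the one in the Kronecker symbol becomes the sum in
    [polar_det], and the two of [wedge11] become the alternations in [alt_form]. *)
Lemma chern_formE F j c K L w : chern_form B F j c K L w =
  chern_coef j * alt_form (polar_form (fun _ => curvature_mx F)) c K L w.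
Proof.
rewrite /chern_form /gen_kronecker gen_kroneckerE /chern_coef -[RHS]mulrA; congr (_ * _).
rewrite /wedge11; under eq_bigr => s _ do rewrite -mulr_sumr mulrCA.
rewrite -mulr_sumr; congr (_ * _); rewrite /alt_form /polar_form /polar_det.
under eq_bigr => s _ do rewrite exchange_big mulr_sumr.
rewrite exchange_big; apply: eq_bigr => s _.
under eq_bigr => s' _ do rewrite exchange_big mulr_sumr.
rewrite exchange_big; apply: eq_bigr => t _.
rewrite mulr_sumr; apply: eq_bigr => s' _.
rewrite -mulr_sumr mulrCA; congr (_ * (_ * _)).
by apply: eq_bigr => a _; apply: eq_bigr => r _; rewrite !(mxE, ffunE).
Qed.

Variable F : forall x : M, E x -> R.
Hypothesis hF : complex_finsler B F.

Lemma endo_tensor_curvature_mx F1 : complex_finsler B F1 -> endo_tensor (curvature_mx F1).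
Proof.
move=> hF1; split=> [c k l a b|c c' w Ww k l].
  have oU : openCN (edom c) by exact: edom_open.
  have H := smoothN oU (smooth_vapp oU true (smooth_delta hF1 c l) (smooth_Lcoef hF1 c a b k)).
  by apply: (smooth_ext oU _ H) => w _; rewrite mxE.
apply/matrixP => a d; rewrite [LHS]mxE [RHS]mxE.
transitivity (\sum_b dmap (echange c c') (rshift n b) (rshift n a) w * Omega F1 c b d k l w).
  by apply: eq_bigr => b _; rewrite !mxE.
rewrite (Omega_echange hF1 _ _ _ _ Ww).
under [RHS]eq_bigr => b _ do rewrite summxE mulr_suml.
rewrite [RHS]exchange_big; apply: eq_bigr => k' _.
under [RHS]eq_bigr => b _ do rewrite summxE mulr_suml.
rewrite [RHS]exchange_big; apply: eq_bigr => l' _.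
by rewrite mulr_sumr; apply: eq_bigr => b _; rewrite !mxE mulrA.
Qed.

(** Closedness from a potential [L], because the fields delta_bar of F commute. Keeping [L]
    arbitrary lets the connection coefficients of the other metric serve as potential too. *)
Lemma delta_bar_exact c (L : coords -> C) (Om : 'I_n -> coords -> C) l l' w :
  smooth (edom c) L -> (forall i w, edom c w -> Om i w = - delta_bar F c i L w) ->
  edom c w -> delta_bar F c l' (Om l) w = delta_bar F c l (Om l') w.
Proof.
move=> sL OmE Uw; have oU : openCN (edom c) by exact: edom_open.
have dE i i' : delta_bar F c i' (Om i) w =
    - vapp true (delta_field F c i') (vapp true (delta_field F c i) L) w.
  apply: (etrans (vapp_ext oU true (delta_field F c i') Uw (OmE i))).
  exact: (vappN oU true _ (smooth_vapp oU true (smooth_delta hF c i) sL) Uw).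
have dd := delta_comm hF true l' l sL Uw.
exact: (etrans (dE l l') (etrans (congr1 (fun x => - x) dd) (esym (dE l' l)))).
Qed.

Lemma endo_closed_curvature_mx : endo_closed F (curvature_mx F).
Proof.
move=> c k l l' a b w Uw.
apply: (delta_bar_exact (Om := fun l w => curvature_mx F c k l w a b) l l'
  (smooth_Lcoef hF c a b k) _ Uw) => i w' _.
by rewrite mxE.
Qed.

Variables (Ft : forall x : M, E x -> R) (sigma : M -> R).
Hypothesis hFt : complex_finsler B Ft.
Hypothesis hFtE : forall x (v : E x), Ft v ^+ 2 = expR (sigma x) * F v ^+ 2.

Lemma endo_closed_curvature_mx_conf : endo_closed F (curvature_mx Ft).
Proof.
move=> c k l l' a b w Uw.
apply: (delta_bar_exact (Om := fun l w => curvature_mx Ft c k l w a b) l l'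
  (smooth_Lcoef hFt c a b k) _ Uw) => i w' Uw'.
by rewrite mxE (Omega_conf hF hFt hFtE).
Qed.

Lemma delta_bar_add_scaled c l (L L' al : coords -> C) (x : C) w :
  smooth (edom c) L -> smooth (edom c) al ->
  (forall w, edom c w -> L' w = L w + x * al w) -> edom c w ->
  delta_bar F c l L' w = delta_bar F c l L w + x * delta_bar F c l al w.
Proof.
move=> sL sal LE Uw; have oU : openCN (edom c) by exact: edom_open.
have sxa : smooth (edom c) (fun w => x * al w).
  by apply: smoothM => //; exact: smooth_cst.
apply: (etrans (vapp_ext oU true (delta_field F c l) Uw LE)).
apply: (etrans (vappD true (delta_field F c l) sL sxa Uw)).
exact: (congr1 (fun y => _ + y) (vappZ oU true (delta_field F c l) x sal Uw)).
Qed.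

(** Curvature is minus the delta_bar of L, and L~ = L + alpha I; hence the correction appears with a
    plus sign on the side of F~. *)
Lemma curvature_mx_conf c k l w : edom c w -> curvature_mx F c k l w =
  curvature_mx Ft c k l w + (delta_bar F c l (conf_form sigma c k) w)%:M.
Proof.
move=> Uw; apply/matrixP => a b.
rewrite [LHS]mxE [RHS]mxE [X in _ = X + _]mxE [X in _ = _ + X]mxE.
rewrite (Omega_conf hF hFt hFtE)//.
have H := delta_bar_add_scaled l (smooth_Lcoef hF c a b k)
  (smooth_conf_form hF hFt hFtE c k)
  (fun w' Uw' => @Lcoef_conf _ _ _ _ _ _ _ _ _ _ hF hFt hFtE c a b k w' Uw') Uw.
apply: (etrans _ (congr1 (fun y => - y + _) (esym H))); rewrite /Omega.
move: (delta_bar _ _ _ _ _) (delta_bar _ _ _ _ _) => x y.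
by rewrite -[x *+ _]mulr_natl opprD addrNK.
Qed.

Lemma covector_conf_form : covector (conf_form sigma : echart B -> 'I_n -> coords -> C).
Proof.
split=> [c k|c c' w Ww k]; first exact: (smooth_conf_form hF hFt hFtE).
exact: (@conf_form_echange _ _ _ _ _ _ _ c c' F Ft sigma k w hF hFt hFtE Ww).
Qed.

(** Interpolates from F at [i = 0] to F~ at [i = j]; passing from [i] to [i + 1] alters slot [i]
    alone. *)
Definition mixed_curvature j (i : nat) (r : 'I_j) : endo_field :=
  if (r < i)%N then curvature_mx Ft else curvature_mx F.

Lemma endo_tensor_mixed j i (r : 'I_j) : endo_tensor (mixed_curvature i r).
Proof. by rewrite /mixed_curvature; case: ifP => _; exact: endo_tensor_curvature_mx. Qed.

Lemma endo_closed_mixed j i (r : 'I_j) : endo_closed F (mixed_curvature i r).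
Proof.
rewrite /mixed_curvature; case: ifP => _; first exact: endo_closed_curvature_mx_conf.
exact: endo_closed_curvature_mx.
Qed.

Lemma polar_form_telescope j c K L w : edom c w ->
  polar_form (fun _ : 'I_j => curvature_mx F) c K L w -
  polar_form (fun _ : 'I_j => curvature_mx Ft) c K L w =
  \sum_(i < j) polar_form (fun r => if r == i then
    fun c k l w => (delta_bar F c l (conf_form sigma c k) w)%:M
    else mixed_curvature i r) c K L w.
Proof.
move=> Uw; pose P i := polar_form (mixed_curvature (j := j) i) c K L w.
have P0 : polar_form (fun _ : 'I_j => curvature_mx F) c K L w = P 0 by [].
have Pj : polar_form (fun _ : 'I_j => curvature_mx Ft) c K L w = P j.
  by apply: eq_polar_det => r; rewrite /mixed_curvature ltn_ord.
apply: (etrans (congr2 (fun x y => x - y) P0 Pj)).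
rewrite -opprB -(telescope_sumr P (leq0n j)) big_mkord -sumrN.
apply: eq_bigr => i _; rewrite opprB; apply/eqP; rewrite subr_eq addrC; apply/eqP.
apply: (polar_detD (r0 := i)) => [|r|r].
- by rewrite /mixed_curvature ltnS leqnn ltnn eqxx; exact: curvature_mx_conf.
- by rewrite -val_eqE => ri; rewrite /mixed_curvature ltnS leq_eqVlt (negPf ri).
- by move=> /negPf ->.
Qed.

Lemma alt_form_telescope j c K L w : edom c w ->
  alt_form (polar_form (fun _ : 'I_j => curvature_mx F)) c K L w -
  alt_form (polar_form (fun _ : 'I_j => curvature_mx Ft)) c K L w =
  \sum_(i < j) alt_form (polar_form (fun r => if r == i then
    fun c k l w => (delta_bar F c l (conf_form sigma c k) w)%:M
    else mixed_curvature i r)) c K L w.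
Proof.
move=> Uw; rewrite /alt_form -sumrB exchange_big; apply: eq_bigr => s _.
rewrite -sumrB exchange_big; apply: eq_bigr => t _.
by rewrite -mulrBr (polar_form_telescope _ _ Uw) mulr_sumr.
Qed.

(** A sum with one term, so that the scalar factor is covered by [hform_lincomb] and
    [dbarh_lincomb]. *)
Lemma chern_form_lincomb F1 j : chern_form B F1 j = fun c K L w =>
  \sum_(i < 1) chern_coef j * alt_form (polar_form (fun _ => curvature_mx F1)) c K L w.
Proof. by do 4 (apply/funext => ?); rewrite big_ord1 chern_formE. Qed.

Lemma hclosed_chern_form F1 j : complex_finsler B F1 -> endo_closed F (curvature_mx F1) ->
  hclosed F (chern_form B F1 j).
Proof.
move=> hF1 cF1; have uM c c' w (Ww : overlap c c' w) := echange_unit hF Ww.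
have tF1 := endo_tensor_curvature_mx hF1.
have hA : hform (alt_form (polar_form (fun _ : 'I_j => curvature_mx F1))).
  by apply: hform_alt; exact: (tensorial_polar_form uM).
rewrite chern_form_lincomb; split; first exact: hform_lincomb.
move=> c w Uw K L; rewrite (dbarh_lincomb F _ (fun=> hA))// big1// => i _.
by rewrite (dbarh_polar_form uM)// mulr0.
Qed.

Lemma hexact_chern_form_conf q :
  hexact F (hsub (chern_form B Ft q.+1) (chern_form B F q.+1)).
Proof.
have uM c c' w (Ww : overlap c c' w) := echange_unit hF Ww.
pose phi (i : 'I_q.+1) := alt_form (polar_form_but i
  (conf_form sigma : echart B -> _) (mixed_curvature i)).
have hphi (i : 'I_q.+1) : hform (phi i).
  apply: hform_alt; apply: (tensorial_polar_form_but uM); first exact: covector_conf_form.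
  exact: endo_tensor_mixed.
(* The minus sign reverses the telescope, which computes F minus F~ whereas [hsub] takes F~ minus F.
   The two other signs cancel those of [dbarh_polar_form_but], their squares being 1. *)
pose a (i : 'I_q.+1) : C := - chern_coef q.+1 * ((-1) ^+ q.+1 * (-1) ^+ i).
exists (fun c K L w => \sum_i a i * phi i c K L w); split; first exact: hform_lincomb.
move=> c w Uw K L; rewrite (dbarh_lincomb F a hphi)//.
apply: (etrans (congr2 (fun x y => x - y) (chern_formE Ft c K L w) (chern_formE F c K L w))).
have T := alt_form_telescope K L Uw.
apply: (etrans (y := - chern_coef q.+1 * 
  (alt_form (polar_form (fun _ : 'I_q.+1 => curvature_mx F)) c K L w -
  alt_form (polar_form (fun _ : 'I_q.+1 => curvature_mx Ft)) c K L w))).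
  have sub (k x y : C) : k * x - k * y = - k * (y - x) by ring.
  exact: sub.
rewrite T mulr_sumr; apply: eq_bigr => i _.
have P := dbarh_polar_form_but uM i K L covector_conf_form
  (@endo_tensor_mixed q.+1 i) (@endo_closed_mixed q.+1 i) Uw.
apply: (etrans _ (congr1 (fun x => a i * x) (esym P))); rewrite /a.
have := sqrr_sign C q.+1; have := sqrr_sign C i.
move: (alt_form _ _ _ _ _) ((-1) ^+ q.+1) ((-1) ^+ i) (chern_coef q.+1) => x s t k tt ss.
transitivity (- k * (s ^+ 2 * t ^+ 2 * x)); last by ring.
by rewrite ss tt !mul1r.
Qed.

End Curvature.

Theorem proposition3 (R : realType) (n m : nat) (M : topologicalType)
    (X : complex_manifold R n M) (E : M -> lmodType R[i])
    (B : holomorphic_bundle X m E)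
    (F Ft : forall x : M, E x -> R) (sigma : M -> R)
    (hF : complex_finsler B F) (hsigma : smooth_on_manifold X sigma)
    (hFt : complex_finsler B Ft)
    (hFtE : forall (x : M) (v : E x), Ft x v ^+ 2 = expR (sigma x) * F x v ^+ 2)
    (j : nat) (hj : (1 <= j <= m)%N) :
  [/\ hclosed F (chern_form B F j),
      hclosed F (chern_form B Ft j)
    & chern_class B F Ft j = chern_class B F F j].
Proof.
split.
- by apply: hclosed_chern_form; [exact: hF|exact: hF|exact: endo_closed_curvature_mx].
- apply: hclosed_chern_form; [exact: hF|exact: hFt|].
  exact: (endo_closed_curvature_mx_conf hF hFt hFtE).
(* In positive degree [j = q + 1] the exactness predicate asks for a primitive of type (q+1, q). *)
- apply: hclass_eq; case: j hj => [//|q] _.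
  exact: (hexact_chern_form_conf hF hFt hFtE).
Qed.
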